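(* Let $\beta\in(0,1)$ and let $\mathrm M_{\mathrm i\beta}$ be the imaginary Gaussian multiplicative chaos on $\mathbb T$ associated with the exactly log-correlated field $X$ on the circle. Then, almost surely, $\mathrm M_{\mathrm i\beta}\notin H^{-\beta^2/2}(\mathbb T)$.
   Context: $\mathbb T=\mathbb R/2\pi\mathbb Z$. $X$ is the centered real Gaussian random distribution on $\mathbb T$ with covariance $\mathbb E[X_\theta X_{\theta'}]=\log\frac{1}{|e^{\mathrm i\theta}-e^{\mathrm i\theta'}|}$ (equivalently, in law, $X=\sum_{n\ge1}n^{-1/2}(A_n\cos(n\cdot)+B_n\sin(n\cdot))$ with $(A_n,B_n)_{n\ge 1}$ i.i.d. standard real Gaussians, the series converging in $\mathcal D'(\mathbb T)$). For $u\in\mathcal D'(\mathbb T)$ set $\widehat u(n)=\frac1{2\pi}\langle u,e^{-\mathrm i n\theta}\rangle$, $n\in\mathbb Z$, and for $s\in\mathbb R$ let $H^s(\mathbb T)=\{u\in\mathcal D'(\mathbb T):\|u\|_{H^s(\mathbb T)}^2=\sum_{n\in\mathbb Z}(1+n^2)^s|\widehat u(n)|^2<\infty\}$. Let $\varphi_\varepsilon=\frac1\varepsilon\varphi(\frac{\cdot}{\varepsilon})$ with $\varphi$ a smooth, nonnegative, even function supported in $[-1,1]$ with $\int\varphi=1$, and $X_\varepsilon=\varphi_\varepsilon*X$. The chaos $\mathrm M_{\mathrm i\beta}$ is the limit in probability, as $\varepsilon\to0$, in $H^s(\mathbb T)$ for every $s<-1/2$, of the random functions \[ \theta\mapsto\exp\Big(\mathrm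 i\beta X_\varepsilon(\theta)+\tfrac{\beta^2}{2}\mathbb E[X_\varepsilon(\theta)^2]\Big) \] (identified with distributions $\langle f,\psi\rangle=\int_{\mathbb T} f\psi\,\mathrm d\theta$); this limit is known to exist. *)

(* Defs.v *)
From HB Require Import structures.
From mathcomp Require Import all_boot all_order all_algebra.
From mathcomp Require Import all_classical all_reals all_analysis.
From mathcomp.real_closed Require Import complex.
Set Implicit Arguments.
Unset Strict Implicit.
Unset Printing Implicit Defensive.
Import Order.TTheory GRing.Theory Num.Theory.
Import numFieldNormedType.Exports.
Import ComplexField.
Local Open Scope classical_set_scope.
Local Open Scope complex_scope.
Local Open Scope ring_scope.

(* Functions on the circle T = R/2piZ are 2pi-periodic functions on R.
   A distribution on T is represented by a functional on all functions
   R -> R[i]; only its values on smooth 2pi-periodic functions matter. *)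

Section complex_valued.
Context {R : realType}.
Implicit Types (f : R -> R[i]) (z : R[i]).

Definition cexp z : R[i] :=
  (expR (complex.Re z) * cos (complex.Im z)) +i*
  (expR (complex.Re z) * sin (complex.Im z)).

Definition cintegral (D : set R) f : R[i] :=
  (\int[lebesgue_measure]_(x in D) complex.Re (f x)) +i*
  (\int[lebesgue_measure]_(x in D) complex.Im (f x)).

Definition smooth (g : R -> R) :=
  forall (k : nat) (x : R), derivable (derive1n k g) x 1.

Definition csmooth f :=
  smooth (fun x => complex.Re (f x)) /\ smooth (fun x => complex.Im (f x)).

Definition cderive1n (k : nat) f (x : R) : R[i] :=
  derive1n k (fun y => complex.Re (f y)) x +i*
  derive1n k (fun y => complex.Im (f y)) x.

End complex_valued.

Section distributions_on_the_circle.
Context {R : realType}.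
Implicit Types (psi : R -> R[i]) (u : (R -> R[i]) -> R[i]).

Definition test_function : set (R -> R[i]) :=
  [set psi | csmooth psi /\ periodic psi (pi *+ 2)].

(* The seminorms of order at most N generating the Frechet topology of
   C^oo(T). *)
Definition Cseminorm (N : nat) psi : R :=
  \sum_(k < N.+1) sup [set Normc.normc (cderive1n k psi x) | x in [set: R]].

Definition circle_distribution : set ((R -> R[i]) -> R[i]) :=
  [set u | (forall (a : R[i]) psi1 psi2,
              test_function psi1 -> test_function psi2 ->
              u (fun x => a * psi1 x + psi2 x) = a * u psi1 + u psi2) /\
           (exists (N : nat) (c : R), forall psi, test_function psi ->
              Normc.normc (u psi) <= c * Cseminorm N psi)].

Definition real_distribution u :=
  circle_distribution u /\
  forall psi : R -> R, test_function (fun x => (psi x)%:C) ->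
    complex.Im (u (fun x => (psi x)%:C)) = 0.

Definition function_distribution (f : R -> R[i]) : (R -> R[i]) -> R[i] :=
  fun psi => cintegral `[0, pi *+ 2] (fun x => f x * psi x).

Definition fourier_coef u (n : int) : R[i] :=
  ((pi *+ 2)^-1)%:C * u (fun x => cexp (0 -i* (n%:~R * x))).

Definition sobolev_norm2 (s : R) u : \bar R :=
  \esum_(n in [set: int])
    ((1 + n%:~R ^+ 2) `^ s * Normc.normc (fourier_coef u n) ^+ 2)%:E.

Definition sobolev_norm (s : R) u : \bar R :=
  poweR (sobolev_norm2 s u) 2^-1.

Definition sobolev_space (s : R) : set ((R -> R[i]) -> R[i]) :=
  [set u | circle_distribution u /\ (sobolev_norm2 s u < +oo)%E].

(* The function y |-> phi_eps (x - y) on T, where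
   phi_eps = eps^-1 phi (. / eps); for compactly supported phi the sum over
   periods has finitely many nonzero terms. *)
Definition mollifier_kernel (phi : R -> R) (eps x y : R) : R :=
  \sum_(k \in [set: int]) eps^-1 * phi ((x - y + pi *+ 2 * k%:~R) / eps).

Definition mollify (phi : R -> R) (eps : R) u (x : R) : R[i] :=
  u (fun y => (mollifier_kernel phi eps x y)%:C).

Definition mollifier (phi : R -> R) :=
  [/\ smooth phi,
      forall x, 0 <= phi x,
      forall x, phi (- x) = phi x,
      forall x, 1 < `|x| -> phi x = 0 &
      (\int[lebesgue_measure]_x (phi x)%:E)%E = 1%E].

End distributions_on_the_circle.

Section random_distributions.
Context {R : realType} {d : measure_display} {Omega : measurableType d}.
Variable P : probability Omega R.
Implicit Types (X M : Omega -> (R -> R[i]) -> R[i]).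

Definition random_distribution X :=
  (forall w, circle_distribution (X w)) /\
  (forall psi, test_function psi ->
     measurable_fun [set: Omega] (fun w => complex.Re (X w psi)) /\
     measurable_fun [set: Omega] (fun w => complex.Im (X w psi))).

(* The Dirac mass at 0 is the degenerate centered Gaussian law;
   the library's normal_prob 0 0 is a different, junk value. *)
Definition centered_gaussian (Y : Omega -> R) :=
  measurable_fun [set: Omega] Y /\
  exists sigma : R, forall A : set R, measurable A ->
    P (Y @^-1` A) = if sigma == 0 then \d_(0 : R) A else normal_prob 0 sigma A.

Definition log_kernel (x y : R) : R :=
  ln ((Normc.normc (cexp (0 +i* x) - cexp (0 +i* y)))^-1).

(* Since X is linear in the test function, requiring each <X, psi> to be
   Gaussian makes the whole family (<X, psi>)_psi jointly Gaussian. *)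
Definition log_correlated_field X :=
  [/\ random_distribution X,
      forall w, real_distribution (X w),
      forall psi : R -> R, test_function (fun x => (psi x)%:C) ->
        centered_gaussian (fun w => complex.Re (X w (fun x => (psi x)%:C))) &
      forall psi1 psi2 : R -> R,
        test_function (fun x => (psi1 x)%:C) ->
        test_function (fun x => (psi2 x)%:C) ->
        ('E_P[fun w => (complex.Re (X w (fun x => (psi1 x)%:C)) *
                        complex.Re (X w (fun x => (psi2 x)%:C)))%R] =
         (\int[lebesgue_measure]_(x in `[0%R, (pi *+ 2)%R])
            \int[lebesgue_measure]_(y in `[0%R, (pi *+ 2)%R])
              (log_kernel x y * psi1 x * psi2 y))%R%:E)%E].

Definition chaos_approx (beta : R) (phi : R -> R) X (eps : R) (w : Omega)
    (x : R) : R[i] :=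
  let Xeps := fun w' => complex.Re (mollify phi eps (X w') x) in
  cexp ((beta ^+ 2 / 2 * fine ('E_P[fun w' => (Xeps w' ^+ 2)%R])%E) +i*
        (beta * Xeps w)).

Definition imaginary_chaos (beta : R) (phi : R -> R) X M :=
  random_distribution M /\
  forall s : R, s < - 2^-1 -> forall eta : R, 0 < eta ->
    P [set w | (eta%:E < sobolev_norm s (fun psi =>
                 (function_distribution (chaos_approx beta phi X eps w) psi
                  - M w psi)%R))%E] @[eps --> 0^'+] --> 0%E.

End random_distributions.

(* Main.v *)
(* Put s = beta^2/2. The idea is to test M against the conjugate of
   G_delta = delta^s exp(i beta X_delta). Since X_delta oscillates at scale
   delta, E ||G_delta||_{H^s}^2 stays bounded, while |G_delta| = delta^s tends
   to 0 uniformly; if M had finite H^{-s} norm, the low frequencies of M would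
   therefore pair with G_delta to o(1), and the high ones to at most a small
   tail norm times O(1). On the other hand the pairing of conj(G_delta) with
   the approximation M_eps, eps << delta, has expectation bounded below and
   variance tending to 0: its covariance kernel exp(beta^2 Q) - 1 tends to 0 off
   the diagonal and is dominated by chord^{-beta^2}, which is integrable because
   beta < 1. On the event that the partial sums of the H^{-s} norm are at most
   L, with a tail beyond L of size at most tau^2, both facts together bound
   the probability by K tau, uniformly in L. Letting L tend to infinity and then
   tau to 0 shows that the H^{-s} norm is almost surely infinite.

   All pairings are computed on the grid 2 pi j / J by discrete Fourier
   analysis, and J tends to infinity last. Only Riemann sums of Lipschitz
   functions are compared with integrals, so that no joint measurability of X
   in (omega, theta) is needed. *)
Require Import Defs.
From HB Require Import structures.
From mathcomp Require Import all_boot all_order all_algebra.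
From mathcomp Require Import all_classical all_reals all_analysis.
From mathcomp.real_closed Require Import complex.
From mathcomp Require Import measurable_realfun ring lra zify.
Set Implicit Arguments.
Unset Strict Implicit.
Unset Printing Implicit Defensive.
Import Order.TTheory GRing.Theory Num.Theory.
Import numFieldNormedType.Exports.
Local Open Scope classical_set_scope.
Local Open Scope complex_scope.
Local Open Scope ring_scope.

(** * Gaussian characteristic function *)

(** In the code, delta is [t] and eps is [e]. The H^s norm of G_delta is of order 1 because its L^2
    norm is delta^s, its gradient has expected square of order delta^(2 s - 2), and the two are
    interpolated at frequency 1/delta. The pairing has mean of order 1 because E[X_eps X_delta] and
    E[X_delta^2] are both - ln delta + O(1) and enter the exponent with factors 2 s and - s: the
    prefactor delta^s is cancelled, and E[X_eps^2] drops out.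

    Cauchy-Schwarz is always used in the form x y <= (k^-1 x^2 + k y^2) / 2 with a deterministic k.
    The pathwise bound on the event is then linear in the squared deviation of the pairing, the
    energy of G_delta and the aliasing error, so it can be integrated directly; no further events on
    which these quantities are small have to be intersected. Convergence in probability of M_eps to
    M enters once, in H^-1, at a single eps chosen after delta. *)

Section integrable_real_functions.
Context d (T : measurableType d) {R : realType} (mu : {measure set T -> \bar R}).
Variable D : set T.
Hypothesis mD : measurable D.
Implicit Types f g : T -> R.

Lemma integrable_realD f g : mu.-integrable D (EFin \o f) ->
  mu.-integrable D (EFin \o g) -> mu.-integrable D (EFin \o (fun x => f x + g x)).
Proof.
move=> fi gi; rewrite (_ : _ \o _ = (EFin \o f) \+ (EFin \o g))%E//.
exact: integrableD.
Qed.

Lemma integrable_realZ k f : mu.-integrable D (EFin \o f) ->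
  mu.-integrable D (EFin \o (fun x => k * f x)).
Proof.
move=> fi; rewrite (_ : _ \o _ = (fun x => k%:E * (EFin \o f) x)%E)//.
exact: integrableZl.
Qed.

Lemma integrable_realB f g : mu.-integrable D (EFin \o f) ->
  mu.-integrable D (EFin \o g) -> mu.-integrable D (EFin \o (fun x => f x - g x)).
Proof.
move=> fi gi; rewrite (_ : _ \o _ = (EFin \o f) \- (EFin \o g))%E//.
exact: integrableB.
Qed.

End integrable_real_functions.

Section integral_of_derivative.
Context {R : realType}.
Notation mu := (@lebesgue_measure R).

Lemma cvg_symmetric_itv (x : R) : \forall n \near \oo, x \in `[- n%:R, n%:R].
Proof.
near=> n; rewrite in_itv/= -ler_norml ltW//.
near: n; exact: nbhs_infty_gtr.
Unshelve. all: by end_near. Qed.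

(** The fundamental theorem on [[-n, n]] combined with dominated convergence. Decay of [F] along the
    integers suffices, since integrability of [f] already provides the limit. This is the form in
    which Gaussian integration by parts is used. *)
Lemma Rintegral_derive_eq0 (f F : R -> R) :
  (forall x : R, is_derive x (1 : R) F (f x)) -> continuous f ->
  mu.-integrable setT (EFin \o f) ->
  F n%:R @[n --> \oo] --> (0 : R) -> F (- n%:R) @[n --> \oo] --> (0 : R) ->
  \int[mu]_x f x = 0.
Proof.
move=> dF cf intf Fy FNy.
pose f_ n := fun x => ((f \_ `[- n%:R, n%:R]) x)%:E : \bar R.
have mf : measurable_fun setT f by exact: continuous_measurable_fun.
have h1 : (\int[mu]_x f_ n x)%E @[n --> \oo] --> (\int[mu]_x (f x)%:E)%E.
  apply: (@dominated_cvg _ _ _ mu setT _ f_ _ (fun x => `|f x|%:E)) => //.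
  - move=> n; apply/measurable_EFinP/measurable_restrict => //.
    by rewrite setTI; exact: measurable_funTS.
  - move=> x _; apply: cvg_near_cst.
    have := cvg_symmetric_itv x; apply: filterS => n xn.
    by rewrite /f_ patchE mem_set.
  - exact: (integrable_norm intf).
  - move=> n x _; rewrite /f_ /= lee_fin patchE; case: ifPn => // _.
    by rewrite normr0.
have h2 : (\int[mu]_x f_ n x)%E @[n --> \oo] --> (0 : \bar R).
  have -> : (0 : \bar R) = (0 - 0)%:E by rewrite subr0.
  apply: (@cvg_trans _ ((fun n : nat => (F n%:R - F (- n%:R))%:E) @ \oo)); last first.
    by apply: cvg_EFin; [exact: nearW | exact: cvgB Fy FNy].
  apply: near_eq_cvg; near=> n.
  rewrite /f_ /=.
  have n0 : - n%:R < n%:R :> R.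
    by rewrite -subr_gt0 opprK -natrD ltr0n addn_gt0; apply/orP; left; near: n; exists 1%N.
  have := @continuous_FTC2 R f F _ _ n0.
  rewrite EFinB => <-.
  - rewrite [in LHS]integral_mkcond; apply: eq_integral => x _ /=.
    by rewrite !patchE; case: ifPn.
  - by apply: continuous_subspaceT => x; exact: cf.
  - split.
    + by move=> x _; case: (dF x).
    + apply: cvg_at_right_filter.
      by apply/differentiable_continuous/derivable1_diffP; case: (dF (- n%:R)).
    + apply: cvg_at_left_filter.
      by apply/differentiable_continuous/derivable1_diffP; case: (dF n%:R).
  - by move=> x _; rewrite derive1E; case: (dF x).
by rewrite /Rintegral (cvg_unique _ h1 h2).
Unshelve. all: by end_near. Qed.

End integral_of_derivative.

Section normal_density_integral.
Context {R : realType}.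
Notation mu := (@lebesgue_measure R).

(** The Radon-Nikodym derivative of [normal_prob] agrees almost everywhere with [normal_pdf], as
    both have the same integral over every measurable set. *)
Lemma integral_normal_prob (s : R) (f : R -> R) :
  (normal_prob 0 s).-integrable setT (EFin \o f) ->
  (\int[normal_prob 0 s]_x (f x)%:E)%E =
  (\int[mu]_x (f x * normal_pdf 0 s x)%:E)%E.
Proof.
move=> intf.
have mf := measurable_int _ intf.
rewrite -(Radon_Nikodym_change_of_variables (normal_prob_dominates 0 s))//=.
under [RHS]eq_integral do rewrite EFinM.
apply: ae_eq_integral => //.
- apply: emeasurable_funM => //; apply: (measurable_int mu).
  by apply: Radon_Nikodym_integrable; exact: normal_prob_dominates.
- apply: emeasurable_funM => //=; apply/measurableT_comp => //=.
  exact: measurable_normal_pdf.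
- apply: ae_eqe_mul2l => /=.
  rewrite Radon_NikodymE//=; first exact: normal_prob_dominates.
  move=> abmu.
  case: cid => /= h [h1 h2 h3].
  apply: integral_ae_eq => //=.
  + by apply/measurableT_comp =>//; exact: measurable_normal_pdf.
  + by move=> E E01 mE; rewrite -h3.
Qed.

End normal_density_integral.

Section normal_characteristic_function.
Context {R : realType}.
Notation mu := (@lebesgue_measure R).

Lemma cvg0_le_inv_nat (D : R) (u : nat -> R) :
  (forall n, (0 < n)%N -> `|u n| <= D / n%:R) -> u n @[n --> \oo] --> (0 : R).
Proof.
move=> uD; apply/cvgrPdist_le => e e0; near=> n.
have n0 : (0 < n)%N by near: n; exists 1%N.
rewrite sub0r normrN (le_trans (uD _ n0))// ler_pdivrMr ?ltr0n// mulrC -ler_pdivrMr//.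
near: n; exact: nbhs_infty_ger.
Unshelve. all: by end_near. Qed.

Variable s : R.
Hypothesis s0 : s != 0.
Local Notation p := (normal_pdf 0 s).

Let pE x : p x = normal_peak s * expR (- x ^+ 2 / (s ^+ 2 *+ 2)).
Proof. by rewrite /normal_pdf (negbTE s0) /normal_fun subr0. Qed.

Let is_derive_p (x : R) : is_derive x (1 : R) p (- (x / s ^+ 2) * p x).
Proof.
have -> : p = (fun x => normal_peak s * expR (- x ^+ 2 / (s ^+ 2 *+ 2))).
  by apply/funext => y; rewrite pE.
apply: is_derive_eq; rewrite /GRing.scale/=.
by field.
Qed.

Let pge0 x : 0 <= p x. Proof. exact: normal_pdf_ge0. Qed.

Let continuous_p : continuous p. Proof. exact: continuous_normal_pdf. Qed.

(** Half of the Gaussian exponent absorbs the square through u <= exp u with u = x^2 / (4 s^2); the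
    other half is the density with doubled variance. Both the integrability of quadratic growth and
    the decay at infinity follow from this. *)
Let sqr_pdf_le : exists2 C : R, 0 <= C & forall x, x ^+ 2 * p x <= C * normal_pdf 0 (s * Num.sqrt 2) x.
Proof.
exists (normal_peak s * (normal_peak (s * Num.sqrt 2))^-1 * (s ^+ 2 *+ 4)).
  by rewrite !mulr_ge0// ?invr_ge0 ?normal_peak_ge0// mulrn_wge0// sqr_ge0.
move=> x; have s20 : s * Num.sqrt 2 != 0 by rewrite mulf_neq0// gt_eqF// sqrtr_gt0.
rewrite pE /normal_pdf (negbTE s20) /normal_fun subr0 exprMn sqr_sqrtr//.
have pk := normal_peak_gt0 s20.
rewrite [leRHS](_ : _ = normal_peak s * (s ^+ 2 *+ 4 * expR (- x ^+ 2 / ((s ^+ 2 * 2) *+ 2)))); last first.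
  by field; rewrite gt_eqF.
rewrite mulrCA ler_pM2l ?normal_peak_gt0//.
have -> : - x ^+ 2 / (s ^+ 2 *+ 2) = - x ^+ 2 / ((s ^+ 2 * 2) *+ 2) - x ^+ 2 / (s ^+ 2 *+ 4).
  by field.
rewrite expRD mulrCA mulrC ler_pM2r ?expR_gt0//.
set u := x ^+ 2 / (s ^+ 2 *+ 4).
have -> : x ^+ 2 = s ^+ 2 *+ 4 * u by rewrite /u; field.
rewrite -[leRHS]mulr1 -mulrA ler_wpM2l//; first by rewrite mulrn_wge0// sqr_ge0.
rewrite expRN -ler_pdivlMr ?invr_gt0 ?expR_gt0// invrK mul1r.
by apply: le_trans (expR_ge1Dx u); rewrite lerDr.
Qed.

Let integrable_dom (f : R -> R) (C D : R) : 0 <= C -> 0 <= D -> continuous f ->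
  (forall x, `|f x| <= C + D * x ^+ 2) ->
  mu.-integrable setT (EFin \o (fun x => f x * p x)).
Proof.
move=> C0 D0 cf fCD; have [E E0 sqrE] := sqr_pdf_le.
apply: (@le_integrable _ _ _ mu setT measurableT _
  (EFin \o (fun x => C * p x + (D * E) * normal_pdf 0 (s * Num.sqrt 2) x))) => //.
- apply/measurable_EFinP/measurable_funM; exact: continuous_measurable_fun.
- move=> x _ /=; rewrite lee_fin normrM (ger0_norm (pge0 x)) [leRHS]ger0_norm; last first.
    by rewrite addr_ge0 ?mulr_ge0// normal_pdf_ge0.
  apply: (le_trans (ler_wpM2r (pge0 x) (fCD x))).
  have := ler_wpM2l D0 (sqrE x); lra.
- by apply: integrable_realD => //; apply: integrable_realZ => //; exact: integrable_normal_pdf.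
Qed.

Let decay : exists D, forall x, x ^+ 2 * p x <= D.
Proof.
have [E E0 sqrE] := sqr_pdf_le; exists (E * normal_peak (s * Num.sqrt 2)) => x.
apply: (le_trans (sqrE x)); rewrite ler_wpM2l// normal_pdf_ub//.
by rewrite mulf_neq0// gt_eqF// sqrtr_gt0.
Qed.

Let cvg_decay (f : R -> R) (t : nat -> R) : (forall n, `|t n| = n%:R) ->
  (forall n, (0 < n)%N -> `|f (t n)| <= `|t n|) ->
  f (t n) * p (t n) @[n --> \oo] --> (0 : R).
Proof.
move=> tn ft; have [D HD] := decay.
apply: (@cvg0_le_inv_nat D) => n n0.
rewrite normrM (ger0_norm (pge0 _)) ler_pdivlMr ?ltr0n//.
rewrite (le_trans _ (HD (t n)))// mulrAC ler_wpM2r// -real_normK ?num_real// tn expr2 ler_wpM2r//.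
by rewrite -[leRHS]tn ft.
Qed.

Let Rintegral_p : \int[mu]_x p x = 1.
Proof. by rewrite /Rintegral integral_normal_pdf. Qed.

Let norm_nat n : `|n%:R : R| = n%:R. Proof. by rewrite normr_nat. Qed.
Let normN_nat n : `|- n%:R : R| = n%:R. Proof. by rewrite normrN normr_nat. Qed.

(** Integrates the derivative of x p(x), which is p - x^2 p / s^2. *)
Lemma Rintegral_sqr_normal_pdf : \int[mu]_x (x ^+ 2 * p x) = s ^+ 2.
Proof.
have i1 := @integrable_normal_pdf R 0 s.
have i2 : mu.-integrable setT (EFin \o (fun x => x ^+ 2 * p x)).
  apply: (@integrable_dom _ 0 1) => //; first exact: exprn_continuous.
  by move=> x; rewrite add0r mul1r ger0_norm// sqr_ge0.
have : \int[mu]_x (p x - (s ^+ 2)^-1 * (x ^+ 2 * p x)) = 0.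
  apply: (@Rintegral_derive_eq0 _ _ (fun x => x * p x)).
  - move=> x; have dp := is_derive_p x; apply: is_derive_eq; rewrite /GRing.scale/=.
    by field.
  - move=> x; apply: cvgB; first exact: continuous_p.
    apply: cvgMr; apply: cvgM; first exact: exprn_continuous.
    exact: continuous_p.
  - by apply: integrable_realB => //; exact: integrable_realZ.
  - exact: (cvg_decay (f := id) (t := fun n => n%:R) norm_nat).
  - exact: (cvg_decay (f := id) (t := fun n => - n%:R) normN_nat).
rewrite RintegralB//; last exact: integrable_realZ.
rewrite RintegralZl// Rintegral_p => /eqP; rewrite subr_eq0 => /eqP h.
by apply: (@mulfI _ (s ^+ 2)^-1); rewrite ?invr_eq0 ?expf_eq0// -h mulVf// expf_eq0.
Qed.

Let int x : mu.-integrable setT (EFin \o (fun y => cos (x * y) * p y)).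
Proof.
apply: (@integrable_dom _ 1 0) => //.
  by move=> y; apply: continuous_comp; [exact: mulrl_continuous|exact: continuous_cos].
by move=> y; rewrite mul0r addr0 ler_norml cos_geN1 cos_le1.
Qed.

Let sin_bound (x y : R) : `|y * sin (x * y)| <= 1 + y ^+ 2.
Proof.
rewrite normrM; have : `|sin (x * y)| <= 1 by rewrite ler_norml sin_geN1 sin_le1.
have := normr_ge0 y; rewrite -[X in _ + X]real_normK ?num_real//.
by have := normr_ge0 (sin (x * y)); nra.
Qed.

Let is_derive_F (t : R) : is_derive t (1 : R)
  (fun t => \int[mu]_y (cos (t * y) * p y))
  (\int[mu]_y (- (y * sin (t * y)) * p y)).
Proof.
have d1 y (x : R) : is_derive x (1 : R) (fun t => cos (t * y) * p y) (- (y * sin (x * y)) * p y).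
  by apply: is_derive_eq; rewrite /GRing.scale/=; ring.
have tI : `](t - 1), (t + 1)[%classic t by rewrite /= in_itv/=; apply/andP; split; lra.
have intG : mu.-integrable setT (EFin \o (fun y => (1 + y ^+ 2) * p y)).
  apply: (@integrable_dom _ 1 1) => //.
    by move=> y; apply: cvgD; [exact: cvg_cst|exact: exprn_continuous].
  by move=> y; rewrite mul1r ger0_norm// addr_ge0// sqr_ge0.
have ub x y : `]t-1, t+1[%classic x -> [set: R] y ->
    `|partial1of2 (fun t y => cos (t * y) * p y) x y| <= (1 + y ^+ 2) * p y.
  move=> _ _; rewrite partial1of2E (@derive_val _ _ _ _ _ _ _ (d1 y x)) normrM (ger0_norm (pge0 _)) ler_wpM2r//.
  by rewrite normrN.
have G0 y : 0 <= (1 + y ^+ 2) * p y by rewrite mulr_ge0// addr_ge0// sqr_ge0.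
have dd x y : `]t-1, t+1[%classic x -> [set: R] y -> derivable (fun t : R => cos (t * y) * p y) x (1 : R).
  by move=> _ _; exact: ex_derive.
apply: DeriveDef.
  exact: (derivable_under_integral measurableT tI (fun x _ => int x) dd G0 intG ub).
rewrite -derive1E (differentiation_under_integral measurableT tI (fun x _ => int x) dd G0 intG ub).
by apply: eq_Rintegral => y _; rewrite partial1of2E (@derive_val _ _ _ _ _ _ _ (d1 y t)).
Qed.

(* Gaussian integration by parts turns F(t) = E cos(tY) into a solution of
   F' = - s^2 t F. *)
Lemma Rintegral_cos_normal_pdf (t : R) :
  \int[mu]_y (cos (t * y) * p y) = expR (- (s ^+ 2 * t ^+ 2 / 2)).
Proof.
pose F (t : R) := \int[mu]_y (cos (t * y) * p y).
have cts x : continuous (fun y : R => y * sin (x * y)).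
  move=> y; apply: cvgM; first exact: cvg_id.
  by apply: continuous_comp; [exact: mulrl_continuous|exact: continuous_sin].
have int2 x : mu.-integrable setT (EFin \o (fun y => (y * sin (x * y)) * p y)).
  apply: (@integrable_dom _ 1 1) => //.
  by move=> y; rewrite mul1r.
have F' x : \int[mu]_y (- (y * sin (x * y)) * p y) = - (s ^+ 2 * x * F x).
  have : \int[mu]_y (x * (cos (x * y) * p y) - (s ^+ 2)^-1 * ((y * sin (x * y)) * p y)) = 0.
    apply: (@Rintegral_derive_eq0 _ _ (fun y => sin (x * y) * p y)).
    - move=> y; have dp := is_derive_p y; apply: is_derive_eq; rewrite /GRing.scale/=.
      by field.
    - move=> y; apply: cvgB; apply: cvgMr; (apply: cvgM; [|exact: continuous_p]); last exact: cts.
      by apply: continuous_comp; [exact: mulrl_continuous|exact: continuous_cos].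
    - by apply: integrable_realB => //; exact: integrable_realZ.
    - apply: (cvg_decay (f := fun y => sin (x * y)) (t := fun n => n%:R) norm_nat) => n n0.
      rewrite (@le_trans _ _ 1)//; first by rewrite ler_norml sin_geN1 sin_le1.
      by rewrite norm_nat ler1n.
    - apply: (cvg_decay (f := fun y => sin (x * y)) (t := fun n => - n%:R) normN_nat) => n n0.
      rewrite (@le_trans _ _ 1)//; first by rewrite ler_norml sin_geN1 sin_le1.
      by rewrite normN_nat ler1n.
  rewrite RintegralB//; [|exact: integrable_realZ..].
  rewrite !RintegralZl// -/(F x) => /eqP; rewrite subr_eq0 => /eqP h.
  under eq_Rintegral do rewrite mulNr -mulN1r.
  rewrite RintegralZl// mulN1r -mulrA h mulrA divff ?mul1r// expf_eq0 //.
have F0 : F 0 = 1.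
  by rewrite /F; under eq_Rintegral do rewrite mul0r cos0 mul1r.
(* The integrating factor of the equation [F'] makes this product constant in t. *)
have H : F t * expR (s ^+ 2 * t ^+ 2 / 2) = F 0 * expR (s ^+ 2 * 0 ^+ 2 / 2).
  apply: (@is_derive_0_is_cst R (fun t => F t * expR (s ^+ 2 * t ^+ 2 / 2)) t 0) => x.
  have dF := is_derive_F x; rewrite F' in dF.
  by apply: is_derive_eq; rewrite /GRing.scale/=; field.
rewrite F0 expr0n/= mulr0 mul0r expR0 mulr1 in H.
apply: (@mulIf _ (expR (s ^+ 2 * t ^+ 2 / 2))); first by rewrite gt_eqF// expR_gt0.
by rewrite -/(F t) H -expRD addNr expR0.
Qed.

End normal_characteristic_function.

Section gaussian_random_variables.
Context {R : realType} {d : measure_display} {Omega : measurableType d}.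
Variable P : probability Omega R.

Lemma bounded_integrableP (f : Omega -> R) (B : R) :
  measurable_fun setT f -> (forall w, `|f w| <= B) ->
  P.-integrable setT (EFin \o f).
Proof.
move=> mf fB; apply: measurable_bounded_integrable => //.
  by rewrite (@le_lt_trans _ _ 1%E)// ?probability_le1// ltry.
exists B; split; first by rewrite num_real.
by move=> x Bx y _ /=; apply: (le_trans (fB y)); exact: ltW.
Qed.

Lemma integral_law (m : {measure set (measurableTypeR R) -> \bar R})
    (Y : Omega -> measurableTypeR R) (f : R -> R) :
  measurable_fun setT Y ->
  (forall A : set (measurableTypeR R), measurable A -> P (Y @^-1` A) = m A) ->
  measurable_fun setT f ->
  P.-integrable setT (EFin \o (f \o Y)) ->
  m.-integrable setT (EFin \o f) /\
  (\int[P]_w (f (Y w))%:E = \int[m]_y (f y)%:E)%E.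
Proof.
move=> mY lawY mf intf.
have E (g : measurableTypeR R -> \bar R) :
    (\int[pushforward P Y]_y g y = \int[m]_y g y)%E.
  apply: (@eq_measure_integral _ _ _ setT m (pushforward P Y)) => A mA _.
  by rewrite -lawY.
split; last first.
  rewrite -(@integral_pushforward _ _ _ _ _ _ mY P setT (EFin \o f))//.
  exact/measurable_EFinP.
apply/integrableP; split; first exact/measurable_EFinP.
rewrite -E (@ge0_integral_pushforward _ _ _ _ _ _ mY P setT (fun y => `|(f y)%:E|%E))//.
- by have /integrableP[_] := intf.
- by apply/measurableT_comp => //; exact/measurable_EFinP.
Qed.

(** The parameter of the law is only known to exist, so v is first identified with its square by
    integrating y^2 against the law. The degenerate case is a Dirac mass at 0 and is treated
    apart. *)
Lemma centered_gaussian_cos (Y : Omega -> R) (v t : R) :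
  centered_gaussian P Y -> ('E_P[fun w => (Y w ^+ 2)%R] = v%:E)%E ->
  \int[P]_w cos (t * Y w) = expR (- (t ^+ 2 * v / 2)).
Proof.
move=> [mY [s lawY]] EY.
have msq : measurable_fun setT (fun y : R => y ^+ 2) by exact: exprn_measurable.
have mcos : measurable_fun setT (fun y : R => cos (t * y)).
  apply: continuous_measurable_fun => y.
  by apply: continuous_comp; [exact: mulrl_continuous|exact: continuous_cos].
have EY' : (\int[P]_w (Y w ^+ 2)%:E = v%:E)%E by move: EY; rewrite unlock.
have isq : P.-integrable setT (EFin \o (fun w => Y w ^+ 2)).
  apply/integrableP; split; first by apply/measurable_EFinP; exact: (measurableT_comp msq).
  under eq_integral do rewrite /= ger0_norm ?sqr_ge0//.
  by rewrite EY' ltry.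
have icos : P.-integrable setT (EFin \o (fun w => cos (t * Y w))).
  apply: (@bounded_integrableP _ 1); first exact: (measurableT_comp mcos).
  by move=> w; exact: cos_max.
have [s0|s0] := eqVneq s 0.
  have law0 A : measurable A -> P (Y @^-1` A) = \d_(0 : measurableTypeR R) A.
    by move=> mA; have := lawY A mA; rewrite s0 eqxx.
  have [_ e1] := integral_law mY law0 msq isq.
  have [_ e2] := integral_law mY law0 mcos icos.
  have : v%:E = (0 ^+ 2)%:E.
    rewrite -EY' e1 integral_dirac ?diracT ?mul1e//.
    exact/measurable_EFinP.
  rewrite /Rintegral e2 integral_dirac ?diracT ?mul1e//; last exact/measurable_EFinP.
  by rewrite mulr0 cos0 => -[->]; rewrite expr0n/= mulr0 mul0r oppr0 expR0.
have law0 A : measurable A -> P (Y @^-1` A) = normal_prob 0 s A.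
  by move=> mA; have := lawY A mA; rewrite (negbTE s0).
have [i1 e1] := integral_law mY law0 msq isq.
have [i2 e2] := integral_law mY law0 mcos icos.
have -> : v = s ^+ 2.
  by rewrite -(Rintegral_sqr_normal_pdf s0) /Rintegral -integral_normal_prob// -e1 EY'.
by rewrite (mulrC (t ^+ 2)) -(Rintegral_cos_normal_pdf s0) /Rintegral -integral_normal_prob// -e2.
Qed.

End gaussian_random_variables.

(** * Discrete Fourier analysis and duality *)

Section unit_complex_numbers.
Context {R : realType}.
Implicit Types (a b t : R) (z w : R[i]).

Lemma twopi_gt0 : 0 < pi *+ 2 :> R.
Proof. by rewrite -mulr_natr mulr_gt0// pi_gt0. Qed.

Definition eix t : R[i] := cos t +i* sin t.

Definition sqn z : R := Normc.normc z ^+ 2.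

Lemma cexp_eix t : cexp (0 +i* t) = eix t.
Proof. by rewrite /cexp /eix /= expR0 !mul1r. Qed.

Lemma eixD a b : eix (a + b) = eix a * eix b.
Proof.
rewrite /eix cosD sinD; apply/eqP; rewrite eq_complex /=.
by rewrite eqxx/= addrC.
Qed.

Lemma eixN a : eix (- a) = ((eix a)^*)%C.
Proof. by rewrite /eix cosN sinN. Qed.

Lemma eix0 : eix 0 = 1.
Proof. by rewrite /eix cos0 sin0. Qed.

Lemma eixX a n : eix (a *+ n) = eix a ^+ n.
Proof. by elim: n => [|n IH]; rewrite ?eix0// mulrS eixD IH exprS. Qed.

Lemma eix_2pi : eix (pi *+ 2) = 1.
Proof. by rewrite /eix cos2pi sin2pi. Qed.

Lemma eix_2pin (n : nat) : eix (pi *+ 2 *+ n) = 1.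
Proof. by rewrite eixX eix_2pi expr1n. Qed.

Lemma eix_2piz (n : int) : eix (pi *+ 2 * n%:~R) = 1.
Proof.
case: n => n; first by rewrite mulr_natr eix_2pin.
by rewrite NegzE mulrNz mulrN eixN mulr_natr eix_2pin conjc1.
Qed.

Lemma sqnE z : sqn z = complex.Re z ^+ 2 + complex.Im z ^+ 2.
Proof. by case: z => a b; rewrite /sqn /Normc.normc sqr_sqrtr// addr_ge0// sqr_ge0. Qed.

Lemma sqnC z : (sqn z)%:C = z * (z^*)%C.
Proof.
rewrite sqnE; case: z => a b /=; apply/eqP; rewrite eq_complex /=.
by apply/andP; split; apply/eqP; ring.
Qed.

Lemma sqn_ge0 z : 0 <= sqn z. Proof. exact: sqr_ge0. Qed.

Lemma sqnM z w : sqn (z * w) = sqn z * sqn w.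
Proof. by rewrite /sqn Normc.normcM exprMn. Qed.

Lemma sqn_eix t : sqn (eix t) = 1.
Proof. by rewrite sqnE /= cos2Dsin2. Qed.

Lemma sqn_real (a : R) : sqn a%:C = a ^+ 2.
Proof. by rewrite sqnE /= expr0n addr0. Qed.

Lemma normc_ge0 z : 0 <= Normc.normc z.
Proof. by case: z => a b; exact: sqrtr_ge0. Qed.

Lemma normc_eix t : Normc.normc (eix t) = 1.
Proof. by apply/eqP; rewrite -sqrp_eq1 ?normc_ge0// -/(sqn _) sqn_eix. Qed.

Lemma normc_real (a : R) : Normc.normc a%:C = `|a|.
Proof. by rewrite /= expr0n addr0 sqrtr_sqr. Qed.

Lemma normcB z w : Normc.normc (z - w) = Normc.normc (w - z).
Proof. by rewrite -normcN opprB. Qed.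

Lemma normcJ_real z : Normc.normc (z^*)%C = Normc.normc z.
Proof. by case: z => a b /=; rewrite sqrrN. Qed.

Lemma normc_sum (I : Type) (r : seq I) (Q : pred I) (F : I -> R[i]) :
  Normc.normc (\sum_(i <- r | Q i) F i) <= \sum_(i <- r | Q i) Normc.normc (F i).
Proof.
elim/big_ind2: _ => [|x1 x2 y1 y2 h1 h2|//]; first by rewrite Normc.normc0.
exact: le_trans (le_normcD _ _) (lerD h1 h2).
Qed.

Lemma eix_sub1E t : sqn (eix t - 1) = 2 - 2 * cos t.
Proof. by rewrite sqnE /=; have := cos2Dsin2 t; nra. Qed.

Lemma eix_sub1_half t : sqn (eix t - 1) = 4 * sin (t / 2) ^+ 2.
Proof.
rewrite eix_sub1E.
have -> : cos t = cos ((t / 2) *+ 2) by rewrite -mulr_natr divfK.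
by rewrite cos_mulr2n; have := cos2Dsin2 (t / 2); rewrite -mulr_natr; nra.
Qed.

(** Put u = 2 v. The mean value theorem gives v cos v <= sin v, so sin u = 2 sin v cos v is at least
    u (cos v)^2, and (cos v)^2 >= 1/2 because cos u >= 0. *)
Lemma sin_ge_half (u : R) : 0 <= u -> u <= pi / 2 -> u / 2 <= sin u.
Proof.
move=> u0 upi; set v := u / 2.
have uE : u = v *+ 2 by rewrite -mulr_natr /v divfK.
have v0 : 0 <= v by rewrite /v divr_ge0.
have cosu : 0 <= cos u by apply: cos_ge0_pihalf; apply/andP; split; lra.
have cosv : 0 <= cos v by apply: cos_ge0_pihalf; apply/andP; split; lra.
have cos2 : 1 / 2 <= cos v ^+ 2 by have := cos_mulr2n v; rewrite -uE -mulr_natr; lra.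
have sinv : v * cos v <= sin v.
  move: v0; rewrite le_eqVlt => /predU1P[<-|v0]; first by rewrite mul0r sin0.
  have cs : {within `[0, v], continuous (@sin R)}.
    by apply: continuous_subspaceT => x; exact: continuous_sin.
  have [c] := MVT v0 (fun x _ => is_derive_sin x) cs.
  rewrite in_itv/= => /andP[c0 cv]; rewrite sin0 !subr0 => ->.
  rewrite mulrC ler_pM2r// ltW// ltr_cos// in_itv/=; apply/andP; split; lra.
rewrite uE sin_mulr2n -[leRHS]mulr_natr; nra.
Qed.

Lemma eix_sub1_ge t : `|t| <= pi -> t ^+ 2 / 4 <= sqn (eix t - 1).
Proof.
move=> tpi; rewrite eix_sub1_half.
have -> : sin (t / 2) ^+ 2 = sin (`|t| / 2) ^+ 2.
  by case: (ger0P t) => // _; rewrite mulNr sinN sqrrN.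
rewrite -(real_normK (num_real t)).
have := @sin_ge_half (`|t| / 2) _ _; have := normr_ge0 t => t0.
have h1 : 0 <= `|t| / 2 by rewrite divr_ge0.
have h2 : `|t| / 2 <= pi / 2 by rewrite ler_pM2r.
move=> /(_ h1 h2); nra.
Qed.

Lemma eix_sub1_le t : sqn (eix t - 1) <= t ^+ 2.
Proof.
wlog t0 : t / 0 <= t.
  move=> H; case: (leP 0 t) => [/H//|/ltW t0].
  have := H (- t); rewrite oppr_ge0 => /(_ t0); rewrite sqrrN.
  by rewrite !eix_sub1E cosN.
rewrite eix_sub1_half.
have h : sin (t / 2) ^+ 2 <= (t / 2) ^+ 2.
  have t20 : 0 <= t / 2 by rewrite divr_ge0.
  rewrite -real_normK ?num_real// -[leRHS]real_normK ?num_real// ler_sqr ?nnegrE//.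
  rewrite (ger0_norm t20).
  move: t20; rewrite le_eqVlt => /predU1P[<-|t20]; first by rewrite sin0 normr0.
  have cs : {within `[0, t / 2], continuous (@sin R)}.
    by apply: continuous_subspaceT => x; exact: continuous_sin.
  have [c _] := MVT t20 (fun x _ => is_derive_sin x) cs.
  rewrite sin0 !subr0 => ->.
  rewrite normrM (ger0_norm (ltW t20)) ler_piMl ?(ltW t20)//.
  exact: cos_max.
by rewrite expr_div_n in h; lra.
Qed.

Lemma normr_Re (z : R[i]) : `|complex.Re z| <= Normc.normc z.
Proof. by case: z => r i /=; rewrite -sqrtr_sqr ler_sqrt ?addr_ge0 ?sqr_ge0// lerDl sqr_ge0. Qed.

Lemma normr_Im (z : R[i]) : `|complex.Im z| <= Normc.normc z.
Proof. by case: z => r i /=; rewrite -sqrtr_sqr ler_sqrt ?addr_ge0 ?sqr_ge0// lerDr sqr_ge0. Qed.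

Lemma normc_le_ReIm (z : R[i]) : Normc.normc z <= `|complex.Re z| + `|complex.Im z|.
Proof.
case: z => r i /=; rewrite -[leRHS]ger0_norm ?addr_ge0// -sqrtr_sqr ler_sqrt ?sqr_ge0//.
by rewrite -(real_normK (num_real r)) -(real_normK (num_real i)) sqrrD lerD2r lerDl mulrn_wge0// mulr_ge0.
Qed.

Lemma normc_eixB a b : Normc.normc (eix a - eix b) <= `|a - b|.
Proof.
have -> : eix a - eix b = eix b * (eix (a - b) - 1).
  by rewrite mulrBr mulr1 -eixD [b + _]addrC subrK.
rewrite Normc.normcM normc_eix mul1r -[leLHS]ger0_norm ?normc_ge0// -sqrtr_sqr.
by rewrite -[leRHS]sqrtr_sqr ler_sqrt ?sqr_ge0//; exact: eix_sub1_le.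
Qed.

End unit_complex_numbers.

Section symmetric_sums.
Variable V : zmodType.
Implicit Types (F : int -> V).

(* As [Negz k] is - (k + 1), [zsum 0 N] sums over - N <= n < N, which is a full
   set of frequencies modulo 2N. *)
Definition zsum (L N : nat) F : V := \sum_(L <= k < N) (F (Posz k) + F (Negz k)).

Lemma zsum_split (L M N : nat) F : (L <= M <= N)%N ->
  zsum L N F = zsum L M F + zsum M N F.
Proof. by move=> /andP[LM MN]; rewrite /zsum (big_cat_nat LM MN). Qed.

Lemma zsumD L N F1 F2 : zsum L N (fun n => F1 n + F2 n) = zsum L N F1 + zsum L N F2.
Proof. by rewrite /zsum -big_split; apply: eq_bigr => i _ /=; rewrite addrACA. Qed.

Lemma eq_zsum L N F1 F2 : F1 =1 F2 -> zsum L N F1 = zsum L N F2.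
Proof. by move=> F12; apply: eq_bigr => i _; rewrite !F12. Qed.

Lemma zsum_shift N F : zsum 0 N F = \sum_(0 <= m < N.*2) F (m%:Z - N%:Z).
Proof.
elim: N => [|N IH]; first by rewrite /zsum !big_nil.
rewrite /zsum big_nat_recr//= -/(zsum 0 N F) IH doubleS.
rewrite big_nat_recr//= big_nat_recl//=.
have -> : N.*2.+1%:Z - N.+1%:Z = N by rewrite -addnn; lia.
have -> : 0%N%:Z - N.+1%:Z = Negz N by lia.
have -> : \sum_(0 <= i < N.*2) F (i.+1%:Z - N.+1%:Z) = \sum_(0 <= m < N.*2) F (m%:Z - N%:Z).
  by apply: eq_bigr => m _; congr F; rewrite !intS; ring.
by rewrite addrA [in RHS](addrC (F (Negz N))) [LHS]addrAC.
Qed.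

End symmetric_sums.

Section discrete_fourier_transform.
Context {R : realType}.
Variable N : nat.
Hypothesis N0 : (0 < N)%N.
Local Notation J := N.*2.
Implicit Types (F G : nat -> R[i]) (n : int).

Definition grid (J : nat) (j : nat) : R := pi *+ 2 * j%:R / J%:R.

(** The factor 1/J makes this the Riemann sum, over J cells, of the integral defining the Fourier
    coefficient at n. *)
Definition dft (J : nat) F n : R[i] :=
  (J%:R^-1)%:C * \sum_(0 <= j < J) F j * eix (- (n%:~R * grid J j)).

Let J0 : (0 < J)%N. Proof. by rewrite double_gt0. Qed.
Let JR0 : J%:R != 0 :> R. Proof. by rewrite pnatr_eq0 -lt0n. Qed.

Lemma grid_lt j : (j < J)%N -> 0 <= grid J j < pi *+ 2.
Proof.
move=> jJ; have pi0 := pi_gt0 R.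
rewrite /grid !mulr_ge0 ?invr_ge0 ?(ltW twopi_gt0)//=.
by rewrite ltr_pdivrMr ?ltr0n// ltr_pM2l ?ltr_nat// mulrn_wgt0.
Qed.

Lemma eix_neq1 (t : R) : 0 < `|t| < pi *+ 2 -> eix t != 1.
Proof.
move=> /andP[t0 t2]; rewrite -subr_eq0; apply/eqP => h.
have := eix_sub1_half t; rewrite h sqnE /= expr0n/= addr0 => /esym/eqP.
rewrite mulf_eq0 pnatr_eq0/= expf_eq0/= => /eqP s0.
have s1 : sin (`|t| / 2) = 0.
  by case: (ger0P t) => _ //; rewrite mulNr sinN s0 oppr0.
have /sin_gt0_pi : 0 < `|t| / 2 < pi by rewrite divr_gt0//= ltr_pdivrMr// mulr_natr.
by rewrite s1 ltxx.
Qed.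

(** Shifting the window to 0, ..., J - 1 factors out a phase and leaves a geometric sum, whose ratio
    is a J-th root of unity different from 1 unless l = j. *)
Lemma zsum_eix (l j : nat) : (l < J)%N -> (j < J)%N ->
  zsum 0 N (fun n => eix (n%:~R * (grid J l - grid J j))) =
  if l == j then J%:R else 0 :> R[i].
Proof.
move=> lJ jJ; rewrite zsum_shift.
set t := grid J l - grid J j.
have -> : \sum_(0 <= m < J) eix ((m%:Z - N%:Z)%:~R * t) =
    eix (- (N%:R * t)) * \sum_(i < J) eix t ^+ i.
  rewrite big_mkord mulr_sumr; apply: eq_bigr => m _.
  by rewrite -eixX -eixD; congr eix; rewrite rmorphB /= -mulr_natl; ring.
case: eqVneq => [lj|lj].
  have -> : t = 0 by rewrite /t lj subrr.
  rewrite mulr0 oppr0 eix0 mul1r; under eq_bigr do rewrite expr1n.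
  by rewrite sumr_const card_ord.
have t0 : eix t != 1.
  apply: eix_neq1; rewrite normr_gt0 subr_eq0.
  have /andP[l0 l1] := grid_lt lJ; have /andP[j0 j1] := grid_lt jJ.
  apply/andP; split; last by rewrite ltr_norml /t; apply/andP; split; lra.
  apply: contraNneq lj; rewrite /grid => /(mulIf (invr_neq0 JR0)) /mulfI.
  move=> /(_ _)/eqP; rewrite eqr_nat => -> //.
  by rewrite gt_eqF// twopi_gt0.
have tJ : eix t ^+ J = 1.
  rewrite -eixX -mulr_natr /t mulrBl !(divfK JR0).
  rewrite (_ : _ - _ = pi *+ 2 * (l%:Z - j%:Z)%:~R) ?eix_2piz//.
  by rewrite rmorphB /= mulrBr.
have := subrX1 (eix t) J; rewrite tJ subrr => /esym/eqP.
by rewrite mulf_eq0 subr_eq0 (negbTE t0)/= => /eqP ->; rewrite mulr0.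
Qed.

Lemma zsum_sum (L M : nat) (I : Type) (r : seq I) (H : I -> int -> R[i]) :
  zsum L M (fun n => \sum_(i <- r) H i n) = \sum_(i <- r) zsum L M (H i).
Proof.
rewrite /zsum; under eq_bigr do rewrite -big_split/=.
by rewrite exchange_big.
Qed.

Lemma zsum_mull (V : pzRingType) (L M : nat) (a : V) H :
  zsum L M (fun n => a * H n) = a * zsum L M H.
Proof. by rewrite /zsum mulr_sumr; apply: eq_bigr => i _; rewrite mulrDr. Qed.

Lemma conjcM (z w : R[i]) : ((z * w)^*)%C = (z^*)%C * (w^*)%C.
Proof. by rewrite rmorphM. Qed.

Lemma conjc_realC (x : R) : ((x%:C)^*)%C = x%:C.
Proof. by rewrite /= oppr0. Qed.

Lemma conjc_sum (I : Type) (r : seq I) (Q : pred I) (H : I -> R[i]) :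
  ((\sum_(i <- r | Q i) H i)^*)%C = \sum_(i <- r | Q i) ((H i)^*)%C.
Proof. by rewrite rmorph_sum. Qed.

Lemma dft_parseval F G :
  zsum 0 N (fun n => dft J F n * ((dft J G n)^*)%C) =
  (J%:R^-1)%:C * \sum_(0 <= j < J) F j * ((G j)^*)%C.
Proof.
have E n : dft J F n * ((dft J G n)^*)%C = (J%:R^-1)%:C * (J%:R^-1)%:C *
    \sum_(0 <= j < J) \sum_(0 <= l < J)
      F j * ((G l)^*)%C * eix (n%:~R * (grid J l - grid J j)).
  rewrite /dft conjcM conjc_realC mulrACA; congr (_ * _).
  rewrite conjc_sum big_distrlr /=.
  apply: eq_bigr => j _; apply: eq_bigr => l _.
  rewrite conjcM -eixN opprK mulrACA -eixD; congr (_ * eix _); ring.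
rewrite (eq_zsum _ _ E) zsum_mull zsum_sum.
under eq_bigr do rewrite zsum_sum.
have -> : \sum_(0 <= j < J) \sum_(0 <= l < J)
    zsum 0 N (fun n => F j * ((G l)^*)%C * eix (n%:~R * (grid J l - grid J j))) =
    \sum_(0 <= j < J) F j * ((G j)^*)%C * J%:R.
  rewrite !big_mkord; apply: eq_bigr => j _; rewrite big_mkord (bigD1 j)//= big1 ?addr0.
    by rewrite zsum_mull zsum_eix// eqxx.
  move=> l lj; rewrite zsum_mull zsum_eix//.
  by rewrite (negbTE (lj : nat_of_ord l != j)) mulr0.
rewrite -mulr_suml mulrA mulrAC -[X in X * _ = _]mulrA.
by rewrite -(rmorph_nat (real_complex R)) -rmorphM /= mulVf// mulr1.
Qed.

Lemma zsum_real L M (H : int -> R) : (zsum L M H)%:C = zsum L M (fun n => (H n)%:C).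
Proof. by rewrite /zsum rmorph_sum /=; apply: eq_bigr => i _; rewrite rmorphD. Qed.

Lemma dft_energy F :
  zsum 0 N (fun n => sqn (dft J F n)) = J%:R^-1 * \sum_(0 <= j < J) sqn (F j).
Proof.
apply: (@complexI R); rewrite zsum_real (eq_zsum _ _ (fun n => sqnC _)) dft_parseval.
rewrite rmorphM /= rmorph_sum /=; congr (_ * _).
by apply: eq_bigr => j _; rewrite sqnC.
Qed.

Lemma dft_shift F n : F J = F 0%N ->
  dft J (fun j => F j.+1 - F j) n = (eix (n%:~R * (pi *+ 2 / J%:R)) - 1) * dft J F n.
Proof.
move=> FJ; set h := pi *+ 2 / J%:R.
pose u j := F j * eix (- (n%:~R * grid J j)).
have uJ : u J = u 0%N.
  rewrite /u FJ; congr (_ * _).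
  rewrite /grid mulfK// mulr0 mul0r mulr0 oppr0 eix0 eixN mulrC eix_2piz.
  by rewrite conjc1.
have E1 : \sum_(0 <= j < J) (F j.+1 - F j) * eix (- (n%:~R * grid J j)) =
    \sum_(0 <= j < J) (eix (n%:~R * h) * u j.+1 - u j).
  apply: eq_bigr => j _; rewrite /u mulrBl; congr (_ - _).
  rewrite [RHS]mulrCA -eixD; congr (_ * eix _).
  by rewrite /grid /h -natr1; field.
have E2 : \sum_(0 <= j < J) u j.+1 = \sum_(0 <= j < J) u j.
  by apply: (@addrI _ (u 0%N)); rewrite -big_nat_recl// big_nat_recr//= uJ addrC.
rewrite /dft E1 sumrB -mulr_sumr E2 -/h.
by rewrite -[X in _ * (_ - X)]mul1r -mulrBl mulrCA.
Qed.

(** On the centered window the phase n h stays in [-pi, pi], where |exp(i n h) - 1|^2 >= (n h)^2 /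
    4. Finite differences therefore control the derivative at every frequency of the window. *)
Lemma dft_gradient F : F J = F 0%N ->
  zsum 0 N (fun n => n%:~R ^+ 2 * sqn (dft J F n)) <=
  4 / (pi *+ 2 / J%:R) ^+ 2 * (J%:R^-1 * \sum_(0 <= j < J) sqn (F j.+1 - F j)).
Proof.
move=> FJ; set h := pi *+ 2 / J%:R.
have h0 : 0 < h by rewrite divr_gt0 ?ltr0n// twopi_gt0.
rewrite -dft_energy -zsum_mull.
have H n : (`|n| <= N)%N -> n%:~R ^+ 2 * sqn (dft J F n) <=
    4 / h ^+ 2 * sqn (dft J (fun j => F j.+1 - F j) n).
  move=> nN; rewrite (dft_shift n FJ) sqnM -/h [leRHS]mulrA ler_wpM2r ?sqn_ge0//.
  have /eix_sub1_ge : `|n%:~R * h| <= pi.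
    rewrite normrM (gtr0_norm h0) /h mulrA ler_pdivrMr ?ltr0n//.
    rewrite -addnn natrD -mulr_natr.
    have : `|n%:~R| <= N%:R :> R by rewrite -intr_norm -abszE ler_nat.
    have := pi_gt0 R; nra.
  rewrite exprMn => hh.
  have -> : (n%:~R ^+ 2 : R) = 4 / h ^+ 2 * (n%:~R ^+ 2 * h ^+ 2 / 4) by field; rewrite gt_eqF.
  by rewrite ler_wpM2l// divr_ge0// sqr_ge0.
rewrite /zsum !big_nat; apply: ler_sum => k /andP[_ kN].
by apply: lerD; apply: H; rewrite ?NegzE; lia.
Qed.

End discrete_fourier_transform.

(** * Weighted duality between Sobolev sums on the grid *)

Section duality_bound.
Context {R : realType}.
Implicit Types (H : int -> R) (a g : int -> R[i]).

(** The Fourier symbol of 1 minus the Laplacian; its powers are the Sobolev weights. *)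
Definition bessel (n : int) : R := 1 + n%:~R ^+ 2.

Lemma bessel_ge1 n : 1 <= bessel n. Proof. by rewrite lerDl sqr_ge0. Qed.
Lemma bessel_gt0 n : 0 < bessel n. Proof. exact: lt_le_trans (bessel_ge1 n). Qed.

Lemma ler_zsum L M H1 H2 :
  (forall k, (L <= k < M)%N -> H1 (Posz k) <= H2 (Posz k) /\ H1 (Negz k) <= H2 (Negz k)) ->
  zsum L M H1 <= zsum L M H2.
Proof.
move=> H12; rewrite /zsum !big_nat; apply: ler_sum => k /H12[h1 h2].
exact: lerD.
Qed.

Lemma zsum_ge0 L M H : (forall n, 0 <= H n) -> 0 <= zsum L M H.
Proof. by move=> H0; apply: sumr_ge0 => k _; rewrite addr_ge0. Qed.

Lemma ler_zsum_nat L M L' M' H : (forall n, 0 <= H n) ->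
  (L' <= L)%N -> (M <= M')%N -> zsum L M H <= zsum L' M' H.
Proof.
move=> H0 LL MM; case: (leqP L M) => LM; last first.
  by rewrite {1}/zsum big_geq ?zsum_ge0// ltnW.
rewrite (@zsum_split _ L' L M')/=; last by rewrite LL (leq_trans LM).
rewrite (@zsum_split _ L M M')/=; last by rewrite LM.
by rewrite addrCA lerDl addr_ge0// zsum_ge0.
Qed.

Lemma normc_zsum L M (a : int -> R[i]) :
  Normc.normc (zsum L M a) <= zsum L M (fun n => Normc.normc (a n)).
Proof.
apply: (le_trans (normc_sum _ _ _)); apply: ler_sum => k _; exact: le_normcD.
Qed.

Lemma normc_dft_le (J : nat) F n (B : R) : (0 < J)%N ->
  (forall j, Normc.normc (F j) <= B) -> Normc.normc (dft J F n) <= B.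
Proof.
move=> J0 HF; rewrite /dft Normc.normcM.
have -> : Normc.normc (J%:R^-1)%:C = (J%:R : R)^-1.
  by rewrite normc_real ger0_norm// invr_ge0.
rewrite ler_pdivrMl ?ltr0n//; apply: (le_trans (normc_sum _ _ _)).
apply: (@le_trans _ _ (\sum_(0 <= j < J) B)).
  by apply: ler_sum => j _; rewrite Normc.normcM normc_eix mulr1.
by rewrite sumr_const_nat subn0 mulr_natl.
Qed.

(** Cauchy-Schwarz with the product of norms replaced by a weighted sum of squares. The bound is
    linear in each quadratic sum, so expectations can be taken term by term later on. *)
Lemma zsum_weighted_amgm L M a g (W : int -> R) (k : R) : 0 < k -> (forall n, 0 < W n) ->
  zsum L M (fun n => Normc.normc (a n) * Normc.normc (g n)) <=
  (k^-1 * zsum L M (fun n => (W n)^-1 * sqn (a n)) + k * zsum L M (fun n => W n * sqn (g n))) / 2.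
Proof.
move=> k0 W0; rewrite -!zsum_mull -zsumD mulrC -zsum_mull.
have h n : Normc.normc (a n) * Normc.normc (g n) <=
    2^-1 * (k^-1 * ((W n)^-1 * sqn (a n)) + k * (W n * sqn (g n))).
  have kW : 0 < k * W n by rewrite mulr_gt0.
  rewrite !mulrA -invfM; set x := Normc.normc (a n); set y := Normc.normc (g n).
  rewrite -/(k * W n) /sqn -/x -/y; set w := k * W n in kW *.
  have : 0 <= w^-1 * (x - w * y) ^+ 2 by rewrite mulr_ge0 ?sqr_ge0// invr_ge0 ltW.
  have -> : w^-1 * (x - w * y) ^+ 2 = w^-1 * x ^+ 2 + w * y ^+ 2 - 2 * (x * y).
    by field; rewrite gt_eqF.
  lra.
by apply: ler_zsum => n _; split; exact: h.
Qed.

(** Interpolation in linear form: the first term dominates for y <= lam, the second for y > lam.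
    Applied to the Sobolev weights, it bounds the H^s norm by the L^2 and H^1 norms. *)
Lemma powR_le_split (s lam y : R) : 0 <= s <= 1 -> 0 < lam -> 0 < y ->
  y `^ s <= lam `^ s + lam `^ (s - 1) * y.
Proof.
move=> /andP[s0 s1] lam0 y0; have [yl|ly] := leP y lam.
  rewrite (@le_trans _ _ (lam `^ s))//; first by rewrite ge0_ler_powR// nnegrE ltW.
  by rewrite lerDl mulr_ge0 ?powR_ge0// ltW.
rewrite (@le_trans _ _ (lam `^ (s - 1) * y))//; last by rewrite lerDr powR_ge0.
rewrite -{1}(subrK 1 s) [y `^ (s - 1 + 1)]powRD; last by apply/implyP => _; rewrite gt_eqF.
rewrite powRr1 ?(ltW y0)// ler_wpM2r ?(ltW y0)//.
rewrite -(opprK (s - 1)) !(powRN _ (- (s - 1))) lef_pV2 ?posrE ?powR_gt0//.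
by rewrite ge0_ler_powR ?nnegrE ?(ltW lam0) ?(ltW y0) ?(ltW ly)// oppr_ge0 subr_le0.
Qed.

(** Roles in the application: F and G are the grid values of M_eps and of t^s exp(i beta X_t), so c
    = t^s is the constant modulus of G; m and u are the Fourier coefficients of M_eps and of M; eta
    measures the tail of u, eta' the distance from M_eps to M in H^-1, and lam is the interpolation
    threshold. *)
Variables (N' L N : nat).
Hypotheses (L0 : (0 < L)%N) (LN : (L <= N)%N) (NN : (N <= N')%N).
Variables (F G : nat -> R[i]) (m u : int -> R[i]) (c b2 eta eta' A lam s : R).
Local Notation J := N'.*2.
Hypotheses (c0 : 0 < c) (eta0 : 0 < eta) (eta'0 : 0 < eta') (lam0 : 0 < lam) (s01 : 0 <= s <= 1).
Hypothesis GJ : G J = G 0%N.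
Hypothesis Gc : forall j, sqn (G j) = c ^+ 2.
Hypothesis Fb : J%:R^-1 * \sum_(0 <= j < J) sqn (F j) <= b2.
Hypothesis mu_le : zsum 0 N (fun n => bessel n `^ (-1) * sqn (m n - u n)) <= eta' ^+ 2.
Hypothesis u_le : zsum 0 L (fun n => bessel n `^ (- s) * sqn (u n)) <= A.
Hypothesis u_tail : zsum L N (fun n => bessel n `^ (- s) * sqn (u n)) <= eta ^+ 2.

Let N'0 : (0 < N')%N. Proof. by rewrite (leq_trans L0)// (leq_trans LN). Qed.
Let J0 : (0 < J)%N. Proof. by rewrite double_gt0. Qed.
Let JR0 : J%:R != 0 :> R. Proof. by rewrite pnatr_eq0 -lt0n. Qed.

(** Bounds the squared H^1 norm of G through finite differences; the factor 4 is the loss in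
    [dft_gradient]. *)
Definition h1_bound : R := c ^+ 2 +
  4 / (pi *+ 2 / J%:R) ^+ 2 * (J%:R^-1 * \sum_(0 <= j < J) sqn (G j.+1 - G j)).

Local Notation g := (dft J G).

Let energy_g : zsum 0 N' (fun n => sqn (g n)) = c ^+ 2.
Proof.
rewrite dft_energy//; under eq_bigr do rewrite Gc.
by rewrite sumr_const_nat subn0 -[X in _ * X]mulr_natr mulrCA mulVf// mulr1.
Qed.

Let grad_g : zsum 0 N' (fun n => n%:~R ^+ 2 * sqn (g n)) <= h1_bound - c ^+ 2.
Proof. by rewrite /h1_bound addrAC subrr add0r; exact: dft_gradient. Qed.

Let sub_le (H : int -> R) (L1 M1 : nat) (B : R) :
  (forall n, 0 <= H n) -> (M1 <= N')%N -> zsum 0 N' H <= B -> zsum L1 M1 H <= B.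
Proof. by move=> H0 bN; apply: le_trans; exact: ler_zsum_nat. Qed.

Let h1_g : zsum 0 N' (fun n => bessel n * sqn (g n)) <= h1_bound.
Proof.
rewrite (@eq_zsum _ _ _ _ (fun n => sqn (g n) + n%:~R ^+ 2 * sqn (g n))); last first.
  by move=> n; rewrite /bessel mulrDl mul1r.
by rewrite zsumD energy_g -lerBrDl.
Qed.

Let hs_g : zsum 0 N' (fun n => bessel n `^ s * sqn (g n)) <=
  lam `^ s * c ^+ 2 + lam `^ (s - 1) * h1_bound.
Proof.
apply: (@le_trans _ _ (zsum 0 N' (fun n => lam `^ s * sqn (g n) + lam `^ (s - 1) * (bessel n * sqn (g n))))).
  have h n : bessel n `^ s * sqn (g n) <= lam `^ s * sqn (g n) + lam `^ (s - 1) * (bessel n * sqn (g n)).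
    by rewrite mulrA -mulrDl ler_wpM2r ?sqn_ge0// powR_le_split// bessel_gt0.
  by apply: ler_zsum => n _; split; exact: h.
by rewrite zsumD !zsum_mull energy_g lerD2l ler_wpM2l// powR_ge0.
Qed.

Let normc_g n : Normc.normc (g n) <= c.
Proof.
apply: normc_dft_le => // j.
by rewrite -ler_sqr ?nnegrE ?normc_ge0 ?(ltW c0)// -/(sqn _) Gc.
Qed.

(* The five terms come from the frequencies |n| >= N (controlled by the gradient
   of G), aliasing, replacing the coefficients m of M_eps by those u of M, the
   tail L <= |n| < N of u, and the frequencies |n| < L. *)
Lemma duality_bound :
  Normc.normc ((J%:R^-1)%:C * \sum_(0 <= j < J) F j * ((G j)^*)%C) <=
  (b2 + h1_bound) / (2 * N%:R) +
  c * zsum 0 N (fun n => Normc.normc (dft J F n - m n)) +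
  eta' / 2 * (1 + h1_bound) +
  eta / 2 * (1 + (lam `^ s * c ^+ 2 + lam `^ (s - 1) * h1_bound)) +
  c / 2 * (bessel L `^ s * A + 1).
Proof.
have N0 : (0 < N)%N by exact: leq_trans LN.
have NR0 : 0 < N%:R :> R by rewrite ltr0n.
have LN' : (L <= N')%N by exact: leq_trans NN.
rewrite -dft_parseval//.
rewrite (@zsum_split _ 0 N N')//=.
rewrite (@eq_zsum _ 0 N _ (fun n => (dft J F n - m n) * ((g n)^*)%C +
   ((m n - u n) * ((g n)^*)%C + u n * ((g n)^*)%C))); last first.
  by move=> n; rewrite -!mulrDl addrA subrKA subrK.
rewrite !zsumD [zsum 0 N (fun n => u n * _)](@zsum_split _ 0 L N)//=.
have le n1 n2 a : Normc.normc (zsum n1 n2 (fun n => a n * ((g n)^*)%C)) <=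
    zsum n1 n2 (fun n => Normc.normc (a n) * Normc.normc (g n)).
  apply: (le_trans (normc_zsum _ _ _)); apply: ler_zsum => k _.
  by split; rewrite Normc.normcM normcJ_real.
have T1 : Normc.normc (zsum N N' (fun n => dft J F n * ((g n)^*)%C)) <= (b2 + h1_bound) / (2 * N%:R).
  apply: (le_trans (le _ _ _)).
  (* On these frequencies the gradient bound gains a factor N^-2 for g, so the weight k = N makes
     both halves of order 1/N. *)
  have := @zsum_weighted_amgm N N' (dft J F) g (fun=> 1) N%:R NR0 (fun=> ltr01).
  move=> /le_trans; apply.
  rewrite [leRHS](_ : _ = (N%:R^-1 * b2 + N%:R^-1 * h1_bound) / 2); last by field; rewrite gt_eqF.
  rewrite ler_pM2r//; apply: lerD.
    rewrite ler_pM2l ?invr_gt0//; apply: le_trans Fb; rewrite -dft_energy//.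
    under [zsum N N' _]eq_zsum do rewrite invr1 mul1r.
    by apply: ler_zsum_nat => // n; exact: sqn_ge0.
  rewrite [leRHS]mulrC ler_pdivlMr// mulrAC -zsum_mull.
  apply: (@le_trans _ _ (zsum N N' (fun n => n%:~R ^+ 2 * sqn (g n)))).
    have h (n : int) : (N <= `|n|)%N -> N%:R * N%:R * (1 * sqn (g n)) <= n%:~R ^+ 2 * sqn (g n).
      move=> Nn; rewrite mul1r ler_wpM2r ?sqn_ge0// -expr2 -[leRHS]real_normK ?num_real//.
      by rewrite ler_sqr ?nnegrE// -intr_norm -abszE ler_nat.
    by apply: ler_zsum => k /andP[Nk _]; split; apply: h => //; exact: leqW.
  apply: sub_le => //; first by move=> n; rewrite mulr_ge0 ?sqr_ge0 ?sqn_ge0.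
  by apply: (le_trans grad_g); rewrite lerBlDr lerDl sqr_ge0.
have T2 : Normc.normc (zsum 0 N (fun n => (dft J F n - m n) * ((g n)^*)%C)) <=
    c * zsum 0 N (fun n => Normc.normc (dft J F n - m n)).
  apply: (le_trans (le _ _ _)); rewrite -zsum_mull.
  have h n : Normc.normc (dft J F n - m n) * Normc.normc (g n) <= c * Normc.normc (dft J F n - m n).
    by rewrite mulrC ler_wpM2r ?normc_ge0.
  by apply: ler_zsum => k _; split; exact: h.
have T3 : Normc.normc (zsum 0 N (fun n => (m n - u n) * ((g n)^*)%C)) <= eta' / 2 * (1 + h1_bound).
  apply: (le_trans (le _ _ _)).
  have := @zsum_weighted_amgm 0 N (fun n => m n - u n) g _ eta' eta'0 bessel_gt0.
  move=> /le_trans; apply.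
  rewrite [leRHS](_ : _ = (eta'^-1 * eta' ^+ 2 + eta' * h1_bound) / 2); last by field; rewrite gt_eqF.
  rewrite ler_pM2r//; apply: lerD.
    rewrite ler_pM2l ?invr_gt0//; apply: le_trans mu_le.
    by apply: ler_zsum => k _; rewrite !powR_inv1 ?(ltW (bessel_gt0 _)).
  rewrite ler_pM2l//; apply: sub_le => // n.
  by rewrite mulr_ge0 ?sqn_ge0// ltW// bessel_gt0.
have T4 : Normc.normc (zsum L N (fun n => u n * ((g n)^*)%C)) <=
    eta / 2 * (1 + (lam `^ s * c ^+ 2 + lam `^ (s - 1) * h1_bound)).
  apply: (le_trans (le _ _ _)).
  have := @zsum_weighted_amgm L N u g (fun n => bessel n `^ s) eta eta0
    (fun n => powR_gt0 s (bessel_gt0 n)).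
  move=> /le_trans; apply.
  set X := (X in 1 + X).
  rewrite [leRHS](_ : _ = (eta^-1 * eta ^+ 2 + eta * X) / 2); last by field; rewrite gt_eqF.
  rewrite ler_pM2r//; apply: lerD.
    rewrite ler_pM2l ?invr_gt0//; apply: le_trans u_tail.
    by apply: ler_zsum => k _; rewrite !powRN.
  rewrite ler_pM2l//; apply: sub_le => // n.
  by rewrite mulr_ge0 ?sqn_ge0// powR_ge0.
have T5 : Normc.normc (zsum 0 L (fun n => u n * ((g n)^*)%C)) <= c / 2 * (bessel L `^ s * A + 1).
  apply: (le_trans (le _ _ _)).
  (* The L^2 norm of g squared is c^2; the weight k = c^-1 turns both halves into multiples of c,
     which is small. *)
  have cV0 : 0 < c^-1 by rewrite invr_gt0.
  have := @zsum_weighted_amgm 0 L u g (fun=> 1) c^-1 cV0 (fun=> ltr01).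
  move=> /le_trans; apply.
  rewrite invrK [leRHS](_ : _ = (c * (bessel L `^ s * A) + c^-1 * c ^+ 2) / 2); last by field; rewrite gt_eqF.
  rewrite ler_pM2r//; apply: lerD; last first.
    rewrite ler_pM2l//; under [zsum 0 L _]eq_zsum do rewrite mul1r.
    apply: sub_le => //; last by rewrite energy_g.
    by move=> n; exact: sqn_ge0.
  rewrite ler_pM2l// -ler_pdivrMl ?powR_gt0 ?bessel_gt0//.
  apply: le_trans u_le; rewrite -zsum_mull.
  have h (n : int) : (`|n| <= L)%N -> (bessel L `^ s)^-1 * (1^-1 * sqn (u n)) <= bessel n `^ (- s) * sqn (u n).
    move=> nL; rewrite invr1 mul1r ler_wpM2r ?sqn_ge0// powRN lef_pV2 ?posrE ?powR_gt0 ?bessel_gt0//.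
    case/andP: s01 => s0 _.
    rewrite ge0_ler_powR// ?nnegrE ?(ltW (bessel_gt0 _))// /bessel lerD2l.
    rewrite -real_normK ?num_real// ler_sqr ?nnegrE//.
    by rewrite -intr_norm -abszE ler_nat.
  by apply: ler_zsum => k /andP[_ kL]; split; apply: h => //; exact: ltnW.
have tri (z w : R[i]) x y : Normc.normc z <= x -> Normc.normc w <= y -> Normc.normc (z + w) <= x + y.
  by move=> zx wy; apply: (le_trans (le_normcD _ _)); exact: lerD.
have := tri _ _ _ _ (tri _ _ _ _ T2 (tri _ _ _ _ T3 (tri _ _ _ _ T5 T4))) T1.
move=> /le_trans; apply.
move: (_ / (2 * _)) (c * _) (eta' / 2 * _) (eta / 2 * _) (c / 2 * _) => x1 x2 x3 x4 x5.
lra.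
Qed.

End duality_bound.

(** * The mollified logarithmic kernel *)

Section antiderivatives.
Context {R : realType}.
Notation mu := (@lebesgue_measure R).
Implicit Types (f F : R -> R).

Lemma is_derive_continuous f df (x : R) :
  is_derive x (1 : R) f df -> {for x, continuous f}.
Proof. by move=> d; apply/differentiable_continuous/derivable1_diffP; case: d. Qed.

Lemma is_derive_chain f g (x a b : R) : is_derive (g x) (1 : R) f a ->
  is_derive x (1 : R) g b -> is_derive x (1 : R) (fun y => f (g y)) (b * a).
Proof. by move=> df dg; rewrite mulrC; exact: is_derive1_comp. Qed.

(** The primitive integrates from a and is differentiated only to the right of a; each use places a
    to the left of all points concerned. *)
Lemma continuous_antiderivative f (a : R) : continuous f ->
  exists F, forall x : R, a < x -> is_derive x (1 : R) F (f x).
Proof.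
move=> cf; exists (fun x => \int[mu]_(t in `[a, x]) f t) => x ax.
have x1 : x < x + 1 by rewrite ltrDl.
have fi : mu.-integrable `[a, x + 1] (EFin \o f).
  apply: continuous_compact_integrable; first exact: segment_compact.
  by apply: continuous_subspaceT => y; exact: cf.
have [d1 d2] := continuous_FTC1_closed x1 fi ax (cf x).
apply: DeriveDef; first exact: d1.
by rewrite -derive1E; exact: d2.
Qed.

Lemma Rintegral_antiderivative f F (a b : R) : a < b -> continuous f ->
  (forall x, a <= x <= b -> is_derive x (1 : R) F (f x)) ->
  \int[mu]_(x in `[a, b]) f x = F b - F a.
Proof.
move=> ab cf dF; rewrite /Rintegral (@continuous_FTC2 R f F a b ab)//.
- by apply: continuous_subspaceT => x; exact: cf.
- split.
  + by move=> x; rewrite in_itv/= => /andP[ax xb]; case: (dF x); rewrite // !ltW.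
  + by apply: cvg_at_right_filter; apply: (@is_derive_continuous _ (f a)); apply: dF; rewrite lexx ltW.
  + by apply: cvg_at_left_filter; apply: (@is_derive_continuous _ (f b)); apply: dF; rewrite lexx ltW.
- move=> x; rewrite in_itv/= => /andP[ax xb]; rewrite derive1E.
  by case: (dF x); rewrite // !ltW.
Qed.

Lemma derive0_ray f (c x y : R) : (forall z, c < z -> is_derive z (1 : R) f 0) ->
  c < x -> c < y -> f x = f y.
Proof.
move=> df; wlog xy : x y / x <= y.
  move=> H cx cy; case: (leP x y) => [xy|/ltW yx]; first exact: H.
  by apply/esym; exact: H.
move=> cx cy; move: xy; rewrite le_eqVlt => /predU1P[->//|xy].
have dfx z : z \in `]x, y[ -> is_derive z (1 : R) f ((fun=> 0) z).
  by rewrite in_itv/= => /andP[xz _]; apply: df; exact: lt_trans xz.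
have cf : {within `[x, y], continuous f}.
  apply: continuous_in_subspaceT => z; rewrite inE/= in_itv/= => /andP[xz _].
  by apply: (@is_derive_continuous _ 0); apply: df; exact: lt_le_trans xz.
have [z _] := MVT xy dfx cf.
by rewrite mul0r => /eqP; rewrite subr_eq0 => /eqP.
Qed.

Lemma derive_bounded_lipschitz f df (B x y : R) :
  (forall z, is_derive z (1 : R) f (df z)) -> (forall z, `|df z| <= B) ->
  `|f x - f y| <= B * `|x - y|.
Proof.
move=> dF HB; wlog xy : x y / x <= y.
  move=> H; case: (leP x y) => [/H//|/ltW yx].
  by rewrite distrC (distrC x); exact: H.
have cf : {within `[x, y], continuous f}.
  by apply: continuous_subspaceT => z; exact: is_derive_continuous (dF z).
have [z _ E] := MVT_segment xy (fun z _ => dF z) cf.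
by rewrite distrC E normrM (distrC x) ler_wpM2r.
Qed.

Lemma is_derive_derive1n f k x : smooth f ->
  is_derive x (1 : R) (derive1n k f) (derive1n k.+1 f x).
Proof. by move=> sf; rewrite derive1nS derive1E; apply: DeriveDef => //; exact: sf. Qed.

End antiderivatives.

Section mollifier_periodization.
Context {R : realType}.
Variable phi : R -> R.
Hypothesis hphi : mollifier phi.
Notation mu := (@lebesgue_measure R).

Let phi_smooth : smooth phi. Proof. by case: hphi. Qed.
Let phi_ge0 x : 0 <= phi x. Proof. by case: hphi. Qed.
Let phi_supp x : 1 < `|x| -> phi x = 0. Proof. by case: hphi => _ _ _ + _; exact. Qed.

Let dphi k (x : R) : is_derive x (1 : R) (derive1n k phi) (derive1n k.+1 phi x).
Proof. exact: is_derive_derive1n. Qed.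

Let cphi k : continuous (derive1n k phi).
Proof. by move=> x; exact: is_derive_continuous (dphi k x). Qed.

Let near_gt1 (x : R) : 1 < `|x| -> \forall y \near x, 1 < `|y|.
Proof.
move=> x1; have : `|y| @[y --> x] --> `|x| by exact: norm_continuous.
by move=> /cvgr_gt; exact.
Qed.

Lemma derive1n_supp k x : 1 < `|x| -> derive1n k phi x = 0.
Proof.
elim: k x => [|k IH] x x1; first exact: phi_supp.
rewrite derive1nS derive1E.
rewrite (@near_eq_derive _ _ _ (derive1n k phi) (cst 0)) ?derive_cst//.
by apply: filterS (near_gt1 x1) => y /IH.
Qed.

Lemma derive1n_bounded k : exists2 B : R, 0 < B & forall x, `|derive1n k phi x| <= B.
Proof.
have cn : {within `[-1, 1], continuous (fun x : R => `|derive1n k phi x|)}.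
  apply: continuous_subspaceT => x; apply: continuous_comp; [exact: cphi|exact: norm_continuous].
have N11 : -1 <= 1 :> R by lra.
have [c _ Hc] := @EVT_max R (fun x => `|derive1n k phi x|) (-1) 1 N11 cn.
exists (`|derive1n k phi c| + 1) => [|x]; first by rewrite ltr_wpDl.
case: (leP `|x| 1) => [x1|x1]; last by rewrite derive1n_supp// normr0 addr_ge0.
by rewrite (le_trans (Hc x _)) ?lerDl// in_itv/= -ler_norml.
Qed.

Lemma derive1n_lipschitz k : exists2 B : R, 0 < B &
  forall x y, `|derive1n k phi x - derive1n k phi y| <= B * `|x - y|.
Proof.
have [B B0 HB] := derive1n_bounded k.+1; exists B => // x y.
exact: derive_bounded_lipschitz (dphi k) HB.
Qed.

Definition periodize (e t : R) : R :=
  \sum_(k \in [set: int]) e^-1 * phi ((t + pi *+ 2 * k%:~R) / e).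

Lemma mollifier_kernelE e x y : mollifier_kernel phi e x y = periodize e (x - y).
Proof. by []. Qed.

Lemma nearest_period (t : R) : exists k : int, `|t + pi *+ 2 * k%:~R| <= pi.
Proof.
have p0 := @pi_gt0 R; have tp : 0 < pi *+ 2 :> R by rewrite -mulr_natr mulr_gt0.
exists (- Num.floor ((t + pi) / (pi *+ 2))).
set z := (t + pi) / (pi *+ 2); have tE : t = z * (pi *+ 2) - pi by rewrite /z divfK ?gt_eqF// addrK.
have /andP[f1 f2] := floor_itv z.
rewrite tE intrN mulrN; move: f2; rewrite intrD1 => f2.
rewrite -mulr_natr in tp *; rewrite ler_norml; apply/andP; split; nra.
Qed.

(** Any other translate has absolute value above pi - 1/2 > 1 >= e, outside the support. The margin
    1/2 lets one k serve a whole neighbourhood of a point, so that derivatives of the periodization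
    are those of a single term. *)
Lemma distant_period (e s : R) (k k' : int) : 0 < e <= 1 ->
  `|s + pi *+ 2 * k%:~R| < pi + 2^-1 -> k' != k -> phi ((s + pi *+ 2 * k'%:~R) / e) = 0.
Proof.
move=> /andP[e0 e1] sk kk; apply: phi_supp.
rewrite normrM normfV (gtr0_norm e0) ltr_pdivlMr// mul1r (le_lt_trans e1)//.
have p2 := @pi_ge2 R; have p0 := @pi_gt0 R.
have h : 1 <= `|(k' - k)%:~R| :> R.
  by rewrite -intr_norm -[1]/(1%:~R) ler_int -gtz0_ge1 normr_gt0 subr_eq0.
have E : s + pi *+ 2 * k'%:~R = (s + pi *+ 2 * k%:~R) + pi *+ 2 * (k' - k)%:~R.
  by rewrite intrB; ring.
rewrite E addrC; apply: lt_le_trans (lerB_normD _ _); rewrite normrM.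
rewrite -(mulr_natr pi) normrM (gtr0_norm p0) normr_nat.
rewrite -(mulr_natr pi) in sk.
suff H (u v : R) : u < pi + 2^-1 -> pi * 2 <= pi * 2 * v -> 1 < pi * 2 * v - u.
  by apply: H => //; rewrite ler_peMr// mulr_ge0// ltW.
by lra.
Qed.

Lemma periodize_local (e s : R) (k : int) : 0 < e <= 1 ->
  `|s + pi *+ 2 * k%:~R| < pi + 2^-1 ->
  periodize e s = e^-1 * phi ((s + pi *+ 2 * k%:~R) / e).
Proof.
move=> e01 sk; rewrite /periodize -(@fsbig_widen _ _ _ _ [set k] [set: int])//.
  by rewrite fsbig_set1.
by move=> k' /= [_ /eqP kk]; rewrite (distant_period e01 sk)// mulr0.
Qed.

Lemma periodize_near (e t : R) : 0 < e <= 1 -> exists k : int,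
  forall s, `|s - t| < 2^-1 -> periodize e s = e^-1 * phi ((s + pi *+ 2 * k%:~R) / e).
Proof.
move=> e01; have [k tk] := nearest_period t; exists k => s st.
apply: periodize_local => //.
have -> : s + pi *+ 2 * k%:~R = (t + pi *+ 2 * k%:~R) + (s - t) by ring.
by rewrite (le_lt_trans (ler_normD _ _))// ler_ltD.
Qed.

Lemma periodize_periodic e : 0 < e <= 1 -> periodic (periodize e) (pi *+ 2).
Proof.
move=> e01 t; have [k tk] := nearest_period t.
have tk1 : `|t + pi *+ 2 * k%:~R| < pi + 2^-1 by rewrite (le_lt_trans tk)// ltrDl invr_gt0.
have E : (t + pi *+ 2) + pi *+ 2 * (k - 1)%:~R = t + pi *+ 2 * k%:~R by rewrite intrB; ring.
rewrite (periodize_local e01 tk1) (@periodize_local e (t + pi *+ 2) (k - 1))// ?E//.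
Qed.

Lemma periodize_ge0 e t : 0 < e <= 1 -> 0 <= periodize e t.
Proof.
move=> e01; have [k ->] := periodize_near t e01; last by rewrite subrr normr0 invr_gt0.
by case/andP: e01 => e0 _; rewrite mulr_ge0// invr_ge0 ltW.
Qed.

Lemma periodize_supp e t : 0 < e <= 1 -> periodize e t != 0 ->
  exists k : int, `|t + pi *+ 2 * k%:~R| <= e.
Proof.
move=> e01; have [k ->] := periodize_near t e01; last by rewrite subrr normr0 invr_gt0.
move=> h; exists k; rewrite leNgt; apply: contra h => h.
case/andP: e01 => e0 _.
by rewrite phi_supp ?mulr0// normrM normfV (gtr0_norm e0) ltr_pdivlMr// mul1r.
Qed.

Lemma derive1n_periodize_near (e t : R) : 0 < e <= 1 -> exists k : int,
  forall j s, `|s - t| < 2^-1 -> derivable (derive1n j (periodize e)) s 1 /\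
  derive1n j (periodize e) s = e^-1 * (e^-1 ^+ j * derive1n j phi ((s + pi *+ 2 * k%:~R) / e)).
Proof.
move=> e01; have [k Hk] := periodize_near t e01; exists k => j.
have e0 : e != 0 by case/andP: e01 => e0 _; rewrite gt_eqF.
pose G j s := e^-1 * (e^-1 ^+ j * derive1n j phi ((s + pi *+ 2 * k%:~R) / e)).
have dG i (x : R) : is_derive x (1 : R) (G i) (G i.+1 x).
  have dp := dphi i ((x + pi *+ 2 * k%:~R) / e).
  have dl : is_derive x (1 : R) (fun s => (s + pi *+ 2 * k%:~R) / e) (e^-1).
    by apply: is_derive_eq; rewrite /GRing.scale/=; field.
  rewrite /G; apply: is_derive_eq; rewrite /GRing.scale/= /G exprS; ring.
have near1 (s : R) : `|s - t| < 2^-1 -> \forall x \near s, `|x - t| < 2^-1.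
  move=> st; have : `|x - t| @[x --> s] --> `|s - t|.
    by apply: cvg_norm; apply: cvgB; [exact: cvg_id|exact: cvg_cst].
  by move=> /cvgr_lt; exact.
suff H i : forall s, `|s - t| < 2^-1 -> derive1n i (periodize e) s = G i s.
  move=> s st; split; last exact: H.
  apply: (@near_eq_derivable _ _ _ (G j)); last by case: (dG j s).
  by apply: filterS (near1 s st) => x xt; rewrite H.
elim: i => [|i IH] s st; first by rewrite derive1n0 Hk// /G expr0 mul1r.
rewrite derive1nS derive1E (@near_eq_derive _ _ _ _ (G i)).
  by case: (dG i s).
by apply: filterS (near1 s st) => x xt; rewrite IH.
Qed.

Lemma periodize_smooth e : 0 < e <= 1 -> smooth (periodize e).
Proof.
move=> e01 j t; have [k H] := derive1n_periodize_near t e01.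
by case: (H j t); rewrite ?subrr ?normr0 ?invr_gt0.
Qed.

Lemma is_derive_periodize e j (t : R) : 0 < e <= 1 ->
  is_derive t (1 : R) (derive1n j (periodize e)) (derive1n j.+1 (periodize e) t).
Proof.
by move=> e01; apply: is_derive_derive1n => i x; exact: periodize_smooth.
Qed.

Lemma continuous_periodize e : 0 < e <= 1 -> continuous (periodize e).
Proof. by move=> e01 t; exact: is_derive_continuous (is_derive_periodize 0 t e01). Qed.

Lemma derive1n_periodize_bounded e j : 0 < e <= 1 ->
  exists2 B : R, 0 < B & forall t, `|derive1n j (periodize e) t| <= B.
Proof.
move=> e01; have [B B0 HB] := derive1n_bounded j.
have e0 : 0 < e by case/andP: e01.
exists (e^-1 * (e^-1 ^+ j * B)) => [|t]; first by rewrite !mulr_gt0 ?exprn_gt0 ?invr_gt0.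
have [k /(_ j t)[|_ ->]] := derive1n_periodize_near t e01; first by rewrite subrr normr0 invr_gt0.
rewrite !normrM normrX normfV (gtr0_norm e0) ler_pM2l ?invr_gt0//.
by rewrite ler_pM2l ?exprn_gt0 ?invr_gt0.
Qed.

Lemma periodize_bounded : exists2 B : R, 0 < B &
  forall e t, 0 < e <= 1 -> periodize e t <= B / e.
Proof.
have [B B0 HB] := derive1n_bounded 0; exists B => // e t e01.
have e0 : 0 < e by case/andP: e01.
have [k ->] := periodize_near t e01; last by rewrite subrr normr0 invr_gt0.
by rewrite mulrC ler_pM2r ?invr_gt0// (le_trans (ler_norm _))// HB.
Qed.

Lemma periodize_lipschitz : exists2 B : R, 0 < B &
  forall e s t, 0 < e <= 1 -> `|s - t| < 2^-1 ->
    `|periodize e s - periodize e t| <= B / e ^+ 2 * `|s - t|.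
Proof.
have [B B0 HB] := derive1n_lipschitz 0; exists B => // e s t e01 st.
have e0 : 0 < e by case/andP: e01.
have [k Hk] := periodize_near t e01; rewrite !Hk ?subrr ?normr0 ?invr_gt0//.
rewrite -mulrBr normrM normfV (gtr0_norm e0) ler_pdivrMl//.
apply: (le_trans (HB _ _)).
rewrite -mulrBl opprD addrACA subrr addr0 normrM normfV (gtr0_norm e0).
by rewrite [leRHS](_ : _ = B * (`|s - t| / e))//; field; rewrite gt_eqF.
Qed.

Lemma derive1n_periodize_lipschitz e j : 0 < e <= 1 ->
  exists2 B : R, 0 < B & forall s t,
    `|derive1n j (periodize e) s - derive1n j (periodize e) t| <= B * `|s - t|.
Proof.
move=> e01; have [B B0 HB] := derive1n_periodize_bounded j.+1 e01; exists B => // x y.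
by apply: derive_bounded_lipschitz HB => z; exact: is_derive_periodize.
Qed.

Lemma Rintegral_mollifier (c : R) : 1 <= c -> \int[mu]_(x in `[- c, c]) phi x = 1.
Proof.
move=> c1; have [_ _ _ _ int1] := hphi.
rewrite /Rintegral integral_mkcond (_ : integral _ _ _ = 1%E)//.
rewrite -int1; apply: eq_integral => x _; rewrite patchE; case: ifPn => //.
rewrite notin_setE/= in_itv/= -ler_norml => /negP; rewrite -ltNge => cx.
by rewrite phi_supp// (le_lt_trans c1).
Qed.

(** Changes of variables are carried out on primitives. By periodicity Q y - Q (y - 2 pi) is
    constant, which moves the period to [-pi, pi]; there only the term k = 0 survives, and scaling
    leads to the integral of phi over an interval containing [-1, 1]. *)
Lemma Rintegral_periodize e x : 0 < e <= 1 ->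
  \int[mu]_(a in `[0, pi *+ 2]) periodize e (x - a) = 1.
Proof.
move=> e01; have e0 : 0 < e by case/andP: e01.
have p0 := @pi_gt0 R; have tp : 0 < pi *+ 2 :> R by rewrite -mulr_natr mulr_gt0.
have cp := continuous_periodize e01.
pose a0 := Num.min x (- pi) - pi *+ 2 - 1.
have [Q dQ] := continuous_antiderivative a0 cp.
have a0x : a0 < x - pi *+ 2 by rewrite /a0; have : Num.min x (- pi) <= x by [rewrite ge_min lexx]; lra.
have a0p : a0 < - pi - pi *+ 2 by rewrite /a0; have : Num.min x (- pi) <= - pi by [rewrite ge_min lexx orbT]; lra.
have -> : \int[mu]_(a in `[0, pi *+ 2]) periodize e (x - a) = - Q (x - pi *+ 2) - (- Q (x - 0)).
  apply: (@Rintegral_antiderivative _ (fun a => periodize e (x - a)) (fun a => - Q (x - a))) => //.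
    by move=> a; apply: continuous_comp; [apply: cvgB; [exact: cvg_cst|exact: cvg_id]|exact: cp].
  move=> a /andP[_ ap].
  have d1 : is_derive (x - a) (1 : R) Q (periodize e (x - a)) by apply: dQ; lra.
  have d2 : is_derive a (1 : R) (fun a => x - a) (-1).
    by apply: is_derive_eq; ring.
  have d3 := @is_derive_chain R Q (fun a => x - a) a _ _ d1 d2.
  by apply: is_derive_eq; rewrite mulN1r opprK.
rewrite subr0 opprK addrC.
have -> : Q x - Q (x - pi *+ 2) = Q pi - Q (pi - pi *+ 2).
  apply: (@derive0_ray _ (fun y => Q y - Q (y - pi *+ 2)) (a0 + pi *+ 2)); [|lra|lra].
  move=> z az; have d1 : is_derive z (1 : R) Q (periodize e z) by apply: dQ; lra.
  have d1' : is_derive (z - pi *+ 2) (1 : R) Q (periodize e z).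
    have <- : periodize e (z - pi *+ 2) = periodize e z.
      by rewrite -(periodize_periodic e01 (z - pi *+ 2)) subrK.
    by apply: dQ; lra.
  have d2 : is_derive z (1 : R) (fun a => a - pi *+ 2) 1.
    by apply: is_derive_eq; ring.
  have d3 := @is_derive_chain R Q (fun a => a - pi *+ 2) z _ _ d1' d2.
  by apply: is_derive_eq; rewrite mul1r subrr.
have -> : pi - pi *+ 2 = - pi :> R by rewrite -mulr_natr; ring.
have <- : \int[mu]_(a in `[(- pi), pi]) periodize e a = Q pi - Q (- pi).
  apply: (@Rintegral_antiderivative _ (periodize e) Q (- pi) pi) => //; first by lra.
  by move=> z /andP[z1 z2]; apply: dQ; lra.
have [S dS] := @continuous_antiderivative R phi (- (pi / e) - 1) (@cphi 0).
have pe : 1 <= pi / e.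
  rewrite ler_pdivlMr// mul1r; case/andP: e01 => _ e1.
  by have := @pi_ge2 R; lra.
have e1 : - (pi / e) < pi / e by lra.
rewrite -(Rintegral_mollifier pe).
have -> : \int[mu]_(x in `[(- (pi / e)), (pi / e)]) phi x = S (pi / e) - S (- (pi / e)).
  apply: (Rintegral_antiderivative e1 (@cphi 0)).
  by move=> z /andP[z1 z2]; apply: dS; lra.
have -> : \int[mu]_(a in `[(- pi), pi]) periodize e a =
    \int[mu]_(t in `[(- pi), pi]) (e^-1 * phi (t / e)).
  apply: eq_Rintegral => t; rewrite inE/= in_itv/= => tp1.
  rewrite (@periodize_local e t 0)// mulr0 addr0//.
  by rewrite (@le_lt_trans _ _ pi)// ?ltrDl ?invr_gt0// ler_norml.
rewrite -mulNr.
apply: (@Rintegral_antiderivative _ (fun t => e^-1 * phi (t / e)) (fun t => S (t / e))).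
- by lra.
- move=> t; apply: cvgMr; apply: continuous_comp; last exact: (@cphi 0).
  exact: mulrr_continuous.
- move=> t /andP[t1 t2].
  have d1 : is_derive (t / e) (1 : R) S (phi (t / e)).
    apply: dS; rewrite ltrBlDr -mulNr (@le_lt_trans _ _ (t / e))// ?ltrDl//.
    by rewrite ler_pM2r ?invr_gt0.
  have d2 : is_derive t (1 : R) (fun a => a / e) (e^-1).
    by apply: is_derive_eq; rewrite /GRing.scale/=; field; rewrite gt_eqF.
  exact: (@is_derive_chain R S (fun a => a / e) t _ _ d1 d2).
Qed.

End mollifier_periodization.

(** * Chord distance and logarithmic potentials *)

Section chord_distance.
Context {R : realType}.
Notation mu := (@lebesgue_measure R).
Implicit Types (a b c t r : R).

Definition chord a b : R := Normc.normc (eix a - eix b).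

Lemma chord_ge0 a b : 0 <= chord a b. Proof. exact: normc_ge0. Qed.

Lemma chordC a b : chord a b = chord b a. Proof. exact: normcB. Qed.

Lemma chord_triangle b a c : chord a c <= chord a b + chord b c.
Proof. by apply: le_trans (le_normcD _ _); rewrite addrA subrK. Qed.

Lemma chord_le2 a b : chord a b <= 2.
Proof. by apply: (le_trans (le_normcD _ _)); rewrite normcN !normc_eix. Qed.

Lemma chordDper a b (k : int) : chord (a + pi *+ 2 * k%:~R) b = chord a b.
Proof. by rewrite /chord eixD eix_2piz mulr1. Qed.

Lemma chord_sqr a b (k : int) : chord a b ^+ 2 = sqn (eix (a - b + pi *+ 2 * k%:~R) - 1).
Proof.
rewrite eixD eix_2piz mulr1 /chord -/(sqn _).
have -> : eix a - eix b = eix b * (eix (a - b) - 1).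
  by rewrite mulrBr mulr1 -eixD subrKC.
by rewrite sqnM sqn_eix mul1r.
Qed.

Lemma chord_le a b (k : int) : chord a b <= `|a - b + pi *+ 2 * k%:~R|.
Proof.
rewrite -ler_sqr ?nnegrE ?chord_ge0// (chord_sqr a b k) real_normK ?num_real//.
exact: eix_sub1_le.
Qed.

Lemma chord_ge a b (k : int) : `|a - b + pi *+ 2 * k%:~R| <= pi ->
  `|a - b + pi *+ 2 * k%:~R| <= 2 * chord a b.
Proof.
move=> h; rewrite -ler_sqr ?nnegrE ?mulr_ge0 ?chord_ge0// exprMn (chord_sqr a b k).
by have := eix_sub1_ge h; rewrite real_normK ?num_real//; lra.
Qed.

Lemma log_kernelE a b : log_kernel a b = ln (chord a b)^-1.
Proof. by rewrite /log_kernel !cexp_eix. Qed.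

Lemma measurable_chord : measurable_fun setT (fun z : R * R => chord z.1 z.2).
Proof.
have E : (fun z : R * R => chord z.1 z.2) = (fun z : R * R =>
    Num.sqrt ((cos z.1 - cos z.2) ^+ 2 + (sin z.1 - sin z.2) ^+ 2)) by [].
have mc : measurable_fun setT (@cos R) by apply: continuous_measurable_fun; exact: continuous_cos.
have ms : measurable_fun setT (@sin R) by apply: continuous_measurable_fun; exact: continuous_sin.
rewrite E; apply: (@measurableT_comp _ _ _ _ _ _ (@Num.sqrt R)).
  by apply: continuous_measurable_fun; exact: sqrt_continuous.
apply: measurable_funD; apply: (@measurableT_comp _ _ _ _ _ _ (fun x : R => x ^+ 2)) => //;
  by apply: measurable_funB; apply: measurableT_comp.
Qed.

Lemma measurable_chord1 a : measurable_fun setT (chord a).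
Proof. exact: (measurableT_comp measurable_chord (pair1_measurable a)). Qed.

Local Notation I := (`[0%R, (pi *+ 2)%R]%classic : set R).

Definition chord_ball a t : set R := [set b | b \in `[0, pi *+ 2] /\ chord a b <= t].

Lemma measurable_chord_ball a t : measurable (chord_ball a t).
Proof.
rewrite (_ : chord_ball a t = I `&` (chord a @^-1` [set x | x <= t])); last first.
  by apply/seteqP; split => b /=.
apply: measurableI => //; rewrite -[_ @^-1` _]setTI; apply: measurable_chord1 => //.
by rewrite (_ : mkset _ = `]-oo, t]%classic) //; apply/seteqP; split => x /=; rewrite in_itv.
Qed.

End chord_distance.

Section chord_measure.
Context {R : realType}.
Notation mu := (@lebesgue_measure R).
Implicit Types (a b c t r : R).
Local Notation I := (`[0%R, (pi *+ 2)%R]%classic : set R).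

Lemma mu_itvcc (x y : R) : x <= y -> mu `[x, y]%classic = (y - x)%:E.
Proof.
move=> xy; rewrite lebesgue_measure_itv/= lte_fin; case: ltP => [//|yx].
by rewrite (_ : y = x) ?subrr//; apply/eqP; rewrite eq_le xy yx.
Qed.

(** For a in one period, every b of the period at chord at most t lies within 2 t of a, a + 2 pi or
    a - 2 pi: three intervals of length 4 t. *)
Lemma chord_le_measure a t : 0 <= t ->
  (mu (chord_ball a t) <= (12 * t)%:E)%E.
Proof.
move=> t0.
wlog aI : a / 0 <= a <= pi *+ 2.
  move=> H; have [k ak] := nearest_period (a - pi).
  have := H (a + pi *+ 2 * k%:~R).
  have -> : chord_ball (a + pi *+ 2 * k%:~R) t = chord_ball a t.
    by apply/seteqP; split => b /= []; rewrite /chord_ball/= chordDper.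
  apply; move: ak; rewrite ler_norml => /andP[]; rewrite -mulr_natr; lra.
pose V (k : int) := `[a + pi *+ 2 * k%:~R - 2 * t, a + pi *+ 2 * k%:~R + 2 * t]%classic : set R.
have muV k : (mu (V k) <= (4 * t)%:E)%E.
  by rewrite /V mu_itvcc; [rewrite lee_fin; lra|lra].
have sub : chord_ball a t `<=` V 0 `|` V 1 `|` V (-1).
  move=> b /= [/andP[]]; rewrite !bnd_simp => b0 b2 abt.
  have [k abk] := nearest_period (a - b).
  have := chord_ge abk => h.
  have h2 : `|a - b + pi *+ 2 * k%:~R| <= 2 * t by apply: (le_trans h); lra.
  have bV : V k b.
    by rewrite /V/= in_itv/=; move: h2; rewrite ler_norml => /andP[h3 h4]; apply/andP; split; lra.
  have p0 := @pi_gt0 R.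
  have k1 : -1 <= k <= 1.
    move: abk aI; rewrite -(mulr_natr pi) in b2 * => abk /andP[a0 a2].
    move: abk; rewrite ler_norml => /andP[h3 h4].
    have kl : -2 < k%:~R :> R by nra.
    have ku : k%:~R < 2 :> R by nra.
    have := kl; rewrite -[(-2 : R)]/((- 2%:Z)%:~R) ltr_int => {}kl.
    have := ku; rewrite -[(2 : R)]/((2%:Z)%:~R) ltr_int => {}ku.
    by move: kl ku; clear; lia.
  have : k = 0 \/ k = 1 \/ k = -1 by move: k1; clear; lia.
  by move=> [E|[E|E]]; rewrite E in bV; [left; left|left; right|right].
have mV k : measurable (V k) by rewrite /V; exact: measurable_itv.
have mU : measurable (V 0 `|` V 1) by exact: measurableU.
have mUU : measurable (V 0 `|` V 1 `|` V (-1)) by exact: measurableU.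
apply: (@le_trans _ _ (mu (V 0 `|` V 1 `|` V (-1)))).
  by apply: le_measure; rewrite ?inE//; exact: measurable_chord_ball.
have -> : (12 * t)%:E = ((4 * t)%:E + (4 * t)%:E + (4 * t)%:E)%E by rewrite -!EFinD; congr EFin; ring.
apply: (le_trans (measureU2 _ _ _)); [exact: mU|exact: mV|].
have h2 : (mu (V 0%R `|` V 1%R) <= (4 * t)%:E + (4 * t)%:E)%E.
  apply: (le_trans (measureU2 _ _ _)); [exact: mV|exact: mV|exact: leeD (muV _) (muV _)].
exact: (leeD h2 (muV _)).
Qed.

(* At a = b the division by 0 makes both [logp] and [log_kernel] equal to 0
   instead of +oo; the diagonal is a null set. *)
Definition logp r a b : R := Num.max 0 (ln (r / chord a b)).

Lemma logp_ge0 r a b : 0 <= logp r a b.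
Proof. by rewrite /logp le_max lexx. Qed.

Lemma measurable_logp r : measurable_fun setT (fun z : R * R => logp r z.1 z.2).
Proof.
apply: measurable_maxr => //; apply: measurableT_comp; first exact: measurable_ln.
apply: measurable_funM => //.
have -> : (fun z : R * R => (chord z.1 z.2)^-1) = (@powR R ^~ (-1)) \o (fun z : R * R => chord z.1 z.2).
  by apply/funext => z /=; rewrite powR_inv1// chord_ge0.
by apply: measurableT_comp; [exact: measurable_powR|exact: measurable_chord].
Qed.

Lemma measurable_logp1 r a : measurable_fun setT (logp r a).
Proof. exact: (measurableT_comp (measurable_logp r) (pair1_measurable a)). Qed.

Lemma ln_le_dyadic (u : R) (m : nat) : u < 2 ^+ m -> ln u <= m%:R.
Proof.
move=> um; case: (leP u 0) => [u0|u0]; first by rewrite ln0//.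
have l2 : ln 2 <= 1 :> R.
  by rewrite -[leRHS]expRK ler_ln ?posrE ?expR_gt0//; have := expR_ge1Dx (1 : R); lra.
rewrite (@le_trans _ _ (ln (2 ^+ m)))//; first by rewrite ler_ln ?posrE ?exprn_gt0// ltW.
by rewrite lnXn// -[ln 2 *+ m]mulr_natl ler_piMr.
Qed.

Lemma dyadic_bracket (u : R) : 1 <= u -> exists m : nat, 2 ^+ m <= u < 2 ^+ m.+1.
Proof.
move=> u1; have u0 : 0 <= u by exact: le_trans u1.
pose n := Num.truncn u.
have /andP[n1 n2] := truncn_itv u0.
have n0 : (0 < n)%N by rewrite truncn_gt0.
have /andP[m1 m2] := trunc_log_bounds (isT : (1 < 2)%N) n0.
exists (trunc_log 2 n); apply/andP; split.
  by rewrite (le_trans _ n1)// -natrX ler_nat.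
by rewrite (lt_le_trans n2)// -natrX ler_nat.
Qed.

Lemma logp_eq r a b : 0 < r -> 0 < chord a b <= r -> logp r a b = ln (r / chord a b).
Proof.
move=> r0 /andP[c0 cr]; rewrite /logp; apply/max_idPr.
by rewrite ln_ge0// ler_pdivlMr// mul1r.
Qed.

Lemma logp0 r a b : 0 < r -> r <= chord a b -> logp r a b = 0.
Proof.
move=> r0 cr; rewrite /logp; apply/max_idPl.
by rewrite ln_le0// ler_pdivrMr ?mul1r// (lt_le_trans r0).
Qed.

Lemma logp0' r a b : chord a b = 0 -> logp r a b = 0.
Proof. by move=> c0; rewrite /logp c0 invr0 mulr0 ln0// maxxx. Qed.

(* For chord a b in (r 2^-(m+1), r 2^-m], exactly m + 1 indicators contribute. *)
Lemma logp_le_series r a b : 0 < r -> b \in `[0, pi *+ 2] ->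
  ((logp r a b)%:E <= \sum_(i <oo) (\1_(chord_ball a (r / 2 ^+ i)) b)%:E)%E.
Proof.
move=> r0 bI; have s0 (i : nat) : (0 <= (\1_(chord_ball a (r / 2 ^+ i)) b : R)%:E)%E.
  by rewrite lee_fin.
case: (eqVneq (chord a b) 0) => [c0|c0].
  by rewrite logp0'// nneseries_ge0.
have {}c0 : 0 < chord a b by rewrite lt0r c0 chord_ge0.
case: (leP (chord a b) r) => [cr|/ltW rc]; last by rewrite logp0// nneseries_ge0.
rewrite logp_eq ?c0//.
have [|m /andP[m1 m2]] := @dyadic_bracket (r / chord a b).
  by rewrite ler_pdivlMr// mul1r.
apply: (@le_trans _ _ (m.+1%:R)%:E); first by rewrite lee_fin; exact: ln_le_dyadic.
apply: (@le_trans _ _ (\sum_(0 <= i < m.+1) (\1_(chord_ball a (r / 2 ^+ i)) b)%:E)%E); last first.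
  exact: nneseries_lim_ge.
rewrite sumEFin lee_fin big_mkord (eq_bigr (fun=> 1)) ?sumr_const ?card_ord//.
move=> i _; rewrite indicE mem_set//; split => //.
rewrite ler_pdivlMr ?exprn_gt0// mulrC -ler_pdivlMr//; apply: le_trans m1.
by rewrite ler_eXn2l ?ltr1n// -ltnS.
Qed.

(** The dyadic balls have measure at most 12 r / 2^i, a geometric series of sum 24 r. Linearity in
    r, without a logarithm, is what later balances the supremum of order 1/r of a kernel at scale
    r. *)
Lemma integral_logp r a : 0 < r ->
  (\int[mu]_(b in `[0%R, (pi *+ 2)%R]) (logp r a b)%:E <= (24 * r)%:E)%E.
Proof.
move=> r0; apply: (@le_trans _ _
  (\int[mu]_(b in `[0%R, (pi *+ 2)%R]) (\sum_(i <oo) (\1_(chord_ball a (r / 2 ^+ i)) b)%:E))%E).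
  apply: ge0_le_integral => //.
  - by move=> b _; rewrite lee_fin logp_ge0.
  - by apply/measurable_EFinP/measurable_funTS; exact: measurable_logp1.
  - apply: measurable_funTS; apply: ge0_emeasurable_sum => [i b _ _|i _]; first by rewrite lee_fin.
    by apply/measurable_EFinP/measurable_indic; exact: measurable_chord_ball.
  - by move=> b bI; exact: logp_le_series.
rewrite integral_nneseries//; last first.
  move=> i; apply/measurable_EFinP/measurable_funTS/measurable_indic.
  exact: measurable_chord_ball.
have H (i : nat) : (\int[mu]_(b in `[0%R, (pi *+ 2)%R]) (\1_(chord_ball a (r / 2 ^+ i)) b)%:E <=
    (12 * r / 2 ^+ i)%:E)%E.
  rewrite integral_indic//; last exact: measurable_chord_ball.
  rewrite setIidl; last by move=> b [].
  rewrite -mulrA; apply: chord_le_measure.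
  by rewrite divr_ge0 ?(ltW r0)// exprn_ge0.
have geomE n : \sum_(0 <= i < n) (12 * r / 2 ^+ i) = 24 * r * (1 - (2^-1) ^+ n).
  elim: n => [|n IH]; first by rewrite big_nil expr0 subrr mulr0.
  by rewrite big_nat_recr//= IH exprS -exprVn; field.
apply: (@le_trans _ _ (\sum_(i <oo) (12 * r / 2 ^+ i)%:E)%E).
  by apply: lee_nneseries => // i _ _; apply: integral_ge0 => b _; rewrite lee_fin.
apply: lime_le.
  apply: is_cvg_nneseries => i _ _.
  by rewrite lee_fin divr_ge0 ?mulr_ge0 ?(ltW r0)// exprn_ge0.
near=> n; rewrite sumEFin lee_fin.
rewrite geomE ler_piMr ?mulr_ge0 ?(ltW r0)// lerBlDr lerDl exprn_ge0//.
Unshelve. all: by end_near. Qed.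

End chord_measure.

Section log_potential.
Context {R : realType}.
Notation mu := (@lebesgue_measure R).
Implicit Types (a b c t r B : R) (psi : R -> R).
Local Notation I := (`[0%R, (pi *+ 2)%R]%classic : set R).

Let mI : measurable I. Proof. by []. Qed.

Lemma integrable_logp r a : 0 < r -> mu.-integrable I (EFin \o logp r a).
Proof.
move=> r0; apply/integrableP; split.
  by apply/measurable_EFinP/measurable_funTS; exact: measurable_logp1.
under eq_integral do rewrite /= ger0_norm ?logp_ge0//.
by apply: (le_lt_trans (integral_logp a r0)); rewrite ltry.
Qed.

Lemma Rintegral_logp r a : 0 < r -> 0 <= \int[mu]_(b in I) logp r a b <= 24 * r.
Proof.
move=> r0; apply/andP; split; first by apply: Rintegral_ge0 => b _; exact: logp_ge0.
rewrite -lee_fin /Rintegral fineK; first exact: integral_logp.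
exact: integrable_fin_num (integrable_logp a r0).
Qed.

Lemma integrable_logpM r a psi B : 0 < r -> measurable_fun setT psi ->
  (forall b, `|psi b| <= B) -> mu.-integrable I (EFin \o (fun b => logp r a b * psi b)).
Proof.
move=> r0 mpsi pB; have B0 : 0 <= B by exact: le_trans (pB 0).
apply: (@le_integrable _ _ _ mu I mI _ (EFin \o (fun b => B * logp r a b))).
- apply/measurable_EFinP/measurable_funTS/measurable_funM => //; exact: measurable_logp1.
- move=> b _; rewrite /= lee_fin !normrM (ger0_norm B0) mulrC.
  by rewrite ler_wpM2r.
- exact: integrable_realZ (integrable_logp a r0).
Qed.

Lemma chord0_null a : mu (chord_ball a 0) = 0%E.
Proof.
apply/eqP; rewrite eq_le measure_ge0 andbT.
by have := @chord_le_measure R a 0 (lexx _); rewrite mulr0.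
Qed.

(** The chord ball of radius 0 is a null set, so the values that the conventions assign on the
    diagonal do not influence integrals. *)
Lemma eq_Rintegral_off_diag a (f g : R -> R) :
  measurable_fun setT f -> measurable_fun setT g ->
  (forall b, b \in `[0, pi *+ 2] -> chord a b != 0 -> f b = g b) ->
  \int[mu]_(b in I) f b = \int[mu]_(b in I) g b.
Proof.
move=> mf mg fg; rewrite /Rintegral; congr fine; apply: ae_eq_integral => //.
- by apply/measurable_EFinP/measurable_funTS.
- by apply/measurable_EFinP/measurable_funTS.
- exists (chord_ball a 0); split; first exact: measurable_chord_ball.
    exact: chord0_null.
  move=> b /= /not_implyP[bI nfg]; split => //.
  rewrite leNgt; apply/negP => c0; apply: nfg; rewrite fg//.
  by rewrite gt_eqF.
Qed.

(** Chords are at most 2, so off the diagonal [logp 2] is the logarithmic kernel plus ln 2. The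
    shift makes the kernel nonnegative. *)
Definition potential psi a : R := \int[mu]_(b in I) (logp 2 a b * psi b).

Lemma measurable_potential_ge0 psi B : measurable_fun setT psi -> (forall b, `|psi b| <= B) ->
  (forall b, 0 <= psi b) -> measurable_fun setT (potential psi).
Proof.
move=> mpsi pB p0; apply: (@measurableT_comp _ _ _ _ _ _ (@fine R)) => //.
have -> : (fun a => \int[mu]_(b in I) (logp 2 a b * psi b)%:E)%E =
    (fun a => \int[mu]_b (fun z : R * R => (logp 2 z.1 z.2 * (psi z.2 * \1_I z.2))%:E) (a, b))%E.
  apply/funext => a; rewrite integral_mkcond; apply: eq_integral => b _.
  by rewrite patchE /= indicE; case: ifPn => _; rewrite ?mulr1// !mulr0.
pose F (z : R * R) := (logp 2 z.1 z.2 * (psi z.2 * \1_I z.2))%:E.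
have F0 z : (0 <= F z)%E by rewrite lee_fin !mulr_ge0// logp_ge0.
suff mF : measurable_fun setT F by have := @measurable_fun_fubini_tonelli_F _ _ _ _ _ mu F mF F0.
  apply/measurable_EFinP/measurable_funM; first exact: measurable_logp.
  apply: measurable_funM; first exact: measurableT_comp.
  by apply: measurableT_comp => //; exact: measurable_indic.
Qed.

Lemma potentialD psi1 psi2 B1 B2 a : measurable_fun setT psi1 -> (forall b, `|psi1 b| <= B1) ->
  measurable_fun setT psi2 -> (forall b, `|psi2 b| <= B2) ->
  potential (fun b => psi1 b - psi2 b) a = potential psi1 a - potential psi2 a.
Proof.
move=> m1 b1 m2 b2; rewrite /potential -RintegralB//.
- by apply: eq_Rintegral => b _; rewrite mulrBr.
- exact: integrable_logpM b1.
- exact: integrable_logpM b2.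
Qed.

(** Adding the constant B reduces to nonnegative densities, for which Tonelli's theorem gives
    measurability. *)
Lemma measurable_potential psi B : measurable_fun setT psi -> (forall b, `|psi b| <= B) ->
  measurable_fun setT (potential psi).
Proof.
move=> mpsi pB; have B0 : 0 <= B by exact: le_trans (pB 0).
have mB : measurable_fun setT (fun b => psi b + B) by exact: measurable_funD.
have bB b : `|psi b + B| <= B + B.
  by rewrite (le_trans (ler_normD _ _))// (ger0_norm B0) lerD2r.
have bc (b : R) : `|B| <= B by rewrite ger0_norm.
have -> : potential psi = (fun a => potential (fun b => psi b + B) a - potential (fun=> B) a).
  apply/funext => a; rewrite -(potentialD a mB bB (measurable_cst _) bc).
  by congr (potential _ a); apply/funext => b; rewrite addrK.
apply: measurable_funB.
  apply: measurable_potential_ge0 mB bB _ => b.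
  by rewrite -(opprK B) subr_ge0; have := pB b; rewrite ler_norml => /andP[].
exact: measurable_potential_ge0 (measurable_cst _) bc (fun=> B0).
Qed.

Lemma potential_bounded psi B a : measurable_fun setT psi -> (forall b, `|psi b| <= B) ->
  `|potential psi a| <= 48 * B.
Proof.
move=> mpsi pB; have B0 : 0 <= B by exact: le_trans (pB 0).
rewrite /potential; apply: (le_trans (le_normr_Rintegral _ _)) => //.
  exact: integrable_logpM pB.
apply: (@le_trans _ _ (\int[mu]_(b in I) (B * logp 2 a b))).
  apply: le_Rintegral => //.
  - exact: integrable_norm (integrable_logpM _ _ mpsi pB).
  - exact: integrable_realZ (integrable_logp a _).
  - by move=> b _; rewrite normrM (ger0_norm (logp_ge0 _ _ _)) mulrC ler_wpM2r ?logp_ge0.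
rewrite RintegralZl//; last exact: integrable_logp.
have /andP[_ h] := @Rintegral_logp 2 a (ltr0n _ 2).
by rewrite mulrC (le_trans (ler_wpM2r B0 h))// ler_wpM2r//; lra.
Qed.

End log_potential.

Section log_covariance.
Context {R : realType}.
Notation mu := (@lebesgue_measure R).
Implicit Types (a b c t r B M : R) (psi : R -> R).
Local Notation I := (`[0%R, (pi *+ 2)%R]%classic : set R).

Definition log_cov psi1 psi2 : R :=
  \int[mu]_(x in `[0%R, (pi *+ 2)%R]) \int[mu]_(y in `[0%R, (pi *+ 2)%R])
    (log_kernel x y * psi1 x * psi2 y).

Lemma integrable_bounded_period psi B : measurable_fun setT psi ->
  (forall b, `|psi b| <= B) -> mu.-integrable I (EFin \o psi).
Proof.
move=> mpsi pB; apply: measurable_bounded_integrable => //.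
- change (@lebesgue_measure R I < +oo)%E.
  by rewrite mu_itvcc ?ltry// ltW// twopi_gt0.
- exact: measurable_funTS.
- exists B; split; first by rewrite num_real.
  by move=> x Bx y _ /=; apply: (le_trans (pB y)); exact: ltW.
Qed.

Lemma log_cov_inner psi1 psi2 B a : measurable_fun setT psi2 -> (forall b, `|psi2 b| <= B) ->
  \int[mu]_(b in I) (log_kernel a b * psi1 a * psi2 b) =
  psi1 a * (potential psi2 a - ln 2 * \int[mu]_(b in I) psi2 b).
Proof.
move=> m2 b2; have i1 := @integrable_logpM R 2 a psi2 B (ltr0n _ 2) m2 b2.
have i2 := integrable_bounded_period m2 b2.
rewrite (@eq_Rintegral_off_diag _ a _ (fun b => psi1 a * (logp 2 a b * psi2 b - ln 2 * psi2 b))).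
- rewrite RintegralZl//; last by apply: integrable_realB => //; exact: integrable_realZ.
  congr (_ * _); rewrite RintegralB//; last exact: integrable_realZ.
  by rewrite RintegralZl.
- apply: measurable_funM => //; apply: measurable_funM => //.
  have -> : log_kernel a = (fun b => (@ln R \o (@powR R ^~ (-1))) (chord a b)).
    by apply/funext => b; rewrite log_kernelE /= powR_inv1// chord_ge0.
  apply: measurableT_comp; last exact: measurable_chord1.
  by apply: measurableT_comp; [exact: measurable_ln|exact: measurable_powR].
- apply: measurable_funM => //; apply: measurable_funB; apply: measurable_funM => //.
  exact: measurable_logp1.
- move=> b _ c0; have c1 : 0 < chord a b by rewrite lt0r c0 chord_ge0.
  rewrite log_kernelE logp_eq ?c1 ?chord_le2// lnM ?posrE ?invr_gt0//.
  ring.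
Qed.

Lemma log_covE psi1 psi2 B : measurable_fun setT psi2 -> (forall b, `|psi2 b| <= B) ->
  log_cov psi1 psi2 =
  \int[mu]_(a in I) (psi1 a * (potential psi2 a - ln 2 * \int[mu]_(b in I) psi2 b)).
Proof.
by move=> m2 b2; apply: eq_Rintegral => a _; exact: log_cov_inner b2.
Qed.

Let integrable_outer psi1 psi2 B1 B2 (k : R) :
  measurable_fun setT psi1 -> (forall b, `|psi1 b| <= B1) ->
  measurable_fun setT psi2 -> (forall b, `|psi2 b| <= B2) ->
  mu.-integrable I (EFin \o (fun a => psi1 a * (potential psi2 a - k))).
Proof.
move=> m1 b1 m2 b2; apply: (@integrable_bounded_period _ (B1 * (48 * B2 + `|k|))).
  apply: measurable_funM => //; apply: measurable_funB => //.
  exact: measurable_potential b2.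
move=> a; rewrite normrM ler_pM//; apply: (le_trans (ler_normB _ _)).
by rewrite lerD2r; exact: potential_bounded.
Qed.

(** For densities of mass one the covariance is the average, against psi1, of the potential of psi2
    minus ln 2. Covariance bounds thus become pointwise bounds of a potential on the support of
    psi1. *)
Lemma log_cov_le psi1 psi2 B1 B2 M :
  measurable_fun setT psi1 -> (forall b, `|psi1 b| <= B1) ->
  measurable_fun setT psi2 -> (forall b, `|psi2 b| <= B2) ->
  (forall a, 0 <= psi1 a) ->
  \int[mu]_(b in I) psi1 b = 1 -> \int[mu]_(b in I) psi2 b = 1 ->
  (forall a, psi1 a != 0 -> potential psi2 a <= M) ->
  log_cov psi1 psi2 <= M - ln 2.
Proof.
move=> m1 b1 m2 b2 p1 i1 i2 H; rewrite (log_covE _ m2 b2) i2 mulr1.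
apply: (@le_trans _ _ (\int[mu]_(a in I) ((M - ln 2) * psi1 a))); last first.
  by rewrite RintegralZl ?i1 ?mulr1//; exact: integrable_bounded_period b1.
apply: le_Rintegral => //.
- exact: (integrable_outer _ m1 b1 m2 b2).
- by apply: integrable_realZ => //; exact: integrable_bounded_period b1.
- move=> a _; rewrite mulrC; case: (eqVneq (psi1 a) 0) => [->|/H h]; first by rewrite !mulr0.
  by rewrite ler_wpM2r// lerD2r.
Qed.

Lemma log_cov_ge psi1 psi2 B1 B2 M :
  measurable_fun setT psi1 -> (forall b, `|psi1 b| <= B1) ->
  measurable_fun setT psi2 -> (forall b, `|psi2 b| <= B2) ->
  (forall a, 0 <= psi1 a) ->
  \int[mu]_(b in I) psi1 b = 1 -> \int[mu]_(b in I) psi2 b = 1 ->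
  (forall a, psi1 a != 0 -> M <= potential psi2 a) ->
  M - ln 2 <= log_cov psi1 psi2.
Proof.
move=> m1 b1 m2 b2 p1 i1 i2 H; rewrite (log_covE _ m2 b2) i2 mulr1.
apply: (@le_trans _ _ (\int[mu]_(a in I) ((M - ln 2) * psi1 a))).
  by rewrite RintegralZl ?i1 ?mulr1//; exact: integrable_bounded_period b1.
apply: le_Rintegral => //.
- by apply: integrable_realZ => //; exact: integrable_bounded_period b1.
- exact: (integrable_outer _ m1 b1 m2 b2).
- move=> a _; rewrite [leRHS]mulrC; case: (eqVneq (psi1 a) 0) => [->|/H h]; first by rewrite !mulr0.
  by rewrite ler_wpM2r// lerD2r.
Qed.

Lemma potential_le_far psi B t a : 0 < t <= 2 -> measurable_fun setT psi ->
  (forall b, `|psi b| <= B) -> (forall b, 0 <= psi b) -> \int[mu]_(b in I) psi b = 1 ->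
  (forall b, psi b != 0 -> t <= chord a b) -> potential psi a <= ln (2 / t).
Proof.
move=> /andP[t0 t2] mp pB p0 i1 H.
apply: (@le_trans _ _ (\int[mu]_(b in I) (ln (2 / t) * psi b))); last first.
  by rewrite RintegralZl ?i1 ?mulr1//; exact: integrable_bounded_period pB.
apply: le_Rintegral => //.
- exact: integrable_logpM pB.
- by apply: integrable_realZ => //; exact: integrable_bounded_period pB.
- move=> b _; case: (eqVneq (psi b) 0) => [->|/H tc]; first by rewrite !mulr0.
  have c0 : 0 < chord a b by exact: lt_le_trans tc.
  rewrite ler_wpM2r// logp_eq ?c0 ?chord_le2//.
  by rewrite ler_ln ?posrE ?divr_gt0// ler_pM2l// lef_pV2.
Qed.

(** The kernel is at most ln (2 / r) + [logp r]. The first part only sees the mass of psi; its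
    supremum B is spent on the second part, whose integral is at most 24 r. *)
Lemma potential_le_near psi B r a : 0 < r <= 2 -> measurable_fun setT psi ->
  (forall b, `|psi b| <= B) -> (forall b, 0 <= psi b) -> \int[mu]_(b in I) psi b = 1 ->
  potential psi a <= ln (2 / r) + 24 * r * B.
Proof.
move=> /andP[r0 r2] mp pB p0 i1; have B0 : 0 <= B by exact: le_trans (pB 0).
have ip := integrable_bounded_period mp pB.
have il := integrable_logp a r0.
apply: (@le_trans _ _ (\int[mu]_(b in I) (ln (2 / r) * psi b + B * logp r a b))); last first.
  rewrite RintegralD ?RintegralZl ?i1 ?mulr1//; try exact: integrable_realZ.
  rewrite lerD2l mulrC ler_wpM2r//.
  by have /andP[] := @Rintegral_logp R r a r0.
apply: le_Rintegral => //.
- exact: integrable_logpM pB.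
- by apply: integrable_realD => //; exact: integrable_realZ.
- move=> b _; apply: (@le_trans _ _ ((ln (2 / r) + logp r a b) * psi b)).
    rewrite ler_wpM2r//; case: (eqVneq (chord a b) 0) => [c0|c0].
      by rewrite !logp0'// addr0 ln_ge0// ler_pdivlMr// mul1r.
    have {}c0 : 0 < chord a b by rewrite lt0r c0 chord_ge0.
    rewrite (logp_eq (r := 2)) ?c0 ?chord_le2//.
    case: (leP (chord a b) r) => cr.
      rewrite logp_eq ?c0// -lnM ?posrE ?divr_gt0//.
      by rewrite mulrA divfK// gt_eqF.
    rewrite logp0 ?(ltW cr)// addr0 ler_ln ?posrE ?divr_gt0//.
    by rewrite ler_pM2l// lef_pV2 ?posrE// ltW.
  rewrite mulrDl lerD2l mulrC ler_wpM2r ?logp_ge0//.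
  by rewrite (le_trans (ler_norm _)).
Qed.

Lemma potential_ge psi B t a : 0 < t -> measurable_fun setT psi ->
  (forall b, `|psi b| <= B) -> (forall b, 0 <= psi b) -> \int[mu]_(b in I) psi b = 1 ->
  (forall b, psi b != 0 -> chord a b <= t) -> ln (2 / t) <= potential psi a.
Proof.
move=> t0 mp pB p0 i1 H; have B0 : 0 <= B by exact: le_trans (pB 0).
(* At b = a the convention makes [logp] vanish, and the pointwise lower bound may fail there. The
   maximum repairs it and changes the integrand only on the diagonal. *)
pose f b := Num.max (logp 2 a b) (ln (2 / t)) * psi b.
have mf : measurable_fun setT f.
  by apply: measurable_funM => //; apply: measurable_maxr => //; exact: measurable_logp1.
have -> : potential psi a = \int[mu]_(b in I) f b.
  apply: (@eq_Rintegral_off_diag _ a) => //.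
    by apply: measurable_funM => //; exact: measurable_logp1.
  move=> b _ c0; rewrite /f; case: (eqVneq (psi b) 0) => [->|/H tc]; first by rewrite !mulr0.
  have {}c0 : 0 < chord a b by rewrite lt0r c0 chord_ge0.
  rewrite (logp_eq (r := 2)) ?c0 ?chord_le2//; congr (_ * _); apply/esym/max_idPl.
  by rewrite ler_ln ?posrE ?divr_gt0// ler_pM2l// lef_pV2 ?posrE.
apply: (@le_trans _ _ (\int[mu]_(b in I) (ln (2 / t) * psi b))).
  by rewrite RintegralZl ?i1 ?mulr1//; exact: integrable_bounded_period pB.
apply: le_Rintegral => //.
- by apply: integrable_realZ => //; exact: integrable_bounded_period pB.
- apply: (@le_integrable _ _ _ mu I _ _ (EFin \o (fun b => B * (logp 2 a b + `|ln (2 / t)|)))) => //.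
  + by apply/measurable_EFinP/measurable_funTS.
  + move=> b _; rewrite /= lee_fin /f normrM [leRHS]ger0_norm; last first.
      by rewrite mulr_ge0 ?addr_ge0 ?logp_ge0.
    rewrite mulrC ler_pM// ger0_norm; last by rewrite le_max logp_ge0.
    rewrite ge_max lerDl normr_ge0/= (le_trans (ler_norm _))// lerDr logp_ge0//.
  + apply: integrable_realZ => //; apply: integrable_realD => //; first exact: integrable_logp.
    by apply: (@integrable_bounded_period _ `|ln (2 / t)|) => // b; rewrite normr_id.
- by move=> b _; rewrite /f ler_wpM2r// le_max lexx orbT.
Qed.

(* As psi has mean zero, the kernel may be shifted by a constant, that is,
   replaced by ln (2 t / chord), which is positive on the support. *)
Lemma log_cov_mean_zero psi B t x : 0 < t -> measurable_fun setT psi ->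
  (forall b, `|psi b| <= B) -> \int[mu]_(b in I) psi b = 0 ->
  (forall b, psi b != 0 -> chord x b <= t) -> `|log_cov psi psi| <= 576 * t ^+ 2 * B ^+ 2.
Proof.
move=> t0 mp pB i0 H; have B0 : 0 <= B by exact: le_trans (pB 0).
have t20 : 0 < 2 * t by rewrite mulr_gt0.
have U a : psi a != 0 -> `|potential psi a| <= B * (24 * (2 * t)).
  move=> pa.
  have -> : potential psi a = \int[mu]_(b in I) (ln t^-1 * psi b + logp (2 * t) a b * psi b).
    apply: (@eq_Rintegral_off_diag _ a).
    - by apply: measurable_funM => //; exact: measurable_logp1.
    - apply: measurable_funD; apply: measurable_funM => //; exact: measurable_logp1.
    move=> b _ c0; case: (eqVneq (psi b) 0) => [->|pb]; first by rewrite !mulr0 addr0.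
    have {}c0 : 0 < chord a b by rewrite lt0r c0 chord_ge0.
    have ct : chord a b <= 2 * t.
      rewrite (le_trans (chord_triangle x a b))// chordC.
      by have := H _ pa; have := H _ pb; lra.
    rewrite (logp_eq (r := 2)) ?c0 ?chord_le2// (logp_eq (r := 2 * t)) ?c0//.
    rewrite -mulrDl -lnM ?posrE ?divr_gt0 ?invr_gt0//; congr (ln _ * _).
    by field; rewrite !gt_eqF.
  have il := @integrable_logpM R (2 * t) a psi B t20 mp pB.
  have ip := integrable_bounded_period mp pB.
  rewrite RintegralD//; last exact: integrable_realZ.
  rewrite RintegralZl// i0 mulr0 add0r.
  apply: (le_trans (le_normr_Rintegral _ _)) => //.
  apply: (@le_trans _ _ (\int[mu]_(b in I) (B * logp (2 * t) a b))).
    apply: le_Rintegral => //.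
    - exact: integrable_norm il.
    - by apply: integrable_realZ => //; exact: integrable_logp.
    - by move=> b _; rewrite normrM (ger0_norm (logp_ge0 _ _ _)) mulrC ler_wpM2r ?logp_ge0.
  rewrite RintegralZl//; last exact: integrable_logp.
  by rewrite ler_wpM2l//; have /andP[] := @Rintegral_logp R (2 * t) a t20.
rewrite (log_covE _ mp pB) i0 mulr0.
have io := integrable_outer 0 mp pB mp pB.
apply: (le_trans (le_normr_Rintegral _ _)) => //.
(* The support of psi lies in S, of measure at most 12 t, and on it the potential is at most 48 t B
   by [U]: hence 576 = 48 * 12. *)
pose S := chord_ball x t.
have mS : measurable S by exact: measurable_chord_ball.
have b1 b : `|(\1_S b : R)| <= 1 by rewrite indicE; case: (_ \in _); rewrite ?normr1 ?normr0.
have iS : mu.-integrable I (EFin \o (\1_S : R -> R)).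
  by apply: (integrable_bounded_period _ b1); exact: measurable_indic.
apply: (@le_trans _ _ (\int[mu]_(a in I) ((B * (B * (24 * (2 * t)))) * \1_S a))).
  apply: le_Rintegral => //.
  - exact: integrable_norm io.
  - exact: integrable_realZ.
  - move=> a aI; case: (eqVneq (psi a) 0) => [->|pa].
      by rewrite mul0r normr0 !mulr_ge0// ltW.
    rewrite subr0 normrM indicE mem_set; last by split => //; exact: H.
    by rewrite mulr1 ler_pM// U.
rewrite RintegralZl// /Rintegral integral_indic// setIidl; last by move=> b [].
rewrite [leRHS](_ : _ = B * (B * (24 * (2 * t))) * (12 * t)); last by ring.
rewrite ler_wpM2l ?mulr_ge0// ?(ltW t0)//.
rewrite -lee_fin fineK; first by apply: chord_le_measure; exact: ltW.
rewrite ge0_fin_numE// (le_lt_trans (chord_le_measure _ _)) ?ltry//; exact: ltW.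
Qed.

Lemma Rintegral_period_bounded psi B : measurable_fun setT psi -> (forall b, `|psi b| <= B) ->
  `|\int[mu]_(b in I) psi b| <= 2 * pi * B.
Proof.
move=> mp pB; have ip := integrable_bounded_period mp pB.
apply: (le_trans (le_normr_Rintegral _ ip)) => //.
apply: (@le_trans _ _ (\int[mu]_(b in I) cst B b)).
  apply: le_Rintegral => //.
  - exact: integrable_norm ip.
  - apply: (@integrable_bounded_period _ `|B|); first exact: measurable_cst.
    by move=> b; rewrite /cst.
rewrite Rintegral_cst// (_ : fine _ = pi *+ 2); first by rewrite -(mulr_natr pi); lra.
rewrite (_ : _ I = @lebesgue_measure R I)// mu_itvcc ?subr0//.
by rewrite ltW// twopi_gt0.
Qed.

Lemma log_cov_bounded : exists2 C : R, 0 < C & forall psi1 psi2 B1 B2,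
  measurable_fun setT psi1 -> (forall b, `|psi1 b| <= B1) ->
  measurable_fun setT psi2 -> (forall b, `|psi2 b| <= B2) ->
  `|log_cov psi1 psi2| <= C * B1 * B2.
Proof.
have p0 := @pi_gt0 R.
exists (2 * pi * (48 + `|ln 2| * (2 * pi))).
  by rewrite mulr_gt0 ?mulr_gt0// ltr_pwDl// !mulr_ge0// ltW.
move=> psi1 psi2 B1 B2 m1 b1 m2 b2.
rewrite (log_covE _ m2 b2).
have := @Rintegral_period_bounded (fun a => psi1 a * (potential psi2 a - ln 2 * \int[mu]_(b in I) psi2 b))
  (B1 * (48 * B2 + `|ln 2| * (2 * pi * B2))).
move=> /(_ _ _)/le_trans; apply; last first.
- by rewrite [leLHS](_ : _ = 2 * pi * (48 + `|ln 2| * (2 * pi)) * B1 * B2)//; ring.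
- move=> a; rewrite normrM ler_pM//; apply: (le_trans (ler_normB _ _)).
  apply: lerD; first exact: potential_bounded.
  by rewrite normrM ler_wpM2l//; exact: Rintegral_period_bounded.
- apply: measurable_funM => //; apply: measurable_funB => //.
  exact: measurable_potential b2.
Qed.

End log_covariance.

Section kernel_covariance.
Context {R : realType}.
Variable phi : R -> R.
Hypothesis hphi : mollifier phi.
Notation mu := (@lebesgue_measure R).
Local Notation ker := (mollifier_kernel phi).

Lemma kernel_ge0 e x y : 0 < e <= 1 -> 0 <= ker e x y.
Proof. exact: periodize_ge0. Qed.

Lemma continuous_kernel e x : 0 < e <= 1 -> continuous (ker e x).
Proof.
move=> e01 y; apply: (@continuous_comp _ _ _ (fun y => x - y) (periodize phi e)).
  by apply: cvgB; [exact: cvg_cst|exact: cvg_id].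
exact: continuous_periodize.
Qed.

Lemma measurable_mollifier_kernel e x : 0 < e <= 1 -> measurable_fun setT (ker e x).
Proof. by move=> e01; apply: continuous_measurable_fun; exact: continuous_kernel. Qed.

Lemma kernel_bounded : exists2 B : R, 0 < B &
  forall e x y, 0 < e <= 1 -> `|ker e x y| <= B / e.
Proof.
have [B B0 HB] := periodize_bounded hphi; exists B => // e x y e01.
by rewrite ger0_norm ?kernel_ge0//; exact: HB.
Qed.

Lemma Rintegral_kernel e x : 0 < e <= 1 ->
  \int[mu]_(y in `[0, pi *+ 2]) ker e x y = 1.
Proof. exact: Rintegral_periodize. Qed.

Lemma kernel_supp e x y : 0 < e <= 1 -> ker e x y != 0 -> chord x y <= e.
Proof.
move=> e01 /(periodize_supp hphi e01)[k hk].
exact: le_trans (chord_le x y k) hk.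
Qed.

Lemma kernel_periodic e x y : 0 < e <= 1 -> ker e (x + pi *+ 2) y = ker e x y.
Proof.
move=> e01; rewrite !mollifier_kernelE addrAC.
exact: (periodize_periodic hphi e01).
Qed.

Lemma kernel_lipschitz : exists2 B : R, 0 < B & forall e x x' y, 0 < e <= 1 ->
  `|x - x'| < 2^-1 -> `|ker e x y - ker e x' y| <= B / e ^+ 2 * `|x - x'|.
Proof.
have [B B0 HB] := periodize_lipschitz hphi; exists B => // e x x' y e01 xx.
have E : (x - y) - (x' - y) = x - x' by ring.
by have := HB e (x - y) (x' - y) e01; rewrite E; apply.
Qed.

Local Ltac kernel_side HB :=
  solve [by apply: measurable_mollifier_kernel | by move=> ?; apply: HB
        | by move=> ?; apply: kernel_ge0 | by apply: Rintegral_kernel].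

(** Cutting the logarithm at r = d, the supremum B / d of the kernel cancels against the integral 24
    d. The bound is uniform in the other scale e, however small. *)
Lemma log_cov_kernel_near : exists2 C : R, 0 < C & forall e d x y,
  0 < e <= 1 -> 0 < d <= 1 -> log_cov (ker e x) (ker d y) <= - ln d + C.
Proof.
have [B B0 HB] := kernel_bounded; exists (24 * B); first by rewrite mulr_gt0.
move=> e d x y e01 d01; have d0 : 0 < d by case/andP: d01.
have -> : - ln d + 24 * B = (ln (2 / d) + 24 * d * (B / d)) - ln 2.
  by rewrite lnM ?posrE ?invr_gt0// lnV ?posrE//; field; rewrite gt_eqF.
apply: (@log_cov_le _ _ _ (B / e) (B / d)); try kernel_side HB.
move=> a _; apply: potential_le_near; try kernel_side HB.
by rewrite d0/=; case/andP: d01 => _ d1; lra.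
Qed.

Lemma log_cov_kernel_far e d x y t : 0 < e <= 1 -> 0 < d <= 1 -> 0 < t ->
  t + e + d <= chord x y -> log_cov (ker e x) (ker d y) <= - ln t.
Proof.
move=> e01 d01 t0 tc; have [B B0 HB] := kernel_bounded.
have t2 : t <= 2.
  by have := chord_le2 x y; case/andP: e01 => e0 _; case/andP: d01 => d0 _; lra.
have -> : - ln t = ln (2 / t) - ln 2.
  by rewrite lnM ?posrE ?invr_gt0// lnV ?posrE//; ring.
apply: (@log_cov_le _ _ _ (B / e) (B / d)); try kernel_side HB.
move=> a /(kernel_supp e01) xa; apply: (@potential_le_far _ _ (B / d)); try kernel_side HB.
  by rewrite t0.
move=> b /(kernel_supp d01) yb.
have := chord_triangle a x y; have := chord_triangle b a y.
by rewrite (chordC b y); lra.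
Qed.

Lemma log_cov_kernel_ge e d x y t : 0 < e <= 1 -> 0 < d <= 1 -> 0 < t ->
  chord x y + e + d <= t -> - ln t <= log_cov (ker e x) (ker d y).
Proof.
move=> e01 d01 t0 tc; have [B B0 HB] := kernel_bounded.
have -> : - ln t = ln (2 / t) - ln 2.
  by rewrite lnM ?posrE ?invr_gt0// lnV ?posrE//; ring.
apply: (@log_cov_ge _ _ _ (B / e) (B / d)); try kernel_side HB.
move=> a /(kernel_supp e01) xa; apply: (@potential_ge _ _ (B / d)); try kernel_side HB; first exact: t0.
move=> b /(kernel_supp d01) yb.
have := chord_triangle x a b; have := chord_triangle y x b.
by rewrite (chordC a x); lra.
Qed.

(** The difference of two kernels has mean zero, lives in a chord ball of radius 2 d and is of size
    h / d^2, so [log_cov_mean_zero] gives d^2 (h / d^2)^2. This is the source of the gradient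
    estimate for exp(i beta X_d). *)
Lemma log_cov_kernel_increment : exists2 C : R, 0 < C & forall d x h,
  0 < d <= 1 -> 0 <= h -> h <= d -> h < 2^-1 ->
  log_cov (fun y => ker d (x + h) y - ker d x y) (fun y => ker d (x + h) y - ker d x y)
    <= C * (h / d) ^+ 2.
Proof.
have [B B0 HB] := kernel_lipschitz; have [B' B'0 HB'] := kernel_bounded.
exists (576 * 4 * B ^+ 2); first by apply: mulr_gt0; [lra|exact: exprn_gt0].
move=> d x h d01 h0 hd h2; have d0 : 0 < d by case/andP: d01.
have xh : `|x + h - x| = h by rewrite addrAC subrr add0r ger0_norm.
apply: (le_trans (ler_norm _)).
have d20 : 0 < 2 * d by rewrite mulr_gt0.
have mk : measurable_fun setT (fun y => ker d (x + h) y - ker d x y).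
  by apply: measurable_funB; exact: measurable_mollifier_kernel.
have bk b : `|ker d (x + h) b - ker d x b| <= B / d ^+ 2 * h.
  by rewrite -{2}xh; apply: HB => //; rewrite xh.
have ik : \int[mu]_(y in `[0, pi *+ 2]) (ker d (x + h) y - ker d x y) = 0.
  rewrite RintegralB//; last 2 first.
  - by apply: (@integrable_bounded_period _ _ (B' / d)); [exact: measurable_mollifier_kernel|move=> b; exact: HB'].
  - by apply: (@integrable_bounded_period _ _ (B' / d)); [exact: measurable_mollifier_kernel|move=> b; exact: HB'].
  by rewrite !Rintegral_kernel// subrr.
apply: (le_trans (log_cov_mean_zero (x := x) d20 mk bk ik _)).
  move=> b hb; have : (ker d (x + h) b != 0) || (ker d x b != 0).
    by rewrite -negb_and; apply: contra hb => /andP[/eqP -> /eqP ->]; rewrite subrr.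
  case/orP => /(kernel_supp d01) hc; last by lra.
  have := chord_le x (x + h) 0; rewrite mulr0 addr0 -normrN opprB xh.
  by have := chord_triangle (x + h) x b; lra.
by rewrite le_eqVlt; apply/orP; left; apply/eqP; field; rewrite gt_eqF.
Qed.

End kernel_covariance.

(** * The field and its chaos *)

Section periodic_test_functions.
Context {R : realType}.
Implicit Types (f g psi : R -> R) (a b c x y : R).

Lemma derive1n_lin f g a b k : smooth f -> smooth g ->
  derive1n k (fun x => a * f x + b * g x) =
  (fun x => a * derive1n k f x + b * derive1n k g x).
Proof.
move=> sf sg; elim: k => [|k IH]; first by rewrite !derive1n0.
rewrite derive1nS IH; apply/funext => x; rewrite derive1E.
have df := is_derive_derive1n k x sf; have dg := is_derive_derive1n k x sg.
have D : is_derive x (1 : R) (fun x0 => a * derive1n k f x0 + b * derive1n k g x0)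
    (a * derive1n k.+1 f x + b * derive1n k.+1 g x).
  by apply: is_derive_eq; rewrite /GRing.scale/=; ring.
by rewrite (@derive_val _ _ _ _ _ _ _ D).
Qed.

Lemma smooth_lin f g a b : smooth f -> smooth g -> smooth (fun x => a * f x + b * g x).
Proof.
move=> sf sg k x; rewrite derive1n_lin//.
have df := is_derive_derive1n k x sf; have dg := is_derive_derive1n k x sg.
exact: ex_derive.
Qed.

Lemma derive1n_reflect f c k : smooth f ->
  derive1n k (fun y => f (c - y)) = (fun y => (-1) ^+ k * derive1n k f (c - y)).
Proof.
move=> sf; elim: k => [|k IH]; first by apply/funext => y; rewrite !derive1n0 expr0 mul1r.
rewrite derive1nS IH; apply/funext => y; rewrite derive1E.
have d1 := is_derive_derive1n k (c - y) sf.
have d2 : is_derive y (1 : R) (fun z => c - z) (-1) by apply: is_derive_eq; ring.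
have D : is_derive y (1 : R) (fun z => (-1) ^+ k * derive1n k f (c - z))
    ((-1) ^+ k.+1 * derive1n k.+1 f (c - y)).
  by apply: is_derive_eq; rewrite /GRing.scale/= exprS; ring.
by rewrite (@derive_val _ _ _ _ _ _ _ D).
Qed.

Lemma smooth_reflect f c : smooth f -> smooth (fun y => f (c - y)).
Proof.
move=> sf k y; rewrite derive1n_reflect//.
have d1 := is_derive_derive1n k (c - y) sf.
have d2 : is_derive y (1 : R) (fun z => c - z) (-1) by apply: is_derive_eq; ring.
exact: ex_derive.
Qed.

Lemma derive1n_zero k : derive1n k (fun=> 0 : R) = (fun=> 0 : R).
Proof.
elim: k => [|k IH]; first by rewrite derive1n0.
by rewrite derive1nS IH; apply/funext => x; rewrite derive1E derive_cst.
Qed.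

Lemma smooth_zero : smooth (fun=> 0 : R).
Proof. by move=> k x; rewrite derive1n_zero; exact: derivable_cst. Qed.

Lemma smooth_trig (m a b : R) : smooth (fun x => a * cos (m * x) + b * sin (m * x)).
Proof.
have step a' b' (x : R) : is_derive x (1 : R)
    (fun x => a' * cos (m * x) + b' * sin (m * x))
    ((b' * m) * cos (m * x) + (- a' * m) * sin (m * x)).
  by apply: is_derive_eq; rewrite /GRing.scale/=; ring.
have H k : exists a' b', derive1n k (fun x => a * cos (m * x) + b * sin (m * x)) =
    (fun x => a' * cos (m * x) + b' * sin (m * x)).
  elim: k => [|k [a' [b' IH]]]; first by exists a, b; rewrite derive1n0.
  exists (b' * m), (- a' * m); rewrite derive1nS IH; apply/funext => x; rewrite derive1E.
  by have d := step a' b' x; rewrite (@derive_val _ _ _ _ _ _ _ d).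
by move=> k x; have [a' [b' ->]] := H k; have d := step a' b' x; exact: ex_derive.
Qed.

Definition rtest psi := smooth psi /\ periodic psi (pi *+ 2).

Lemma rtest_function psi : rtest psi -> test_function (fun x => (psi x)%:C).
Proof.
move=> [sp pp]; split; first by split => //=; exact: smooth_zero.
by move=> x; rewrite pp.
Qed.

Lemma rtest_lin f g a b : rtest f -> rtest g -> rtest (fun x => a * f x + b * g x).
Proof.
move=> [sf pf] [sg pg]; split; first exact: smooth_lin.
by move=> x; rewrite pf pg.
Qed.

Lemma rtestB f g : rtest f -> rtest g -> rtest (fun x => f x - g x).
Proof.
move=> tf tg; have := rtest_lin 1 (-1) tf tg.
by congr rtest; apply/funext => x; rewrite mul1r mulN1r.
Qed.

Lemma rtest0 : rtest (fun=> 0).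
Proof. by split; first exact: smooth_zero. Qed.

Lemma character_test (n : int) : test_function (fun x : R => cexp (0 -i* (n%:~R * x))).
Proof.
split; [split|].
- have -> : (fun x : R => complex.Re (cexp (0 -i* (n%:~R * x)))) =
      (fun x => 1 * cos ((- n%:~R) * x) + 0 * sin ((- n%:~R) * x)).
    by apply/funext => x /=; rewrite expR0 !mul1r mul0r addr0 mulNr.
  exact: smooth_trig.
- have -> : (fun x : R => complex.Im (cexp (0 -i* (n%:~R * x)))) =
      (fun x => 0 * cos ((- n%:~R) * x) + 1 * sin ((- n%:~R) * x)).
    by apply/funext => x /=; rewrite expR0 !mul1r mul0r add0r mulNr.
  exact: smooth_trig.
- move=> x; rewrite -!(mulrN (n%:~R)).
  have E y : cexp (0 +i* (n%:~R * - y)) = eix (- (n%:~R * y)) :> R[i] by rewrite cexp_eix mulrN.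
  by rewrite !E mulrDr opprD eixD eixN (eixN (n%:~R * (pi *+ 2))) mulrC (mulrC n%:~R (pi *+ 2)) eix_2piz conjc1 mul1r.
Qed.

End periodic_test_functions.

Section log_correlated.
Context {R : realType} {d : measure_display} {Omega : measurableType d}.
Variables (P : probability Omega R) (X : Omega -> (R -> R[i]) -> R[i]).
Hypothesis hX : log_correlated_field P X.
Variable phi : R -> R.
Hypothesis hphi : mollifier phi.
Local Notation ker := (mollifier_kernel phi).
Implicit Types (f g h psi : R -> R) (a b x y : R) (w : Omega).

Definition field psi w : R := complex.Re (X w (fun x => (psi x)%:C)).

Let distX w : circle_distribution (X w). Proof. by case: hX => -[]. Qed.

Let linX w (a : R[i]) (psi1 psi2 : R -> R[i]) : test_function psi1 -> test_function psi2 ->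
  X w (fun x => a * psi1 x + psi2 x) = a * X w psi1 + X w psi2.
Proof. by case: (distX w) => + _; exact. Qed.

Lemma field_lin f g a b w : rtest f -> rtest g ->
  field (fun x => a * f x + b * g x) w = a * field f w + b * field g w.
Proof.
move=> tf tg; have t0 := @rtest0 R.
have Z : X w (fun=> 0%:C) = 0.
  have := @linX w 1 _ _ (rtest_function t0) (rtest_function t0).
  have -> : (fun x : R => 1 * 0%:C + 0%:C) = (fun=> 0%:C) :> (R -> R[i]).
    by apply/funext => x; rewrite mul1r addr0.
  by rewrite mul1r => /eqP; rewrite -subr_eq subrr => /eqP <-.
have tbg : rtest (fun x => b * g x).
  have := rtest_lin b 0 tg t0; congr rtest; apply/funext => x; by rewrite mul0r addr0.
have E1 : X w (fun x => (b * g x)%:C) = b%:C * X w (fun x => (g x)%:C).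
  have := @linX w b%:C _ _ (rtest_function tg) (rtest_function t0).
  rewrite Z addr0 => <-; congr (X w _); apply/funext => x.
  by rewrite addr0 rmorphM.
have := @linX w a%:C _ _ (rtest_function tf) (rtest_function tbg).
rewrite /field E1 => E.
have -> : (fun x => (a * f x + b * g x)%:C) = (fun x => a%:C * (f x)%:C + (b * g x)%:C).
  by apply/funext => x; rewrite rmorphD rmorphM.
rewrite E.
by case: (X w _) => r1 i1; case: (X w _) => r2 i2 /=; rewrite !mul0r !subr0.
Qed.

Lemma fieldB f g w : rtest f -> rtest g ->
  field (fun x => f x - g x) w = field f w - field g w.
Proof.
move=> tf tg; rewrite -[RHS]mul1r mulrBr -mulNr -(field_lin 1 (-1))// ?mul1r//.
by congr (field _ w); apply/funext => x; rewrite mul1r mulN1r.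
Qed.

Lemma measurable_field psi : rtest psi -> measurable_fun setT (field psi).
Proof. by move=> /rtest_function tp; case: hX => -[_ /(_ _ tp)[]]. Qed.

Lemma expectation_field2 f g : rtest f -> rtest g ->
  ('E_P[fun w => (field f w * field g w)%R] = (log_cov f g)%:E)%E.
Proof. by move=> /rtest_function tf /rtest_function tg; case: hX => _ _ _ /(_ f g tf tg). Qed.

Lemma integrable_field_sqr f : rtest f -> P.-integrable setT (EFin \o (fun w => field f w ^+ 2)).
Proof.
move=> tf; have := expectation_field2 tf tf; rewrite unlock => E.
apply/integrableP; split.
  apply/measurable_EFinP; apply: (@measurableT_comp _ _ _ _ _ _ (fun x : R => x ^+ 2)) => //.
  exact: measurable_field.
under eq_integral do rewrite /= ger0_norm ?sqr_ge0// expr2.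
by rewrite E ltry.
Qed.

Lemma integrable_field2 f g : rtest f -> rtest g ->
  P.-integrable setT (EFin \o (fun w => field f w * field g w)).
Proof.
move=> tf tg.
apply: (@le_integrable _ _ _ P setT measurableT _
  (EFin \o (fun w => field f w ^+ 2 + field g w ^+ 2))).
- by apply/measurable_EFinP/measurable_funM; exact: measurable_field.
- move=> w _; rewrite /= lee_fin [leRHS]ger0_norm ?addr_ge0 ?sqr_ge0// ler_norml.
  by apply/andP; split; nra.
- by apply: integrable_realD => //; exact: integrable_field_sqr.
Qed.

Lemma Rintegral_field2 f g : rtest f -> rtest g ->
  \int[P]_w (field f w * field g w) = log_cov f g.
Proof.
by move=> tf tg; have := expectation_field2 tf tg; rewrite unlock /Rintegral => ->.
Qed.

(** Symmetry is read off the expectation of a product of field values; the bilinearity rules below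
    are obtained in the same way from the linearity of X. *)
Lemma log_covC f g : rtest f -> rtest g -> log_cov f g = log_cov g f.
Proof.
move=> tf tg; rewrite -!Rintegral_field2//.
by apply: eq_Rintegral => w _; rewrite mulrC.
Qed.

Lemma log_covBl f g h : rtest f -> rtest g -> rtest h ->
  log_cov (fun x => f x - g x) h = log_cov f h - log_cov g h.
Proof.
move=> tf tg th; have tfg := rtestB tf tg.
rewrite -!Rintegral_field2// -RintegralB//; try exact: integrable_field2.
by apply: eq_Rintegral => w _; rewrite fieldB// mulrBl.
Qed.

Lemma log_covBr f g h : rtest f -> rtest g -> rtest h ->
  log_cov h (fun x => f x - g x) = log_cov h f - log_cov h g.
Proof.
move=> tf tg th; have tfg := rtestB tf tg.
by rewrite (log_covC th tfg) (log_covBl tf tg th) (log_covC tf th) (log_covC tg th).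
Qed.

Lemma log_cov_sqrB f g : rtest f -> rtest g ->
  log_cov (fun x => f x - g x) (fun x => f x - g x) =
  log_cov f f + log_cov g g - 2 * log_cov f g.
Proof.
move=> tf tg; have tfg := rtestB tf tg.
rewrite (log_covBl tf tg tfg) (log_covBr tf tg tf) (log_covBr tf tg tg) (log_covC tg tf).
by move: (log_cov f f) (log_cov g g) (log_cov f g) => u v z; ring.
Qed.

Lemma Rintegral_cos_field psi t : rtest psi ->
  \int[P]_w cos (t * field psi w) = expR (- (t ^+ 2 * log_cov psi psi / 2)).
Proof.
move=> tp; apply: centered_gaussian_cos.
  by case: hX => _ _ /(_ psi (rtest_function tp)).
have := expectation_field2 tp tp.
by under eq_fun do rewrite -expr2.
Qed.

Lemma rtest_kernel e x : 0 < e <= 1 -> rtest (ker e x).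
Proof.
move=> e01; split.
  have -> : ker e x = fun y => periodize phi e (x - y) by apply/funext => y; rewrite mollifier_kernelE.
  by apply: smooth_reflect => k y; exact: periodize_smooth.
move=> y; rewrite !mollifier_kernelE.
have E : x - (y + pi *+ 2) + pi *+ 2 = x - y by ring.
by rewrite -(periodize_periodic hphi e01 (x - (y + pi *+ 2))) E.
Qed.

(** For a fixed sample, X w is a distribution of finite order, and translating the kernel is
    Lipschitz for every C^k seminorm. The constant is random and uncontrolled, which is enough for
    Riemann sums along each sample. *)
Lemma field_kernel_lipschitz e w : 0 < e <= 1 -> exists2 B : R, 0 < B &
  forall x y, `|field (ker e x) w - field (ker e y) w| <= B * `|x - y|.
Proof.
move=> e01; have [_ [N [c Hc]]] := distX w.
have /choice[B HB] : forall k : nat, exists B : R, 0 < B /\ forall s t,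
    `|derive1n k (periodize phi e) s - derive1n k (periodize phi e) t| <= B * `|s - t|.
  by move=> k; have [B B0 HB] := derive1n_periodize_lipschitz hphi k e01; exists B.
(* The sign of c is not known, hence the absolute value; the summand 1 makes the constant
   positive. *)
exists (`|c| * \sum_(k < N.+1) B k + 1).
  rewrite ltr_wpDl// mulr_ge0// sumr_ge0// => k _.
  by have [/ltW] := HB k.
move=> x y; have tx := rtest_kernel x e01; have ty := rtest_kernel y e01.
rewrite -fieldB//.
set psi := fun z => ker e x z - ker e y z.
have tp : rtest psi by exact: rtestB.
apply: (le_trans (normr_Re _)); apply: (le_trans (Hc _ (rtest_function tp))).
have D k z : derive1n k psi z =
    (-1) ^+ k * (derive1n k (periodize phi e) (x - z) - derive1n k (periodize phi e) (y - z)).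
  have sp : smooth (periodize phi e) by move=> j t; exact: periodize_smooth.
  have -> : psi = fun z => 1 * periodize phi e (x - z) + (-1) * periodize phi e (y - z).
    by apply/funext => t; rewrite mul1r mulN1r /psi !mollifier_kernelE.
  rewrite derive1n_lin; [|exact: smooth_reflect..].
  by rewrite !derive1n_reflect//; ring.
have Cb (k : nat) z : Normc.normc (cderive1n k (fun z => (psi z)%:C) z) <= B k * `|x - y|.
  rewrite /cderive1n /= derive1n_zero expr0n/= addr0 sqrtr_sqr D normrM normrX normrN1 expr1n mul1r.
  have [_ H] := HB k; apply: (le_trans (H _ _)).
  by have -> : x - z - (y - z) = x - y by ring.
(* A supremum dominates the elements of its set only when the set is bounded, which is what [Cb]
   supplies. *)
have Cn (k : nat) : 0 <= sup [set Normc.normc (cderive1n k (fun z => (psi z)%:C) z) | z in setT].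
  apply: (@le_trans _ _ (Normc.normc (cderive1n k (fun z => (psi z)%:C) 0))); first exact: normc_ge0.
  by apply: ub_le_sup; [exists (B k * `|x - y|) => _ [z _ <-]; exact: Cb|exists 0].
have C0 : 0 <= Cseminorm N (fun z => (psi z)%:C) by apply: sumr_ge0 => k _; exact: Cn.
apply: (@le_trans _ _ (`|c| * Cseminorm N (fun z => (psi z)%:C))).
  by rewrite ler_wpM2r// ler_norm.
rewrite mulrDl mul1r; apply: (@le_trans _ _ (`|c| * (\sum_(k < N.+1) B k) * `|x - y|)); last by rewrite lerDl.
rewrite -mulrA ler_wpM2l// mulr_suml; apply: ler_sum => k _.
by apply: ge_sup; [exists (Normc.normc (cderive1n k (fun z => (psi z)%:C) 0)); exists 0|move=> _ [z _ <-]; exact: Cb].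
Qed.

End log_correlated.

(** * Riemann sums of Lipschitz functions and coefficients of the chaos *)

Section lipschitz_riemann_sums.
Context {R : realType}.
Notation mu := (@lebesgue_measure R).
Implicit Types (f g : R -> R) (x y a b : R).

Definition lipschitz_by B f := forall x y, `|f x - f y| <= B * `|x - y|.

Definition bounded_lipschitz f :=
  exists B, (forall x, `|f x| <= B) /\ lipschitz_by B f.

Lemma lipschitz_by_ge0 B f : lipschitz_by B f -> 0 <= B.
Proof. by move=> /(_ 0 1); rewrite sub0r normrN1 mulr1; exact: le_trans. Qed.

Lemma lipschitz_by_continuous B f : lipschitz_by B f -> continuous f.
Proof.
move=> Hf x; apply/cvgrPdist_le => e e0.
have B0 := lipschitz_by_ge0 Hf.
have B1 : 0 < B + 1 by rewrite ltr_wpDl.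
near=> y; apply: (le_trans (Hf _ _)).
apply: (@le_trans _ _ ((B + 1) * `|x - y|)); first by rewrite ler_wpM2r// lerDl.
rewrite -ler_pdivlMl// mulrC.
near: y; have /cvgrPdist_le := @cvg_id R (nbhs x); apply.
exact: divr_gt0.
Unshelve. all: by end_near. Qed.

Lemma bounded_lipschitz_cst a : bounded_lipschitz (fun=> a).
Proof. by exists `|a|; split => [//|x y]; rewrite subrr normr0 mulr_ge0. Qed.

Lemma bounded_lipschitzM f g : bounded_lipschitz f -> bounded_lipschitz g ->
  bounded_lipschitz (fun x => f x * g x).
Proof.
move=> [B [fB fL]] [C [gB gL]].
have B0 : 0 <= B := le_trans (normr_ge0 _) (fB 0).
have C0 : 0 <= C := le_trans (normr_ge0 _) (gB 0).
exists (2 * (B * C)); split => [x|x y].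
  rewrite normrM; apply: (@le_trans _ _ (B * C)); first exact: ler_pM.
  by rewrite ler_peMl ?mulr_ge0// ler1n.
have -> : f x * g x - f y * g y = (f x - f y) * g x + f y * (g x - g y) by ring.
apply: (le_trans (ler_normD _ _)); rewrite !normrM.
rewrite (_ : 2 * (B * C) * _ = B * `|x - y| * C + B * (C * `|x - y|)); last by ring.
by apply: lerD; apply: ler_pM.
Qed.

Lemma bounded_lipschitz_trig B f : lipschitz_by B f ->
  bounded_lipschitz (fun x => cos (f x)) /\ bounded_lipschitz (fun x => sin (f x)).
Proof.
move=> fL; have L (p : R[i] -> R) (q : R -> R) : (forall z, `|p z| <= Normc.normc z) ->
    (forall u v, p (eix u - eix v) = q u - q v) -> (forall u, `|q u| <= 1) ->
    bounded_lipschitz (fun x => q (f x)).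
  move=> pn pq q1; exists (Num.max 1 B); split => [x|x y]; first by rewrite le_max q1.
  rewrite -pq; apply: (le_trans (pn _)); apply: (le_trans (normc_eixB _ _)).
  by apply: (le_trans (fL x y)); rewrite ler_wpM2r// le_max lexx orbT.
split; [apply: (L (@complex.Re R))|apply: (L (@complex.Im R))] => // u.
- exact: normr_Re.
- exact: cos_max.
- exact: normr_Im.
- exact: sin_max.
Qed.

Lemma bounded_lipschitz_expR f : bounded_lipschitz f -> bounded_lipschitz (fun x => expR (f x)).
Proof.
move=> [B [fB fL]]; have B0 : 0 <= B := le_trans (normr_ge0 _) (fB 0).
have fe x : expR (f x) <= expR B by rewrite ler_expR (le_trans (ler_norm _)).
exists (expR B * Num.max 1 B); split => [x|x y].
  by rewrite gtr0_norm ?expR_gt0// (le_trans (fe x))// ler_peMr ?expR_ge0// le_max lexx.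
suff H u v : f u <= f v -> `|expR (f u) - expR (f v)| <= expR B * Num.max 1 B * `|u - v|.
  have [h|/ltW h] := leP (f x) (f y); first exact: H.
  by rewrite distrC (distrC x); exact: H.
move=> uv; rewrite distrC ger0_norm ?subr_ge0 ?ler_expR//.
have -> : expR (f v) - expR (f u) = expR (f v) * (1 - expR (f u - f v)).
  by rewrite mulrBr mulr1 -expRD [f v + _]addrC subrK.
rewrite -mulrA; apply: ler_pM; rewrite ?expR_ge0//.
  by rewrite subr_ge0 -[leRHS]expR0 ler_expR subr_le0.
apply: (@le_trans _ _ `|f u - f v|).
  by rewrite ler0_norm ?subr_le0// lerBlDr; have := expR_ge1Dx (f u - f v); lra.
apply: (le_trans (fL u v)).
by rewrite ler_wpM2r// le_max lexx orbT.
Qed.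

(** On each cell the mean value theorem for a primitive gives h f(z) with z in the cell, at distance
    at most h = 2 pi / J from the node. *)
Lemma riemann_sum_error B f (J : nat) : (0 < J)%N -> lipschitz_by B f ->
  `|(pi *+ 2)^-1 * \int[mu]_(x in `[0%R, (pi *+ 2)%R]) f x
    - J%:R^-1 * \sum_(0 <= j < J) f (grid J j)| <= B * (pi *+ 2) / J%:R.
Proof.
move=> J0 fL; have cf := lipschitz_by_continuous fL.
have p0 := @twopi_gt0 R; have JR : 0 < J%:R :> R by rewrite ltr0n.
have [F dF] := continuous_antiderivative (-1) cf.
have m10 x : 0 <= x -> -1 < x by move=> x0; rewrite (lt_le_trans _ x0)// ltrN10.
have -> : \int[mu]_(x in `[0%R, (pi *+ 2)%R]) f x = F (pi *+ 2) - F 0.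
  by apply: Rintegral_antiderivative => // x /andP[x0 _]; apply: dF; exact: m10.
pose h : R := pi *+ 2 / J%:R; have h0 : 0 < h by rewrite divr_gt0.
have gE j : grid J j = j%:R * h by rewrite /grid /h; ring.
have -> : F (pi *+ 2) - F 0 = \sum_(0 <= j < J) (F (grid J j.+1) - F (grid J j)).
  by rewrite telescope_sumr// /grid mulfK ?gt_eqF// mulr0 mul0r.
rewrite [X in `|X|](_ : _ = (pi *+ 2)^-1 *
    \sum_(0 <= j < J) ((F (grid J j.+1) - F (grid J j)) - h * f (grid J j))); last first.
  rewrite [in RHS]sumrB -[in RHS]mulr_sumr [in RHS]mulrBr [in RHS]mulrA; congr (_ - _ * _).
  by rewrite /h mulrA mulVf ?mul1r// gt_eqF.
rewrite normrM gtr0_norm ?invr_gt0// ler_pdivrMl//.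
apply: (le_trans (ler_norm_sum _ _ _)).
apply: (@le_trans _ _ (\sum_(0 <= j < J) (B * h ^+ 2))); last first.
  rewrite sumr_const_nat subn0 -mulr_natr /h.
  by rewrite le_eqVlt; apply/orP; left; apply/eqP; field; rewrite gt_eqF.
apply: ler_sum => j _.
have lt : grid J j < grid J j.+1 :> R by rewrite !gE ltr_pM2r// ltr_nat.
have g0 : 0 <= grid J j :> R by rewrite gE mulr_ge0// ltW.
have [||z zi ->] := @MVT R F f _ _ lt.
- by move=> x; rewrite in_itv/= => /andP[jx _]; apply: dF; apply: m10; rewrite (le_trans g0)// ltW.
- apply: continuous_in_subspaceT => x; rewrite inE/= in_itv/= => /andP[jx _].
  by apply: (@is_derive_continuous _ _ (f x)); apply: dF; apply: m10; exact: le_trans jx.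
have E : grid J j.+1 - grid J j = h :> R by rewrite !gE -natr1; ring.
rewrite E mulrC -mulrBr normrM (gtr0_norm h0) expr2 mulrCA ler_pM2l//.
move: zi; rewrite in_itv/= => /andP[z1 z2].
apply: (le_trans (fL _ _)); apply: ler_wpM2l (lipschitz_by_ge0 fL) _ _ _.
rewrite gtr0_norm ?subr_gt0// -E lerD2r.
exact: ltW.
Qed.

End lipschitz_riemann_sums.

Section chaos_coefficients.
Context {R : realType} {d : measure_display} {Omega : measurableType d}.
Variables (P : probability Omega R) (X : Omega -> (R -> R[i]) -> R[i]).
Hypothesis hX : log_correlated_field P X.
Variable phi : R -> R.
Hypothesis hphi : mollifier phi.
Variable beta : R.
Local Notation ker := (mollifier_kernel phi).
Local Notation fld e x w := (field X (ker e x) w).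
Implicit Types (e x : R) (w : Omega).

Lemma chaos_approxE e w x : 0 < e <= 1 -> chaos_approx P beta phi X e w x =
  (expR (beta ^+ 2 / 2 * log_cov (ker e x) (ker e x)))%:C * eix (beta * fld e x w).
Proof.
move=> e01; have tk := rtest_kernel hphi x e01.
have E := expectation_field2 hX tk tk.
rewrite /chaos_approx /mollify; under eq_fun do rewrite expr2.
by rewrite E /= /cexp /eix /=; apply/eqP; rewrite eq_complex/= !mul0r subr0 addr0 !eqxx.
Qed.

(** By rotation invariance this variance is constant in x; Lipschitz continuity is all that the
    Riemann sums ask for, and it follows at once from bilinearity. *)
Lemma lipschitz_log_cov e : 0 < e <= 1 ->
  bounded_lipschitz (fun x => log_cov (ker e x) (ker e x)).
Proof.
move=> e01; have [C C0 HC] := @log_cov_bounded R.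
have [B B0 HB] := kernel_bounded hphi.
have [L L0 HL] := derive1n_periodize_lipschitz hphi 0 e01.
have e0 : 0 < e by case/andP: e01.
have kL x y z : `|ker e x z - ker e y z| <= L * `|x - y|.
  have := HL (x - z) (y - z); rewrite !derive1n0 !mollifier_kernelE.
  by have -> : x - z - (y - z) = x - y by ring.
exists (Num.max (C * (B / e) * (B / e)) (2 * (C * (B / e) * L))); split => [x|x y].
  rewrite le_max; apply/orP; left; apply: HC.
  + exact: (measurable_mollifier_kernel hphi).
  + by move=> y; exact: HB.
  + exact: (measurable_mollifier_kernel hphi).
  + by move=> y; exact: HB.
have tx := rtest_kernel hphi x e01; have ty := rtest_kernel hphi y e01.
have -> : log_cov (ker e x) (ker e x) - log_cov (ker e y) (ker e y) =
    log_cov (fun z => ker e x z - ker e y z) (ker e x) +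
    log_cov (ker e y) (fun z => ker e x z - ker e y z).
  by rewrite (log_covBl hX tx ty tx) (log_covBr hX tx ty ty) addrA subrK.
apply: (@le_trans _ _ (2 * (C * (B / e) * L) * `|x - y|)); last first.
  by rewrite ler_wpM2r// le_max lexx orbT.
apply: (le_trans (ler_normD _ _)).
have -> : 2 * (C * (B / e) * L) * `|x - y| =
    C * (L * `|x - y|) * (B / e) + C * (B / e) * (L * `|x - y|) by ring.
have HB1 x' z : `|ker e x' z| <= B / e by exact: HB.
by apply: lerD; apply: HC => //; try (by exact: (measurable_mollifier_kernel hphi));
  apply: measurable_funB; exact: (measurable_mollifier_kernel hphi).
Qed.

Lemma lipschitz_chaos e w (n : int) : 0 < e <= 1 ->
  bounded_lipschitz (fun x => complex.Re
    (chaos_approx P beta phi X e w x * eix (- (n%:~R * x)))) /\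
  bounded_lipschitz (fun x => complex.Im
    (chaos_approx P beta phi X e w x * eix (- (n%:~R * x)))).
Proof.
move=> e01; have [B B0 HB] := field_kernel_lipschitz hX hphi w e01.
have l1 : lipschitz_by (`|beta| * B + `|n%:~R|) (fun x => beta * fld e x w - n%:~R * x).
  move=> x y.
  have -> : beta * fld e x w - n%:~R * x - (beta * fld e y w - n%:~R * y) =
    beta * (fld e x w - fld e y w) - n%:~R * (x - y) by ring.
  apply: (le_trans (ler_normB _ _)); rewrite !normrM mulrDl lerD2r -mulrA.
  by rewrite ler_wpM2l.
have l2 : bounded_lipschitz (fun x => expR (beta ^+ 2 / 2 * log_cov (ker e x) (ker e x))).
  apply: bounded_lipschitz_expR; apply: bounded_lipschitzM; first exact: bounded_lipschitz_cst.
  exact: lipschitz_log_cov.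
have E x : chaos_approx P beta phi X e w x * eix (- (n%:~R * x)) =
    (expR (beta ^+ 2 / 2 * log_cov (ker e x) (ker e x)))%:C * eix (beta * fld e x w - n%:~R * x).
  by rewrite chaos_approxE// -mulrA -eixD.
have [lc ls] := bounded_lipschitz_trig l1.
by split; under eq_fun do rewrite E /= mul0r ?subr0 ?addr0; exact: bounded_lipschitzM.
Qed.

Definition chaos_coef e w n :=
  fourier_coef (function_distribution (chaos_approx P beta phi X e w)) n.

Definition chaos_grid e J w j := chaos_approx P beta phi X e w (grid J j).

(** The constant depends on e, w and n. This does no harm, since J grows after e and the range of
    frequencies have been fixed. *)
Lemma dft_chaos_error e w n : 0 < e <= 1 -> exists2 C, 0 <= C & forall J, (0 < J)%N ->
  Normc.normc (dft J (chaos_grid e J w) n - chaos_coef e w n) <= C / J%:R.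
Proof.
move=> e01; have [[B1 [_ L1]] [B2 [_ L2]]] := lipschitz_chaos w n e01.
have B10 := lipschitz_by_ge0 L1; have B20 := lipschitz_by_ge0 L2.
have p0 := @twopi_gt0 R.
exists ((B1 + B2) * (pi *+ 2)); first by apply: mulr_ge0; [exact: addr_ge0|exact: ltW].
move=> J J0.
have E1 := riemann_sum_error J0 L1; have E2 := riemann_sum_error J0 L2.
rewrite normcB; apply: (le_trans (normc_le_ReIm _)); rewrite !mulrDl.
have Rec (a : R) (z : R[i]) : complex.Re (a%:C * z) = a * complex.Re z by case: z => r i /=; rewrite mul0r subr0.
have Imc (a : R) (z : R[i]) : complex.Im (a%:C * z) = a * complex.Im z by case: z => r i /=; rewrite mul0r addr0.
have -> : chaos_coef e w n = ((pi *+ 2)^-1)%:C * cintegral `[0, pi *+ 2]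
    (fun x => chaos_approx P beta phi X e w x * eix (- (n%:~R * x))).
  rewrite /chaos_coef /fourier_coef /function_distribution; congr (_ * cintegral _ _).
  by apply/funext => x; rewrite cexp_eix.
have ReB (z z' : R[i]) : complex.Re (z - z') = complex.Re z - complex.Re z' by exact: raddfB.
have ImB (z z' : R[i]) : complex.Im (z - z') = complex.Im z - complex.Im z' by exact: raddfB.
rewrite /dft ReB ImB !Rec !Imc !raddf_sum.
exact: lerD.
Qed.

Lemma measurable_chaos_grid e J j : 0 < e <= 1 ->
  measurable_fun setT (fun w => complex.Re (chaos_grid e J w j)) /\
  measurable_fun setT (fun w => complex.Im (chaos_grid e J w j)).
Proof.
move=> e01.
have mf : measurable_fun setT (fun w => beta * fld e (grid J j) w).
  by apply: measurable_funM => //; exact: measurable_field hX _ (rtest_kernel _ _ _).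
have mt (h : R -> R) : continuous h -> measurable_fun setT (fun w => h (beta * fld e (grid J j) w)).
  by move=> ch; apply: (measurableT_comp _ mf); exact: continuous_measurable_fun.
split; under eq_fun do rewrite /chaos_grid chaos_approxE//= mul0r ?subr0 ?addr0;
  apply: measurable_funM => //; apply: mt; [exact: continuous_cos|exact: continuous_sin].
Qed.

End chaos_coefficients.

(** * Second moment of the pairing *)

Section finite_sums.
Context d (T : measurableType d) {R : realType} (mu : {measure set T -> \bar R}).

Lemma integrable_real_sum (I : Type) (r : seq I) (f : I -> T -> R) :
  (forall i, mu.-integrable setT (EFin \o f i)) ->
  mu.-integrable setT (EFin \o (fun x => \sum_(i <- r) f i x)).
Proof.
move=> fi; elim: r => [|i r IH].
  have -> : EFin \o (fun x : T => \sum_(i <- [::]) f i x) = cst 0%E.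
    by apply/funext => x /=; rewrite big_nil.
  exact: integrable0.
have -> : (fun x => \sum_(i <- i :: r) f i x) = (fun x => f i x + \sum_(i <- r) f i x).
  by apply/funext => x; rewrite big_cons.
exact: integrable_realD.
Qed.

Lemma Rintegral_sum (I : Type) (r : seq I) (f : I -> T -> R) :
  (forall i, mu.-integrable setT (EFin \o f i)) ->
  \int[mu]_x (\sum_(i <- r) f i x) = \sum_(i <- r) \int[mu]_x f i x.
Proof.
move=> fi; elim: r => [|i r IH].
  rewrite big_nil (_ : (fun x => _) = cst 0).
    by rewrite Rintegral_cst// mul0r.
  by apply/funext => x; rewrite big_nil.
rewrite big_cons -IH -RintegralD//; last exact: integrable_real_sum.
by apply: eq_Rintegral => x _; rewrite big_cons.
Qed.

End finite_sums.

Section random_exponential_sums.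
Context {R : realType} {d : measure_display} {Omega : measurableType d}.
Variables (P : probability Omega R) (X : Omega -> (R -> R[i]) -> R[i]).
Hypothesis hX : log_correlated_field P X.
Implicit Types (w : Omega).

Lemma integrable_cos_field (t : R) psi : rtest psi ->
  P.-integrable setT (EFin \o (fun w => cos (t * field X psi w))).
Proof.
move=> tp; apply: (@bounded_integrableP _ _ _ P _ 1).
  have mf : measurable_fun setT (fun w => t * field X psi w).
    by apply: measurable_funM => //; exact: measurable_field hX _ tp.
  by apply: (measurableT_comp _ mf); apply: continuous_measurable_fun; exact: continuous_cos.
by move=> w; exact: cos_max.
Qed.

Lemma Rintegral_prob_cst (c : R) : \int[P]_w c = c.
Proof.
rewrite Rintegral_cst//; set x := (X in fine X).
have -> : x = 1%E by exact: probability_setT.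
by rewrite mulr1.
Qed.

Lemma integrable_prob_cst (c : R) : P.-integrable setT (EFin \o (fun=> c)).
Proof. by apply: (@bounded_integrableP _ _ _ P _ `|c|). Qed.

Variables (J : nat) (psi : nat -> R -> R) (p : nat -> R) (t : R).
Hypothesis tpsi : forall j, rtest (psi j).
Local Notation Y j w := (field X (psi j) w).

Definition exp_sum w : R[i] :=
  (J%:R^-1)%:C * \sum_(0 <= j < J) (p j)%:C * eix (t * Y j w).

(** The expectation of the j-th summand of [exp_sum], by the Gaussian characteristic function. *)
Definition exp_mean j := p j * expR (- (t ^+ 2 * log_cov (psi j) (psi j) / 2)).

Local Notation a := exp_mean.

Definition exp_sum_mean : R := J%:R^-1 * \sum_(0 <= j < J) a j.

(** The real part of the product of the j-th centered summand with the conjugate of the l-th one.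
    Only cosines of single field values remain. *)
Let term j l w := p j * p l * cos (t * field X (fun x => psi j x - psi l x) w)
  - a j * p l * cos (t * Y l w) - a l * p j * cos (t * Y j w) + a j * a l.

Let sqn_exp_sum w : sqn (exp_sum w - exp_sum_mean%:C) =
  J%:R^-1 ^+ 2 * \sum_(0 <= j < J) \sum_(0 <= l < J) term j l w.
Proof.
have -> : exp_sum w - exp_sum_mean%:C =
    (J%:R^-1)%:C * \sum_(0 <= j < J) ((p j * cos (t * Y j w) - a j) +i* (p j * sin (t * Y j w))).
  rewrite /exp_sum /exp_sum_mean rmorphM/= -mulrBr rmorph_sum/= -sumrB; congr (_ * _).
  apply: eq_bigr => j _; rewrite /eix.
  by apply/eqP; rewrite eq_complex/= !mul0r subr0 addr0 subr0 !eqxx.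
rewrite sqnM sqn_real; congr (_ * _).
have S (F1 F2 : nat -> R) : \sum_(0 <= j < J) (F1 j +i* F2 j) =
    (\sum_(0 <= j < J) F1 j) +i* (\sum_(0 <= j < J) F2 j).
  elim: J => [|n IH]; first by rewrite !big_nil.
  by rewrite !big_nat_recr//= IH.
rewrite S sqnE/= !expr2 !big_distrlr/= -big_split/=; apply: eq_bigr => j _.
rewrite -big_split/=; apply: eq_bigr => l _.
rewrite /term (fieldB hX _ (tpsi j) (tpsi l)) [t * (_ - _)]mulrBr cosB.
move: (cos _) (cos _) (sin _) (sin _) (a j) (a l) (p j) (p l) => c1 c2 s1 s2 a1 a2 p1 p2.
ring.
Qed.

(** The difference Y_j - Y_l is itself a field value, so its law is a one-dimensional Gaussian. Its
    variance contains minus twice the covariance, which produces the factor exp(t^2 cov) once a_j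
    a_l is taken out. *)
Let term_ok j l : P.-integrable setT (EFin \o term j l) /\
  \int[P]_w term j l w = a j * a l * (expR (t ^+ 2 * log_cov (psi j) (psi l)) - 1).
Proof.
have tB := rtestB (tpsi j) (tpsi l).
have i1 := integrable_realZ measurableT (p j * p l) (integrable_cos_field t tB).
have i2 := integrable_realZ measurableT (a j * p l) (integrable_cos_field t (tpsi l)).
have i3 := integrable_realZ measurableT (a l * p j) (integrable_cos_field t (tpsi j)).
have i12 := integrable_realB measurableT i1 i2.
have i123 := integrable_realB measurableT i12 i3.
have i4 := integrable_prob_cst (a j * a l).
split; first exact: (integrable_realD measurableT i123 i4).
rewrite /term RintegralD// RintegralB// RintegralB// Rintegral_prob_cst !RintegralZl//;
  try exact: integrable_cos_field.
rewrite !(Rintegral_cos_field hX)//.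
rewrite (log_cov_sqrB hX (tpsi j) (tpsi l)) /a.
move: (log_cov (psi j) (psi j)) (log_cov (psi l) (psi l)) (log_cov (psi j) (psi l)) => u v z.
have -> : - (t ^+ 2 * (u + v - 2 * z) / 2) =
  - (t ^+ 2 * u / 2) + - (t ^+ 2 * v / 2) + t ^+ 2 * z by field.
by rewrite !expRD; ring.
Qed.

Lemma integrable_sqn_exp_sum :
  P.-integrable setT (EFin \o (fun w => sqn (exp_sum w - exp_sum_mean%:C))).
Proof.
rewrite (_ : (fun w => _) = (fun w => J%:R^-1 ^+ 2 * \sum_(0 <= j < J) \sum_(0 <= l < J) term j l w)).
  apply: integrable_realZ => //; apply: integrable_real_sum => j.
  by apply: integrable_real_sum => l; case: (term_ok j l).
by apply/funext => w; rewrite sqn_exp_sum.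
Qed.

Lemma Rintegral_sqn_exp_sum :
  \int[P]_w sqn (exp_sum w - exp_sum_mean%:C) =
  J%:R^-1 ^+ 2 * \sum_(0 <= j < J) \sum_(0 <= l < J)
    (a j * a l * (expR (t ^+ 2 * log_cov (psi j) (psi l)) - 1)).
Proof.
have i1 j l : P.-integrable setT (EFin \o term j l) by case: (term_ok j l).
have i2 j : P.-integrable setT (EFin \o (fun w => \sum_(0 <= l < J) term j l w)).
  by apply: integrable_real_sum => l.
rewrite (_ : (fun w => _) = (fun w => J%:R^-1 ^+ 2 * \sum_(0 <= j < J) \sum_(0 <= l < J) term j l w)); last first.
  by apply/funext => w; rewrite sqn_exp_sum.
rewrite RintegralZl//; last exact: integrable_real_sum.
congr (_ * _); rewrite Rintegral_sum//; apply: eq_bigr => j _.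
by rewrite Rintegral_sum//; apply: eq_bigr => l _; case: (term_ok j l).
Qed.

End random_exponential_sums.

(** * Sums of negative powers of chords over the grid *)

Section grid_sums.
Context {R : realType}.
Implicit Types (f : nat -> R) (b : R).

(** Induction in place of comparison with the integral of x^-b. With a = 1 - b and v = a / (n + 1)
    <= 1, one has (n / (n + 1))^a <= exp(-v) <= 1 - v / 2; the factor 2 in the statement compensates
    for this halving. *)
Lemma sum_powRN b n : 0 < b < 1 ->
  \sum_(1 <= k < n.+1) k%:R `^ (- b) <= 2 / (1 - b) * n%:R `^ (1 - b) :> R.
Proof.
move=> /andP[b0 b1]; have a0 : 0 < 1 - b by rewrite subr_gt0.
elim: n => [|n IH]; first by rewrite big_geq// mulr_ge0 ?powR_ge0// divr_ge0// ltW.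
rewrite big_nat_recr//=; apply: (le_trans (lerD IH (lexx _))).
set a := 1 - b; set y := n.+1%:R `^ (- b).
have yE : n.+1%:R `^ a = n.+1%:R * y.
  by rewrite /a powRD ?powRr1 ?ltW//; apply/implyP => _; rewrite gt_eqF.
have H : n%:R `^ a <= n.+1%:R `^ a * (1 - a / 2 * n.+1%:R^-1).
  have t0 : 0 < (n.+1%:R)^-1 :> R by rewrite invr_gt0.
  have t1 : (n.+1%:R)^-1 <= 1 :> R by rewrite invf_le1// ler1n.
  have [->|nn0] := posnP n.
    rewrite powR0 ?gt_eqF// mulr_ge0 ?powR_ge0// invr1 mulr1 subr_ge0 ler_pdivrMr//.
    by rewrite mul1r /a; lra.
  have nR : 0 < n%:R :> R by rewrite ltr0n.
  rewrite /powR !gt_eqF//.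
  have -> : ln n%:R = ln n.+1%:R + ln (1 - n.+1%:R^-1) :> R.
    rewrite -lnM ?posrE//; last by rewrite subr_gt0 invf_lt1// ltr1n.
    by congr ln; rewrite mulrBr mulr1 divff ?gt_eqF// -natr1 addrK.
  rewrite mulrDr expRD ler_wpM2l ?expR_ge0//.
  have l1 : ln (1 - n.+1%:R^-1) <= - n.+1%:R^-1 :> R.
    by apply: le_ln1Dx; rewrite ltrN2 invf_lt1// ltr1n.
  apply: (@le_trans _ _ (expR (- (a * n.+1%:R^-1)))).
    by rewrite ler_expR -mulrN ler_wpM2l// ltW.
  set t := n.+1%:R^-1 in t0 t1 *.
  have at0 : 0 < a * t by rewrite mulr_gt0.
  have at1 : a * t <= 1 by rewrite -[leRHS]mulr1 ler_pM// ?ltW//; rewrite /a; lra.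
  have P0 : 0 < 1 - a / 2 * t by nra.
  have P1 : 0 < (1 - a / 2 * t)^-1 by rewrite invr_gt0.
  rewrite expRN -[leRHS]invrK lef_pV2 ?posrE ?expR_gt0//.
  apply: (@le_trans _ _ (1 + a * t)); last exact: expR_ge1Dx.
  rewrite -[leLHS]div1r ler_pdivrMr//.
  by nra.
have : 2 / a * n%:R `^ a <= 2 / a * (n.+1%:R `^ a * (1 - a / 2 * n.+1%:R^-1)).
  by apply: ler_wpM2l H; apply: divr_ge0 => //; exact: ltW.
have -> : 2 / a * (n.+1%:R `^ a * (1 - a / 2 * n.+1%:R^-1)) = 2 / a * n.+1%:R `^ a - y.
  by rewrite yE; field; rewrite !gt_eqF.
by lra.
Qed.

Lemma ler_sum_subset (I : eqType) (r r' : seq I) (f : I -> R) :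
  (forall i, 0 <= f i) -> uniq r -> uniq r' -> {subset r <= r'} ->
  \sum_(i <- r) f i <= \sum_(i <- r') f i.
Proof.
move=> f0 ur ur' rr'; rewrite [leRHS](bigID (mem r))/=.
have -> : \sum_(i <- r) f i = \sum_(i <- r' | i \in r) f i.
  rewrite -[RHS]big_filter; apply: perm_big; apply: uniq_perm => //.
    by rewrite filter_uniq.
  move=> i; rewrite mem_filter; case: (boolP (i \in r)) => //= ir.
  by rewrite rr'.
by rewrite lerDl sumr_ge0.
Qed.

Lemma ler_sum_injective f (g : nat -> nat) (r : seq nat) (J : nat) :
  (forall k, 0 <= f k) -> uniq r -> {in r &, injective g} ->
  {in r, forall l, (0 < g l < J)%N} ->
  \sum_(l <- r) f (g l) <= \sum_(1 <= k < J) f k.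
Proof.
move=> f0 ur gi gJ; rewrite -(big_map g xpredT f).
apply: ler_sum_subset => //; rewrite ?iota_uniq ?map_inj_in_uniq//.
by move=> _ /mapP[l lr ->]; rewrite mem_index_iota; exact: gJ.
Qed.

(** A chord is at least half of the shorter arc, and the shorter arc consists of k or J - k steps of
    length 2 pi / J. *)
Lemma chord_grid (J j l : nat) : (j < J)%N -> (l < J)%N -> l != j ->
  let k := `|l - j|%N in
  k%:R / J%:R <= chord (grid J j) (grid J l) :> R \/
  (J - k)%:R / J%:R <= chord (grid J j) (grid J l) :> R.
Proof.
move=> jJ lJ lj; have p0 := @pi_gt0 R.
have J0 : 0 < J%:R :> R by rewrite ltr0n (leq_ltn_trans _ jJ).
have p1 : 1 <= pi :> R by apply: le_trans (pi_ge2 R); rewrite ler1n.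
wlog jl : j l jJ lJ lj / (j < l)%N.
  move=> H; have [jl|/ltnW lj'|E] := ltngtP j l; first exact: H.
    rewrite distnC chordC; apply: H => //; first by rewrite eq_sym.
    by rewrite ltn_neqAle lj' andbT.
  by rewrite E eqxx in lj.
rewrite chordC (distnEl (ltnW jl)); set k := (l - j)%N.
have gE : grid J l - grid J j = pi *+ 2 * (k%:R / J%:R) :> R.
  by rewrite /grid /k natrB ?(ltnW jl)//; ring.
have kJ : (k < J)%N by rewrite (leq_ltn_trans (leq_subr _ _)).
have [h|h] := leqP (k * 2) J; [left|right].
  have := @chord_ge R (grid J l) (grid J j) 0; rewrite mulr0 addr0 gE.
  have q0 : 0 <= k%:R / J%:R :> R by rewrite divr_ge0.
  have q1 : k%:R / J%:R <= 2^-1 :> R.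
    by rewrite ler_pdivrMr// ler_pdivlMl// mulrC -natrM ler_nat.
  rewrite ger0_norm; last by rewrite mulr_ge0// mulrn_wge0// ltW.
  rewrite -(mulr_natr pi) => H.
  by have {}H := H ltac:(nra); nra.
have := @chord_ge R (grid J l) (grid J j) (-1); rewrite gE mulrN1z mulrN1.
have -> : pi *+ 2 * (k%:R / J%:R) - pi *+ 2 = - (pi *+ 2 * ((J - k)%:R / J%:R)) :> R.
  by rewrite (@natrB R J k) ?(ltnW kJ)// mulrBl divff ?gt_eqF// mulrBr mulr1 opprB.
set q := (J - k)%:R / J%:R.
have q0 : 0 <= q by rewrite divr_ge0.
have q1 : q <= 2^-1 :> R.
  rewrite ler_pdivrMr// ler_pdivlMl// mulrC -natrM ler_nat mulnBl leq_subLR.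
  by rewrite -[(J * 2)%N]/(J * 2)%N muln2 -addnn leq_add2r ltnW.
rewrite normrN ger0_norm; last by rewrite mulr_ge0// mulrn_wge0// ltW.
rewrite -(mulr_natr pi) => H.
by have {}H := H ltac:(nra); nra.
Qed.

Lemma chord_grid_gt0 (J j l : nat) : (j < J)%N -> (l < J)%N -> l != j ->
  0 < chord (grid J j) (grid J l) :> R.
Proof.
move=> jJ lJ lj; have J0 : 0 < J%:R :> R by rewrite ltr0n (leq_ltn_trans _ jJ).
have k0 : (0 < `|l - j|)%N by rewrite lt0n distn_eq0.
have kJ : (`|l - j| < J)%N by move: jJ lJ; clear; lia.
have [|] := chord_grid jJ lJ lj; apply: lt_le_trans; rewrite divr_gt0// ltr0n ?subn_gt0//.
Qed.

(** The two alternatives of [chord_grid] are added up. On each side of j, both |l - j| and J - |l -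
    j| are injective in l with values in 1, ..., J - 1, so four copies of [sum_powRN] occur: 8 = 4 *
    2. *)
Lemma sum_chord_grid b (J j : nat) : 0 < b < 1 -> (j < J)%N ->
  \sum_(0 <= l < J | l != j) chord (grid J j) (grid J l) `^ (- b) <= 8 / (1 - b) * J%:R :> R.
Proof.
move=> b01 jJ; have J0 : 0 < J%:R :> R by rewrite ltr0n (leq_ltn_trans _ jJ).
have /andP[b0 b1] := b01.
pose f (k : nat) : R := (k%:R / J%:R) `^ (- b).
have f0 k : 0 <= f k by exact: powR_ge0.
have Sf : \sum_(1 <= k < J) f k <= 2 / (1 - b) * J%:R.
  rewrite /f.
  under eq_bigr do rewrite powRM ?invr_ge0//.
  rewrite -mulr_suml.
  apply: (@le_trans _ _ (2 / (1 - b) * J.-1%:R `^ (1 - b) * J%:R^-1 `^ (- b))).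
    rewrite ler_wpM2r ?powR_ge0//.
    by have := sum_powRN J.-1 b01; rewrite prednK// (leq_ltn_trans _ jJ).
  apply: (@le_trans _ _ (2 / (1 - b) * J%:R `^ (1 - b) * J%:R^-1 `^ (- b))).
    rewrite ler_wpM2r ?powR_ge0// ler_wpM2l//; first by rewrite divr_ge0// subr_ge0 ltW.
    by rewrite ge0_ler_powR ?nnegrE ?ler_nat ?leq_pred// subr_ge0 ltW.
  rewrite -mulrA -[J%:R^-1]powR_inv1 ?(ltW J0)// -powRrM mulN1r opprK -powRD.
    by rewrite subrK powRr1// ltW.
  by apply/implyP => _; rewrite gt_eqF.
apply: (@le_trans _ _ (\sum_(0 <= l < J | l != j) (f `|l - j|%N + f (J - `|l - j|)%N))).
  rewrite big_seq_cond [leRHS]big_seq_cond; apply: ler_sum => l /andP[].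
  rewrite mem_index_iota => /= lJ lj.
  have k0 : (0 < `|l - j|)%N by rewrite lt0n distn_eq0.
  have kJ : (`|l - j| < J)%N by move: jJ lJ; clear; lia.
  have anti u v : 0 < u -> u <= v -> v `^ (- b) <= u `^ (- b).
    move=> u0 uv; rewrite !powRN lef_pV2 ?posrE ?powR_gt0 ?(lt_le_trans u0)//.
    by rewrite ge0_ler_powR ?nnegrE ?(ltW b0) ?(ltW u0)// (le_trans (ltW u0)).
  have [|] := chord_grid jJ lJ lj => h.
    rewrite (@le_trans _ _ (f `|l - j|%N)) ?lerDl//; apply: anti => //.
    by rewrite divr_gt0// ltr0n.
  rewrite (@le_trans _ _ (f (J - `|l - j|)%N)) ?lerDr//; apply: anti => //.
  by rewrite divr_gt0// ltr0n subn_gt0.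
have -> : 8 / (1 - b) * J%:R = (2 / (1 - b) * J%:R) *+ 4 by rewrite -mulr_natr; ring.
apply: (@le_trans _ _ ((\sum_(1 <= k < J) f k) *+ 4)); last by rewrite ler_pMn2r.
rewrite (@big_cat_nat _ _ _ j)//= ?(ltnW jJ)//.
have E (F : nat -> R) : \sum_(0 <= l < j | l != j) F l = \sum_(l <- index_iota 0 j) F l.
  rewrite big_nat_cond [RHS]big_nat; apply: eq_bigl => l.
  by case: (ltnP l j) => lj; rewrite ?andbF//= ltn_eqF.
have E' (F : nat -> R) : \sum_(j <= l < J | l != j) F l = \sum_(l <- index_iota j.+1 J) F l.
  rewrite big_ltn_cond// eqxx/= big_nat_cond [RHS]big_nat; apply: eq_bigl => l.
  by case: (ltnP j l) => lj; rewrite ?andbF//= gtn_eqF// andbT.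
rewrite E E' !big_split/= -!addrA [X in _ <= X]mulrSr [X in _ <= X + _]mulrSr.
rewrite [X in _ <= X + _ + _]mulr2n -!addrA.
by do !apply: lerD; apply: ler_sum_injective; rewrite ?iota_uniq//;
  [move=> u v|move=> u|move=> u v|move=> u|move=> u v|move=> u|move=> u v|move=> u];
  rewrite !mem_index_iota; move: jJ; clear; lia.
Qed.

End grid_sums.

Section chaos_against_wick_exponential.
Context {R : realType} {d : measure_display} {Omega : measurableType d}.
Variables (P : probability Omega R) (X : Omega -> (R -> R[i]) -> R[i]).
Hypothesis hX : log_correlated_field P X.
Variable phi : R -> R.
Hypothesis hphi : mollifier phi.
Variable beta : R.
Hypothesis hbeta : 0 < beta < 1.
Local Notation ker := (mollifier_kernel phi).
Local Notation s := (beta ^+ 2 / 2).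
Implicit Types (e t x y r : R).

Lemma two_scales e t : 0 < e <= t -> t <= 1 -> [/\ 0 < e, 0 < t, 0 < e <= 1 & 0 < t <= 1].
Proof.
move=> /andP[e0 et] t1; have t0 := lt_le_trans e0 et.
by split; rewrite ?e0 ?t0 ?(le_trans et).
Qed.

Definition kernel_diff e t x := fun z => ker e x z - ker t x z.

Lemma rtest_kernel_diff e t x : 0 < e <= 1 -> 0 < t <= 1 -> rtest (kernel_diff e t x).
Proof. by move=> e01 t01; apply: rtestB; exact: rtest_kernel. Qed.

Lemma log_cov_kernel_diff e t x y : 0 < e <= 1 -> 0 < t <= 1 ->
  log_cov (kernel_diff e t x) (kernel_diff e t y) =
  log_cov (ker e x) (ker e y) - log_cov (ker e x) (ker t y)
  - log_cov (ker t x) (ker e y) + log_cov (ker t x) (ker t y).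
Proof.
move=> e01 t01; have T a z (h : 0 < a <= 1) := rtest_kernel hphi z h.
have Ty := rtest_kernel_diff y e01 t01.
rewrite (log_covBl hX (T _ x e01) (T _ x t01) Ty) /kernel_diff.
rewrite (log_covBr hX (T _ y e01) (T _ y t01) (T _ x e01)).
rewrite (log_covBr hX (T _ y e01) (T _ y t01) (T _ x t01)).
move: (log_cov (ker e x) (ker e y)) (log_cov (ker e x) (ker t y)) => k1 k2.
by move: (log_cov (ker t x) (ker e y)) (log_cov (ker t x) (ker t y)) => k3 k4; ring.
Qed.

Let chord_near e t x : 0 < e <= t -> t <= 1 ->
  [/\ - ln (2 * t) <= log_cov (ker e x) (ker t x), - ln (2 * t) <= log_cov (ker t x) (ker e x)
  & - ln (2 * t) <= log_cov (ker t x) (ker t x)].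
Proof.
move=> et t1; have [e0 t0 e01 t01] := two_scales et t1; have /andP[_ et'] := et.
have c0 : chord x x = 0 by rewrite /chord subrr Normc.normc0.
have t20 : 0 < 2 * t by rewrite mulr_gt0.
by split; apply: log_cov_kernel_ge => //; rewrite c0; lra.
Qed.

(** The quotient of the arguments is 1 + 4 t / (p - 2 t), and p - 2 t >= r / 2. *)
Lemma ln_ratio_le t r p : 0 < t -> 4 * t <= r -> r <= p ->
  2 * (ln (p + 2 * t) - ln (p - 2 * t)) <= 16 * t / r.
Proof.
move=> t0 tr rp; have r0 : 0 < r by lra.
have u0 : 0 < p - 2 * t by lra.
have v0 : 0 < p + 2 * t by lra.
rewrite -ln_div ?posrE//.
have w0 : 0 <= 4 * t / (p - 2 * t) by rewrite divr_ge0 ?(ltW u0)// mulr_ge0 ?(ltW t0).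
have -> : (p + 2 * t) / (p - 2 * t) = 1 + 4 * t / (p - 2 * t) by field; rewrite gt_eqF.
have h : ln (1 + 4 * t / (p - 2 * t)) <= 4 * t / (p - 2 * t).
  by apply: le_ln1Dx; rewrite (lt_le_trans (ltrN10 _)).
have h6 : 4 * t / (p - 2 * t) <= 8 * t / r.
  by rewrite ler_pdivrMr// mulrAC ler_pdivlMr//; nra.
have -> : 16 * t / r = 2 * (8 * t / r) by ring.
by rewrite ler_pM2l// (le_trans h).
Qed.

(** At distance much larger than t, mollification moves a covariance only between the logarithms at
    chord + 2 t and chord - 2 t, and the main logarithm cancels in the alternating sum of four.
    Subtracting X_t thus removes the long-range correlation of X_e. *)
Lemma kernel_diff_cov_far e t x y r : 0 < e <= t -> t <= 1 -> 4 * t <= r -> r <= chord x y ->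
  log_cov (kernel_diff e t x) (kernel_diff e t y) <= 16 * t / r.
Proof.
move=> et0 t1 tr rxy; have [e0 t0 e01 t01] := two_scales et0 t1.
have /andP[_ et] := et0.
have p0 : 0 < chord x y - 2 * t by lra.
have s1 : chord x y - 2 * t + e + e <= chord x y by lra.
have s2 : chord x y - 2 * t + t + t <= chord x y by lra.
have s3 : chord x y + e + t <= chord x y + 2 * t by lra.
have s4 : chord x y + t + e <= chord x y + 2 * t by lra.
have q0 : 0 < chord x y + 2 * t by lra.
have L := ln_ratio_le t0 tr rxy.
have h1 := log_cov_kernel_far hphi e01 e01 p0 s1.
have h2 := log_cov_kernel_far hphi t01 t01 p0 s2.
have h3 := log_cov_kernel_ge hphi e01 t01 q0 s3.
have h4 := log_cov_kernel_ge hphi t01 e01 q0 s4.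
rewrite log_cov_kernel_diff//; move: L h1 h2 h3 h4.
move: (log_cov (ker e x) (ker e y)) (log_cov (ker e x) (ker t y)) => k1 k2.
move: (log_cov (ker t x) (ker e y)) (log_cov (ker t x) (ker t y)) => k3 k4.
move: (ln _) (ln _) (16 * t / r) => l1 l2 v; lra.
Qed.

(** The covariance of X_e alone accounts for - ln chord. The three covariances involving X_t add up
    to at most ln chord + O(1) when chord >= 4 t, and to at most ln t + O(1) otherwise; both are
    bounded above. *)
Lemma kernel_diff_cov_near : exists2 C, 0 < C & forall e t x y, 0 < e <= t -> t <= 1 ->
  0 < chord x y -> log_cov (kernel_diff e t x) (kernel_diff e t y) <= - ln (chord x y) + C.
Proof.
have [C C0 HC] := log_cov_kernel_near hphi.
have l2 : 0 < ln 2 :> R by rewrite ln_gt0// ltr1n.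
have l4 : ln 4 = 2 * ln 2 :> R by rewrite (_ : 4 = 2 * 2) ?lnM ?posrE//; [ring|rewrite -natrM].
have l6 : ln 6 <= 3 * ln 2 :> R.
  apply: (@le_trans _ _ (ln 8)); first by rewrite ler_ln ?posrE ?ler_nat.
  by rewrite (_ : 8 = 2 * 4) ?lnM ?posrE ?l4//; [lra|rewrite -natrM].
(* The multiple of ln 2 generously covers the numerical factors 2, 4 and 6 inside the logarithms
   below. *)
exists (C + C + 20 * ln 2); first by lra.
move=> e t x y et0 t1 p0; have [e0 t0 e01 t01] := two_scales et0 t1.
have /andP[_ et] := et0.
have p2 := chord_le2 x y; have lp : ln (chord x y) <= ln 2 by rewrite ler_ln ?posrE.
have lt0 : ln t <= 0 by apply: ln_le0.
have lpE a : 0 < a -> ln (a * chord x y) = ln a + ln (chord x y) by move=> a0; rewrite lnM ?posrE.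
have near a : 0 < a <= 1 -> log_cov (ker a x) (ker a y) <= - ln (chord x y) + C + 2 * ln 2.
  move=> a01; have a0 : 0 < a by case/andP: a01.
  have [h|h] := leP (4 * a) (chord x y).
    have s1 : 2^-1 * chord x y + a + a <= chord x y by lra.
    have q0 : 0 < 2^-1 * chord x y by rewrite mulr_gt0.
    apply: (le_trans (log_cov_kernel_far hphi a01 a01 q0 s1)).
    by rewrite lpE// lnV ?posrE//; lra.
  apply: (le_trans (HC a a x y a01 a01)).
  have : ln (4^-1 * chord x y) <= ln a by rewrite ler_ln ?posrE ?mulr_gt0// ler_pdivrMl// ltW.
  by rewrite lpE// lnV ?posrE// l4; lra.
have h1 := near _ e01.
rewrite log_cov_kernel_diff//.
have [h|h] := leP (4 * t) (chord x y).
  have q0 : 0 < 2 * chord x y by rewrite mulr_gt0.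
  have s3 : chord x y + e + t <= 2 * chord x y by clear h1; lra.
  have s4 : chord x y + t + e <= 2 * chord x y by clear h1; lra.
  have h2 := near _ t01.
  have h3 := log_cov_kernel_ge hphi e01 t01 q0 s3.
  have h4 := log_cov_kernel_ge hphi t01 e01 q0 s4.
  move: h1 h2 h3 h4; rewrite lpE//.
  move: (log_cov (ker e x) (ker e y)) (log_cov (ker e x) (ker t y)) => k1 k2.
  move: (log_cov (ker t x) (ker e y)) (log_cov (ker t x) (ker t y)) => k3 k4.
  lra.
have q0 : 0 < 6 * t by rewrite mulr_gt0.
have s3 : chord x y + e + t <= 6 * t by clear h1; lra.
have s4 : chord x y + t + e <= 6 * t by clear h1; lra.
have h2 := HC t t x y t01 t01.
have h3 := log_cov_kernel_ge hphi e01 t01 q0 s3.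
have h4 := log_cov_kernel_ge hphi t01 e01 q0 s4.
move: h1 h2 h3 h4; rewrite lnM ?posrE//.
move: (log_cov (ker e x) (ker e y)) (log_cov (ker e x) (ker t y)) => k1 k2.
move: (log_cov (ker t x) (ker e y)) (log_cov (ker t x) (ker t y)) => k3 k4.
lra.
Qed.

(** The diagonal sees the full variance of X_e, of order - ln e. Its exponential e^(- beta^2) occurs
    with weight 1/J only and disappears as J grows with e fixed. *)
Lemma kernel_diff_cov_diag : exists2 C, 0 < C & forall e t x, 0 < e <= t -> t <= 1 ->
  log_cov (kernel_diff e t x) (kernel_diff e t x) <= - ln e + C.
Proof.
have [C C0 HC] := log_cov_kernel_near hphi.
have l2 : 0 < ln 2 :> R by rewrite ln_gt0// ltr1n.
exists (C + C + 2 * ln 2); first by lra.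
move=> e t x et t1; have [e0 t0 e01 t01] := two_scales et t1.
rewrite log_cov_kernel_diff//.
have [h1 h2 _] := chord_near x et t1.
have h3 := HC e e x x e01 e01; have h4 := HC t t x x t01 t01.
have lt0 : ln t <= 0 by apply: ln_le0.
move: h1 h2 h3 h4; rewrite lnM ?posrE//; move: lt0 l2 C0.
move: (log_cov (ker e x) (ker e x)) (log_cov (ker e x) (ker t x)) => k1 k2.
move: (log_cov (ker t x) (ker e x)) (log_cov (ker t x) (ker t x)) => k3 k4.
move: (ln 2) (ln t) (ln e) => u v v'; lra.
Qed.

(* [pair_sum] is the pairing of M_eps with the conjugate of t^s exp (i beta X_t):
   the weight collects the two deterministic normalizations. *)
Definition pair_weight e t x := t `^ s * expR (s * log_cov (ker e x) (ker e x)).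

Definition pair_sum e t J :=
  exp_sum X J (fun j => kernel_diff e t (grid J j)) (fun j => pair_weight e t (grid J j)) beta.

Definition pair_term e t J j :=
  exp_mean (fun j => kernel_diff e t (grid J j)) (fun j => pair_weight e t (grid J j)) beta j.

Definition pair_mean e t J :=
  exp_sum_mean J (fun j => kernel_diff e t (grid J j)) (fun j => pair_weight e t (grid J j)) beta.

(** The exponent reduces to s (ln t + 2 u - v), where u is the covariance of X_e and X_t at the same
    point and v the variance of X_t. Both are - ln t + O(1), uniformly in e, so everything cancels
    up to a constant. *)
Lemma pair_term_bounds : exists c1 c2, [/\ 0 < c1, 0 < c2 & forall e t J j,
  0 < e <= t -> t <= 1 -> c1 <= pair_term e t J j <= c2].
Proof.
have [C C0 HC] := log_cov_kernel_near hphi.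
have b0 : 0 < beta by case/andP: hbeta.
have s0 : 0 < s by rewrite divr_gt0// exprn_gt0.
exists (expR (s * (- (2 * ln 2) - C))), (expR (s * (2 * C + ln 2))).
rewrite !expR_gt0; split => // e t J j et t1.
have [e0 t0 e01 t01] := two_scales et t1.
rewrite /pair_term /exp_mean /pair_weight log_cov_kernel_diff//.
set x := grid J j; have [h1 h2 h3] := chord_near x et t1.
have h4 := HC t t x x t01 t01; have h5 := HC e t x x e01 t01.
have E : log_cov (ker t x) (ker e x) = log_cov (ker e x) (ker t x).
  by apply: (log_covC hX); exact: rtest_kernel.
rewrite E in h2 *.
rewrite /powR gt_eqF// -!expRD !ler_expR.
move: h1 h2 h3 h4 h5; rewrite lnM ?posrE//.
move: (log_cov (ker e x) (ker t x)) (log_cov (ker t x) (ker t x)) (log_cov (ker e x) (ker e x)).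
move=> u v z h1 h2 h3 h4 h5; clear E x HC.
have -> : s * ln t + s * z + - (beta ^+ 2 * (z - u - u + v) / 2) = s * (ln t + u + u - v) by field.
by rewrite !ler_pM2l//; apply/andP; split; lra.
Qed.

(** The three summands come, in this order, from pairs of nodes at chord at least r, from distinct
    nodes at chord less than r, and from the diagonal. *)
Lemma pair_variance_bound : exists2 C, 0 < C & forall e t r J, 0 < e <= t -> t <= 1 ->
  4 * t <= r -> (0 < J)%N ->
  \int[P]_w sqn (pair_sum e t J w - (pair_mean e t J)%:C) <=
  C * ((expR (beta ^+ 2 * (16 * t / r)) - 1) + r `^ ((1 - beta ^+ 2) / 2)
       + e `^ (- beta ^+ 2) / J%:R).
Proof.
have [c1 [c2 [c10 c20 Hc]]] := pair_term_bounds.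
have [C1 C10 H1] := kernel_diff_cov_near; have [C2 C20 H2] := kernel_diff_cov_diag.
have /andP[b0 b1] := hbeta.
have bb0 : 0 < beta ^+ 2 by rewrite exprn_gt0.
have bb1 : beta ^+ 2 < 1 by rewrite expr_lt1// ltW.
set b := beta ^+ 2 in bb0 bb1 *; set g := (1 - b) / 2; pose b' := (1 + b) / 2.
have b'01 : 0 < b' < 1 by rewrite /b'; apply/andP; split; lra.
have g0 : 0 < g by rewrite divr_gt0// subr_gt0.
pose D1 := expR (b * C1); pose D2 := expR (b * C2).
have D10 : 0 < D1 by exact: expR_gt0.
have D20 : 0 < D2 by exact: expR_gt0.
pose S := 8 / (1 - b').
have S0 : 0 < S by rewrite divr_gt0// subr_gt0; case/andP: b'01.
exists (c2 ^+ 2 * (1 + D1 * S + D2)).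
  by rewrite mulr_gt0 ?exprn_gt0// !addr_gt0// mulr_gt0.
move=> e t r J et t1 tr J0.
have [e0 t0 e01 t01] := two_scales et t1.
have r0 : 0 < r by lra.
have JR : 0 < J%:R :> R by rewrite ltr0n.
rewrite (Rintegral_sqn_exp_sum hX); last by move=> j; exact: rtest_kernel_diff.
set f0 := expR (b * (16 * t / r)) - 1.
have f00 : 0 <= f0.
  rewrite subr_ge0 -[leLHS]expR0 ler_expR mulr_ge0 ?(ltW bb0)// divr_ge0 ?(ltW r0)//.
  by rewrite mulr_ge0// ltW.
set f1 := r `^ g; set f2 := e `^ (- b).
have f10 : 0 <= f1 by exact: powR_ge0.
have f20 : 0 <= f2 by exact: powR_ge0.
set a := exp_mean _ _ _.
pose x j : R := grid J j.
pose Q j l := log_cov (kernel_diff e t (x j)) (kernel_diff e t (x l)).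
have a0 j : 0 <= a j <= c2.
  by have /andP[h1 h2] := Hc e t J j et t1; apply/andP; split=> //; exact: (le_trans (ltW c10) h1).
clearbody a.
have mono j l u v : u <= v -> 0 <= v -> a j * a l * u <= c2 ^+ 2 * v.
  move=> uv v0; have /andP[p1 p2] := a0 j; have /andP[q1 q2] := a0 l.
  have aa0 : 0 <= a j * a l by exact: mulr_ge0.
  apply: (le_trans (ler_wpM2l aa0 uv)); apply: ler_wpM2r => //.
  by rewrite expr2; exact: ler_pM.
have term j l : (j < J)%N -> (l < J)%N -> l != j ->
    a j * a l * (expR (b * Q j l) - 1) <= c2 ^+ 2 * (f0 + D1 * f1 * chord (x j) (x l) `^ (- b')).
  move=> jJ lJ lj; have p0 : 0 < chord (x j) (x l) by exact: chord_grid_gt0.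
  have Y0 : 0 <= D1 * f1 * chord (x j) (x l) `^ (- b').
    by rewrite !mulr_ge0 ?powR_ge0// ltW.
  apply: mono; last by rewrite addr_ge0.
  have [h|h] := leP r (chord (x j) (x l)).
    apply: (@le_trans _ _ f0); last by rewrite lerDl.
    rewrite lerD2r ler_expR ler_pM2l//; exact: kernel_diff_cov_far.
  apply: (@le_trans _ _ (D1 * f1 * chord (x j) (x l) `^ (- b'))); last by rewrite lerDr.
  apply: (@le_trans _ _ (expR (b * Q j l))); first by rewrite gerBl.
  apply: (@le_trans _ _ (expR (b * (- ln (chord (x j) (x l)) + C1)))).
    by rewrite ler_expR ler_pM2l//; exact: H1.
  have -> : expR (b * (- ln (chord (x j) (x l)) + C1)) = D1 * chord (x j) (x l) `^ (- b).
    by rewrite /D1 /powR gt_eqF// -expRD; congr expR; ring.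
  rewrite -mulrA ler_wpM2l ?(ltW D10)//.
  (* chord^-b <= r^(b' - b) chord^-b' gains a power of r near the diagonal
     while keeping the exponent b' below 1. *)
  have -> : - b = g + - b' by rewrite /g /b'; field.
  rewrite powRD; last by apply/implyP => _; rewrite gt_eqF.
  rewrite ler_wpM2r ?powR_ge0// /f1 ge0_ler_powR ?nnegrE ?(ltW g0) ?(ltW r0) ?(ltW h)//.
  exact: chord_ge0.
have diag j : a j * a j * (expR (b * Q j j) - 1) <= c2 ^+ 2 * (D2 * f2).
  apply: mono; last by rewrite mulr_ge0// ltW.
  apply: (@le_trans _ _ (expR (b * Q j j))); first by rewrite gerBl.
  apply: (@le_trans _ _ (expR (b * (- ln e + C2)))).
    by rewrite ler_expR ler_pM2l//; exact: H2.
  rewrite le_eqVlt; apply/orP; left; apply/eqP.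
  by rewrite /D2 /f2 /powR gt_eqF// -expRD; congr expR; ring.
have row j : (j < J)%N -> \sum_(0 <= l < J) a j * a l * (expR (b * Q j l) - 1) <=
    c2 ^+ 2 * (D2 * f2 + (f0 * J%:R + D1 * f1 * (S * J%:R))).
  move=> jJ; rewrite (bigD1_seq j) ?iota_uniq ?mem_index_iota// [leRHS]mulrDr lerD//.
  apply: (@le_trans _ _ (\sum_(0 <= l < J | l != j)
      c2 ^+ 2 * (f0 + D1 * f1 * chord (x j) (x l) `^ (- b')))).
    rewrite big_seq_cond [leRHS]big_seq_cond; apply: ler_sum => l /andP[].
    by rewrite mem_index_iota => /= lJ lj; exact: term.
  rewrite -mulr_sumr ler_wpM2l ?sqr_ge0// big_split/= lerD//.
    apply: (@le_trans _ _ (\sum_(0 <= l < J) f0)); last first.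
      by rewrite sumr_const_nat subn0 mulr_natr.
    by rewrite [leRHS](bigID (fun l => l != j))/= lerDl sumr_ge0.
  by rewrite -mulr_sumr ler_wpM2l ?mulr_ge0 ?(ltW D10)//; exact: sum_chord_grid.
apply: (@le_trans _ _ (J%:R^-1 ^+ 2 * \sum_(0 <= j < J)
    (c2 ^+ 2 * (D2 * f2 + (f0 * J%:R + D1 * f1 * (S * J%:R)))))).
  rewrite ler_wpM2l ?sqr_ge0// big_nat [leRHS]big_nat; apply: ler_sum => j jJ.
  exact: row.
rewrite sumr_const_nat subn0 -(mulr_natr (c2 ^+ 2 * _)).
have -> : J%:R^-1 ^+ 2 * (c2 ^+ 2 * (D2 * f2 + (f0 * J%:R + D1 * f1 * (S * J%:R))) * J%:R) =
    c2 ^+ 2 * (f0 + D1 * S * f1 + D2 * (f2 / J%:R)) by field; rewrite gt_eqF.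
rewrite -[leRHS]mulrA ler_wpM2l ?sqr_ge0//.
have f2J : 0 <= f2 / J%:R by rewrite divr_ge0.
have DS : 0 < D1 * S by rewrite mulr_gt0.
move: (f2 / J%:R) (D1 * S) f2J DS => z k z0 k0.
have hh1 := mulr_ge0 (ltW k0) f00. have hh2 := mulr_ge0 (ltW k0) z0.
have hh3 := mulr_ge0 (ltW D20) f00. have hh4 := mulr_ge0 (ltW D20) f10.
by nra.
Qed.

End chaos_against_wick_exponential.

(** * Probability estimates *)

Section complex_measurability.
Context {R : realType} d (T : measurableType d).
Implicit Types (f g : T -> R[i]) (z : R[i]).

Definition cmeasurable f :=
  measurable_fun setT (fun w => complex.Re (f w)) /\
  measurable_fun setT (fun w => complex.Im (f w)).

Lemma cmeasurable_cst z : cmeasurable (fun=> z).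
Proof. by split; exact: measurable_cst. Qed.

Lemma cmeasurableD f g : cmeasurable f -> cmeasurable g -> cmeasurable (fun w => f w + g w).
Proof.
by move=> [f1 f2] [g1 g2]; split; under eq_fun do rewrite raddfD; exact: measurable_funD.
Qed.

Lemma cmeasurableM f g : cmeasurable f -> cmeasurable g -> cmeasurable (fun w => f w * g w).
Proof.
move=> [f1 f2] [g1 g2]; split.
  rewrite (_ : (fun w => _) = (fun w => complex.Re (f w) * complex.Re (g w) -
      complex.Im (f w) * complex.Im (g w))).
    by apply: measurable_funB; exact: measurable_funM.
  by apply/funext => w; case: (f w); case: (g w).
rewrite (_ : (fun w => _) = (fun w => complex.Re (f w) * complex.Im (g w) +
    complex.Im (f w) * complex.Re (g w))).
  by apply: measurable_funD; exact: measurable_funM.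
by apply/funext => w; case: (f w); case: (g w).
Qed.

Lemma cmeasurableB f g : cmeasurable f -> cmeasurable g -> cmeasurable (fun w => f w - g w).
Proof.
move=> mf mg; have := cmeasurableD mf (cmeasurableM (cmeasurable_cst (-1)) mg).
by congr cmeasurable; apply/funext => w; rewrite mulN1r.
Qed.

Lemma cmeasurable_sum (I : Type) (r : seq I) (F : I -> T -> R[i]) :
  (forall i, cmeasurable (F i)) -> cmeasurable (fun w => \sum_(i <- r) F i w).
Proof.
move=> mF; elim: r => [|i r IH].
  by rewrite (_ : (fun w => _) = fun=> 0); [exact: cmeasurable_cst|apply/funext => w; rewrite big_nil].
rewrite (_ : (fun w => _) = fun w => F i w + \sum_(i <- r) F i w).
  exact: cmeasurableD.
by apply/funext => w; rewrite big_cons.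
Qed.

Lemma measurable_sqn f : cmeasurable f -> measurable_fun setT (fun w => sqn (f w)).
Proof.
move=> [m1 m2]; under eq_fun do rewrite sqnE !expr2.
by apply: measurable_funD; exact: measurable_funM.
Qed.

Lemma measurable_normc f : cmeasurable f -> measurable_fun setT (fun w => Normc.normc (f w)).
Proof.
move=> mf; rewrite (_ : (fun w => _) = (fun w => Num.sqrt (sqn (f w)))).
  apply: (measurableT_comp _ (measurable_sqn mf)).
  by apply: continuous_measurable_fun; exact: sqrt_continuous.
by apply/funext => w; rewrite /sqn sqrtr_sqr ger0_norm ?normc_ge0.
Qed.

Lemma cmeasurable_lim (F : nat -> T -> R[i]) f : (forall n, cmeasurable (F n)) ->
  (forall w, exists C, forall n, Normc.normc (F n w - f w) <= C / n.+1%:R) -> cmeasurable f.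
Proof.
move=> mF H.
have inv0 w : exists2 C, 0 < C & forall n, Normc.normc (F n w - f w) <= C / n.+1%:R.
  have [C HC] := H w; exists (Num.max 1 C); first by rewrite lt_max ltr01.
  move=> n; apply: (le_trans (HC n)); rewrite ler_wpM2r ?invr_ge0// le_max lexx.
  by rewrite orbT.
have cv (p : R[i] -> R) w : (forall z z', p (z - z') = p z - p z') ->
    (forall z, `|p z| <= Normc.normc z) -> p (F n w) @[n --> \oo] --> p (f w).
  move=> pB pn; have [C C0 HC] := inv0 w.
  apply/cvgrPdist_le => e e0; near=> n.
  rewrite distrC -pB; apply: (le_trans (pn _)); apply: (le_trans (HC n)).
  rewrite ler_pdivrMr// mulrC -ler_pdivrMr//.
  apply: (@le_trans _ _ n%:R); last by rewrite ler_nat.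
  near: n; exact: nbhs_infty_ger.
split.
  apply: (@measurable_fun_cvg _ _ _ _ (fun n w => complex.Re (F n w))) => [n|w _].
    by case: (mF n).
  by apply: cv => [z z'|z]; [exact: raddfB|exact: normr_Re].
apply: (@measurable_fun_cvg _ _ _ _ (fun n w => complex.Im (F n w))) => [n|w _].
  by case: (mF n).
by apply: cv => [z z'|z]; [exact: raddfB|exact: normr_Im].
Unshelve. all: by end_near. Qed.

Lemma cmeasurable_dft (J : nat) (F : T -> nat -> R[i]) n :
  (forall j, cmeasurable (fun w => F w j)) -> cmeasurable (fun w => dft J (F w) n).
Proof.
move=> mF; apply: cmeasurableM; first exact: cmeasurable_cst.
by apply: cmeasurable_sum => j; apply: cmeasurableM => //; exact: cmeasurable_cst.
Qed.

Lemma measurable_zsum L N (F : int -> T -> R) :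
  (forall n, measurable_fun setT (F n)) -> measurable_fun setT (fun w => zsum L N (fun n => F n w)).
Proof.
by move=> mF; apply: measurable_sum => k; exact: measurable_funD.
Qed.

End complex_measurability.

Section chaos_coefficient_convergence.
Context {R : realType} {d : measure_display} {Omega : measurableType d}.
Variables (P : probability Omega R) (X : Omega -> (R -> R[i]) -> R[i]).
Hypothesis hX : log_correlated_field P X.
Variable phi : R -> R.
Hypothesis hphi : mollifier phi.
Variables (beta e : R).
Hypothesis e01 : 0 < e <= 1.
Local Notation coef := (chaos_coef P X phi beta e).
Local Notation cgrid := (chaos_grid P X phi beta e).

(** The coefficient is a pointwise limit of discrete transforms, each of which depends on finitely
    many field values. *)
Lemma cmeasurable_chaos_coef n : cmeasurable (fun w => coef w n).
Proof.
apply: (@cmeasurable_lim _ _ _ (fun k w => dft k.+1 (cgrid k.+1 w) n)) => [k|w].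
  by apply: cmeasurable_dft => j; exact: measurable_chaos_grid.
have [C _ HC] := dft_chaos_error hX hphi beta w n e01.
by exists C => k; exact: HC.
Qed.

Lemma chaos_grid_bounded : exists2 B, 0 < B &
  forall J w j, Normc.normc (cgrid J w j) <= B.
Proof.
have [B [HB _]] := lipschitz_log_cov hX hphi e01.
exists (expR (beta ^+ 2 / 2 * B)); first exact: expR_gt0.
move=> J w j; rewrite /chaos_grid (chaos_approxE hX hphi)// Normc.normcM normc_eix mulr1.
rewrite normc_real ger0_norm ?expR_ge0// ler_expR.
apply: ler_wpM2l; first by rewrite divr_ge0// sqr_ge0.
by apply: le_trans (HB _); exact: ler_norm.
Qed.

Lemma chaos_coef_bounded B w n : (forall J w j, Normc.normc (cgrid J w j) <= B) ->
  Normc.normc (coef w n) <= B.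
Proof.
move=> HB; have [C C0 HC] := dft_chaos_error hX hphi beta w n e01.
apply/ler_addgt0Pr => t t0.
pose k := (Num.truncn (C / t)).+1.
have k0 : (0 < k)%N by [].
have kt : C / k%:R <= t.
  by rewrite ler_pdivrMr ?ltr0n// mulrC -ler_pdivrMr// ltW// truncnS_gt.
have -> : coef w n = dft k (cgrid k w) n + (coef w n - dft k (cgrid k w) n).
  by rewrite addrC subrK.
apply: (le_trans (le_normcD _ _)); apply: lerD; first exact: normc_dft_le.
by rewrite normcB; exact: le_trans (HC k k0) kt.
Qed.

Definition aliasing_error N J w :=
  zsum 0 N (fun n => Normc.normc (dft J (cgrid J w) n - coef w n)).

Lemma measurable_aliasing_error N J : measurable_fun setT (aliasing_error N J).
Proof.
apply: measurable_zsum => n; apply: measurable_normc; apply: cmeasurableB.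
  by apply: cmeasurable_dft => j; exact: measurable_chaos_grid.
exact: cmeasurable_chaos_coef.
Qed.

Lemma aliasing_error_ge0 N J w : 0 <= aliasing_error N J w.
Proof. by apply: zsum_ge0 => n; exact: normc_ge0. Qed.

Lemma aliasing_error_bounded N : exists B, forall J w, (0 < J)%N ->
  `|aliasing_error N J w| <= B.
Proof.
have [B B0 HB] := chaos_grid_bounded; exists (\sum_(0 <= k < N) (4 * B)) => J w J0.
rewrite ger0_norm ?aliasing_error_ge0//; apply: ler_sum => k _.
have h n : Normc.normc (dft J (cgrid J w) n - coef w n) <= B + B.
  apply: (le_trans (le_normcD _ _)); rewrite normcN; apply: lerD.
    exact: normc_dft_le.
  exact: chaos_coef_bounded.
by apply: (le_trans (lerD (h _) (h _))); lra.
Qed.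

Lemma integrable_aliasing_error N J : (0 < J)%N ->
  P.-integrable setT (EFin \o aliasing_error N J).
Proof.
move=> J0; have [B HB] := aliasing_error_bounded N.
apply: (@bounded_integrableP _ _ _ P _ B); first exact: measurable_aliasing_error.
by move=> w; exact: HB.
Qed.

Lemma aliasing_error_cvg N w : aliasing_error N k.+1 w @[k --> \oo] --> (0 : R).
Proof.
have /choice[C HC] : forall n, exists C, forall J, (0 < J)%N ->
    Normc.normc (dft J (cgrid J w) n - coef w n) <= C / J%:R.
  by move=> n; have [C _ HC] := dft_chaos_error hX hphi beta w n e01; exists C.
pose D := zsum 0 N C.
have HD k : `|aliasing_error N k.+1 w| <= `|D| / k.+1%:R.
  rewrite ger0_norm ?aliasing_error_ge0//.
  apply: (@le_trans _ _ (D / k.+1%:R)); last by rewrite ler_wpM2r ?invr_ge0// ler_norm.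
  rewrite /D [_ / _]mulrC -zsum_mull; apply: ler_zsum => n _.
  by split; rewrite mulrC; exact: HC.
apply/cvgrPdist_le => t t0; near=> k.
rewrite sub0r normrN; apply: (le_trans (HD k)).
rewrite ler_pdivrMr// mulrC -ler_pdivrMr//.
apply: (@le_trans _ _ k%:R); last by rewrite ler_nat.
near: k; exact: nbhs_infty_ger.
Unshelve. all: by end_near. Qed.

(** Pathwise convergence comes without a uniform rate, but M_e has deterministic modulus, hence a
    deterministic bound, and dominated convergence applies at fixed e and N. *)
Lemma Rintegral_aliasing_error_small N (t : R) : 0 < t ->
  exists J0, forall J, (J0 < J)%N -> \int[P]_w aliasing_error N J w <= t.
Proof.
move=> t0; have [B HB] := aliasing_error_bounded N.
have := @dominated_cvg _ _ _ P setT measurableT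
  (fun k w => (aliasing_error N k.+1 w)%:E) (fun=> 0%E) (fun=> B%:E).
move=> /(_ _ _ _ _ _)/wrap[].
- by move=> k; apply/measurable_EFinP; exact: measurable_aliasing_error.
- by move=> w _; apply: cvg_EFin; [exact: nearW|exact: aliasing_error_cvg].
- by [].
- by apply: (@bounded_integrableP _ _ _ P (fun=> B) `|B|).
- by move=> k w _; rewrite lee_fin; exact: HB.
rewrite integral0 => cv.
have /cvgrPdist_le/(_ t t0)[J0 _ HJ] : \int[P]_w (aliasing_error N k.+1 w) @[k --> \oo] --> (0 : R).
  exact: fine_cvg cv.
exists J0.+1 => -[//|J] JJ; have := HJ J (ltnW JJ).
by rewrite /= sub0r normrN; apply: le_trans; exact: ler_norm.
Qed.

End chaos_coefficient_convergence.

Section duality_estimate.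
Context {R : realType} {d : measure_display} {Omega : measurableType d}.
Variables (P : probability Omega R) (X : Omega -> (R -> R[i]) -> R[i]).
Hypothesis hX : log_correlated_field P X.
Variable phi : R -> R.
Hypothesis hphi : mollifier phi.
Variable beta : R.
Hypothesis hbeta : 0 < beta < 1.
Local Notation ker := (mollifier_kernel phi).
Local Notation s := (beta ^+ 2 / 2).
Local Notation coef := (chaos_coef P X phi beta).
Local Notation cgrid := (chaos_grid P X phi beta).
Implicit Types (e t r : R) (w : Omega).

(** The factor t^s equals exp(- s Var X_t) up to bounded factors. Taking this constant keeps the
    modulus independent of the node and of the sample, as [duality_bound] requires. *)
Definition wick_grid t J w j : R[i] :=
  (t `^ s)%:C * eix (beta * field X (ker t (grid J j)) w).

Lemma sqn_wick_grid t J w j : sqn (wick_grid t J w j) = t `^ s ^+ 2.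
Proof. by rewrite sqnM sqn_eix mulr1 sqn_real. Qed.

Lemma wick_grid_periodic t (J : nat) w : 0 < t <= 1 -> (0 < J)%N ->
  wick_grid t J w J = wick_grid t J w 0.
Proof.
move=> t01 J0; rewrite /wick_grid; congr (_ * eix (_ * field X _ w)).
have -> : grid J J = pi *+ 2 :> R by rewrite /grid mulfK// pnatr_eq0 -lt0n.
have -> : grid J 0 = 0 :> R by rewrite /grid mulr0 mul0r.
by apply/funext => y; rewrite -(kernel_periodic hphi 0 y t01) add0r.
Qed.

Lemma pair_sumE e t J w : 0 < e <= 1 -> 0 < t <= 1 ->
  (J%:R^-1)%:C * \sum_(0 <= j < J) cgrid e J w j * ((wick_grid t J w j)^*)%C =
  pair_sum X phi beta e t J w.
Proof.
move=> e01 t01; rewrite /pair_sum /exp_sum; congr (_ * _); apply: eq_bigr => j _.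
have tk a : 0 < a <= 1 -> rtest (ker a (grid J j)) by move=> a01; exact: rtest_kernel.
rewrite /kernel_diff (fieldB hX _ (tk _ e01) (tk _ t01)) mulrBr eixD eixN.
rewrite /chaos_grid (chaos_approxE hX hphi)// /wick_grid conjcM conjc_realC.
rewrite /pair_weight rmorphM/= -/(_%:C).
by rewrite mulrACA [(expR _)%:C * _]mulrC.
Qed.

(** Dominates [h1_bound] by |exp(i a) - exp(i b)| <= |a - b|. It is quadratic in the field, so its
    expectation is given by covariances. *)
Definition field_energy t (J : nat) w : R := t `^ s ^+ 2 +
  4 / (pi *+ 2 / J%:R) ^+ 2 * (J%:R^-1 * \sum_(0 <= j < J)
    (t `^ s ^+ 2 * beta ^+ 2) *
    field X (fun y => ker t (grid J j + pi *+ 2 / J%:R) y - ker t (grid J j) y) w ^+ 2).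

Lemma grid_succ J j : grid J j.+1 = grid J j + pi *+ 2 / J%:R :> R.
Proof. by rewrite /grid -natr1; ring. Qed.

Lemma field_energy_ge0 t J w : 0 <= field_energy t J w.
Proof.
rewrite addr_ge0 ?sqr_ge0// mulr_ge0 ?divr_ge0 ?sqr_ge0// mulr_ge0 ?invr_ge0// sumr_ge0// => j _.
by apply: mulr_ge0; [apply: mulr_ge0|]; exact: sqr_ge0.
Qed.

Lemma h1_bound_le t N' w : 0 < t <= 1 ->
  h1_bound N' (wick_grid t N'.*2 w) (t `^ s) <= field_energy t N'.*2 w.
Proof.
move=> t01; rewrite /h1_bound lerD2l ler_wpM2l ?divr_ge0 ?sqr_ge0// ler_wpM2l ?invr_ge0//.
apply: ler_sum => j _; set J := N'.*2.
have tk a : rtest (ker t a) by exact: rtest_kernel.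
rewrite /wick_grid -mulrBr sqnM sqn_real -mulrA ler_wpM2l ?sqr_ge0//.
rewrite (fieldB hX _ (tk _) (tk _)) -grid_succ -exprMn mulrBr /sqn.
rewrite -[leRHS]real_normK ?num_real// ler_sqr ?nnegrE ?normc_ge0//.
exact: normc_eixB.
Qed.

Let rtest_increment t x h : 0 < t <= 1 -> rtest (fun y => ker t (x + h) y - ker t x y).
Proof. by move=> t01; apply: rtestB; exact: rtest_kernel. Qed.

Lemma integrable_field_energy t J : 0 < t <= 1 ->
  P.-integrable setT (EFin \o field_energy t J).
Proof.
move=> t01; apply: integrable_realD => //; first exact: integrable_prob_cst.
apply: integrable_realZ => //; apply: integrable_realZ => //.
apply: integrable_real_sum => j; apply: integrable_realZ => //.
exact: (integrable_field_sqr hX (rtest_increment _ _ t01)).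
Qed.

(** An increment over one mesh width h has variance O((h / t)^2), which cancels the h^-2 of the
    difference quotient: the bound does not depend on J. *)
Lemma Rintegral_field_energy_le : exists2 C, 0 < C & forall t (J : nat),
  0 < t <= 1 -> (0 < J)%N -> pi *+ 2 / J%:R <= t -> pi *+ 2 / J%:R < 2^-1 :> R ->
  \int[P]_w field_energy t J w <= C * (t `^ s ^+ 2 / t ^+ 2).
Proof.
have [C C0 HC] := log_cov_kernel_increment hphi.
exists (1 + 4 * C); first by rewrite addr_gt0// mulr_gt0.
move=> t J t01 J0 ht h2; set h := pi *+ 2 / J%:R in ht h2 *; set c := t `^ s ^+ 2.
have JR : 0 < J%:R :> R by rewrite ltr0n.
have h0 : 0 < h by rewrite divr_gt0// twopi_gt0.
have /andP[t0 t1] := t01; have c0 : 0 <= c by exact: sqr_ge0.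
have b1 : beta ^+ 2 <= 1 by case/andP: hbeta => b0 b1; rewrite expr_le1// ltW.
have i1 j : P.-integrable setT (EFin \o (fun w => field X
    (fun y => ker t (grid J j + h) y - ker t (grid J j) y) w ^+ 2)).
  exact: (integrable_field_sqr hX (rtest_increment _ _ t01)).
have i2 j := integrable_realZ measurableT (c * beta ^+ 2) (i1 j).
have i3 : P.-integrable setT (EFin \o (fun w => \sum_(0 <= j < J) c * beta ^+ 2 * field X
    (fun y => ker t (grid J j + h) y - ker t (grid J j) y) w ^+ 2)).
  exact: integrable_real_sum.
have i4 := integrable_realZ measurableT J%:R^-1 i3.
have i5 := integrable_realZ measurableT (4 / h ^+ 2) i4.
have i0 := integrable_prob_cst P c.
rewrite /field_energy -/h -/c RintegralD// Rintegral_prob_cst RintegralZl// RintegralZl// Rintegral_sum//.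
have E j : \int[P]_w (c * beta ^+ 2 * field X
    (fun y => ker t (grid J j + h) y - ker t (grid J j) y) w ^+ 2) <= c * (C * (h / t) ^+ 2).
  rewrite RintegralZl//; under eq_Rintegral do rewrite expr2.
  rewrite (Rintegral_field2 hX (rtest_increment _ _ t01) (rtest_increment _ _ t01)).
  rewrite -mulrA ler_wpM2l//; have := HC t (grid J j) h t01 (ltW h0) ht h2.
  set L := log_cov _ _ => HL.
  have Ht : 0 <= C * (h / t) ^+ 2 by rewrite mulr_ge0 ?sqr_ge0// ltW.
  apply: (le_trans (ler_wpM2l (sqr_ge0 _) HL)).
  by rewrite ler_piMl.
apply: (@le_trans _ _ (c + 4 / h ^+ 2 * (J%:R^-1 * \sum_(0 <= j < J) c * (C * (h / t) ^+ 2)))).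
  by rewrite lerD2l ler_wpM2l ?divr_ge0 ?sqr_ge0// ler_wpM2l ?invr_ge0// ler_sum.
rewrite sumr_const_nat subn0 -(mulr_natr (c * _)).
have -> : 4 / h ^+ 2 * (J%:R^-1 * (c * (C * (h / t) ^+ 2) * J%:R)) = 4 * C * (c / t ^+ 2).
  by field; rewrite !gt_eqF.
rewrite [leRHS]mulrDl mul1r lerD2r ler_pdivlMr ?exprn_gt0//.
by rewrite ler_piMr// expr_le1// ltW.
Qed.

Lemma pair_mean_ge c1 e t (J : nat) : (0 < J)%N ->
  (forall j, c1 <= pair_term phi beta e t J j) -> c1 <= pair_mean phi beta e t J.
Proof.
move=> J0 H; rewrite /pair_mean /exp_sum_mean ler_pdivlMl ?ltr0n//.
apply: (@le_trans _ _ (\sum_(0 <= j < J) c1)).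
  by rewrite sumr_const_nat subn0 mulr_natl.
by apply: ler_sum => j _; exact: H.
Qed.

(** On E the mean of the pairing, at least c1, is at most |Z - mean| + |Z|; the first term is split
    as (tau + |Z - mean|^2 / tau) / 2 and the second is bounded by duality. Off E the same
    right-hand side is nonnegative. Integrating the inequality for c1 times the indicator of E gives
    the claim. *)
Lemma probability_duality_bound : exists c1 C, [/\ 0 < c1, 0 < C &
  forall (e t r tau eta' A B : R) L N N' (u : Omega -> int -> R[i]) (E : set Omega),
  0 < e <= t -> t <= 1 -> 4 * t <= r -> 0 < tau -> 0 < eta' ->
  (0 < L)%N -> (L <= N)%N -> (N <= N')%N ->
  pi *+ 2 / N'.*2%:R <= t -> pi *+ 2 / N'.*2%:R < 2^-1 :> R -> 0 <= A -> measurable E ->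
  (forall J w j, Normc.normc (cgrid e J w j) <= B) ->
  (forall w, E w ->
    [/\ zsum 0 N (fun n => bessel n `^ (-1) * sqn (coef e w n - u w n)) <= eta' ^+ 2,
        zsum 0 L (fun n => bessel n `^ (- s) * sqn (u w n)) <= A &
        zsum L N (fun n => bessel n `^ (- s) * sqn (u w n)) <= tau ^+ 2]) ->
  c1 * fine (P E) <=
    tau / 2
    + (2 * tau)^-1 * (C * ((expR (beta ^+ 2 * (16 * t / r)) - 1)
        + r `^ ((1 - beta ^+ 2) / 2) + e `^ (- beta ^+ 2) / N'.*2%:R))
    + (B ^+ 2 + C * (t `^ s ^+ 2 / t ^+ 2)) / (2 * N%:R)
    + t `^ s * \int[P]_w aliasing_error P X phi beta e N N'.*2 w
    + eta' / 2 * (1 + C * (t `^ s ^+ 2 / t ^+ 2))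
    + tau / 2 * (2 + C)
    + t `^ s / 2 * (bessel L `^ s * A + 1)].
Proof.
have [c1 [c2 [c10 c20 Hc]]] := pair_term_bounds hX hphi hbeta.
have [C1 C10 HV] := pair_variance_bound hX hphi hbeta.
have [C2 C20 HE] := Rintegral_field_energy_le.
exists c1, (C1 + C2); split => //; first exact: addr_gt0.
move=> e t r tau eta' A B L N N' u E et t1 tr tau0 eta0 L0 LN NN ht h2 A0 mE HB HEw.
have [e0 t0 e01 t01] := two_scales et t1.
have N'0 : (0 < N')%N by rewrite (leq_trans L0)// (leq_trans LN).
have J0 : (0 < N'.*2)%N by rewrite double_gt0.
have s01 : 0 <= s <= 1.
  case/andP: hbeta => b0 b1; rewrite divr_ge0 ?sqr_ge0//=.
  by rewrite ler_pdivrMr// mul1r (le_trans (_ : _ <= 1)) ?expr_le1 ?ltW// ltr1n.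
set J := N'.*2 in ht h2 J0 *; set c := t `^ s.
have c0 : 0 < c by exact: powR_gt0.
(* The frequency 1/t balances the two terms of the interpolation: by [lam1] and [lam2] the L^2 bound
   c^2 and the H^1 scale c^2 / t^2 both contribute exactly 1. *)
pose lam := t ^- 2; have lam0 : 0 < lam by rewrite invr_gt0 exprn_gt0.
have lamE a : lam `^ a = t `^ (- (2 * a)).
  rewrite /lam -powR_invn ?(ltW t0)// -powRrM; congr (_ `^ _).
  by rewrite mulNr.
have tD a b : t `^ a * t `^ b = t `^ (a + b).
  by rewrite powRD//; apply/implyP => _; rewrite gt_eqF.
have lam1 : lam `^ s * c ^+ 2 = 1.
  rewrite lamE /c (expr2 (t `^ s)) !tD (_ : - (2 * s) + (s + s) = 0) ?powRr0//; ring.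
have lam2 : lam `^ (s - 1) * (c ^+ 2 / t ^+ 2) = 1.
  rewrite -[t ^- 2]powR_invn ?(ltW t0)// lamE /c (expr2 (t `^ s)) !tD.
  by rewrite (_ : - (2 * (s - 1)) + (s + s - 2%:R) = 0) ?powRr0//; ring.
pose Z := pair_sum X phi beta e t J; pose zeta := pair_mean phi beta e t J.
pose V w := sqn (Z w - zeta%:C).
pose H := field_energy t J; pose T := aliasing_error P X phi beta e N J.
(* K1 collects the coefficients of the energy H in [duality_bound], K0 all deterministic terms; tau
   in K0 is tau / 2 times 1 + lam^s c^2. *)
pose K1 := (2 * N%:R)^-1 + eta' / 2 + tau / 2 * lam `^ (s - 1).
pose K0 := tau / 2 + B ^+ 2 / (2 * N%:R) + eta' / 2 + tau + c / 2 * (bessel L `^ s * A + 1).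
have NR : 0 < N%:R :> R by rewrite ltr0n (leq_trans L0).
have K10 : 0 <= K1.
  by rewrite !addr_ge0 ?invr_ge0 ?mulr_ge0 ?divr_ge0 ?powR_ge0 ?(ltW tau0) ?(ltW eta0)// ltW.
have K00 : 0 <= K0.
  rewrite !addr_ge0 ?divr_ge0 ?(ltW tau0) ?(ltW eta0) ?sqr_ge0 ?mulr_ge0 ?(ltW NR)//.
  - exact: ltW.
  - by rewrite addr_ge0// mulr_ge0// powR_ge0.
have V0 w : 0 <= V w by exact: sqn_ge0.
have H0 w : 0 <= H w by exact: field_energy_ge0.
have T0 w : 0 <= T w by exact: aliasing_error_ge0.
have iV : P.-integrable setT (EFin \o V).
  by apply: (integrable_sqn_exp_sum hX) => j; exact: rtest_kernel_diff.
have iH : P.-integrable setT (EFin \o H) by exact: integrable_field_energy.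
have iT : P.-integrable setT (EFin \o T) by exact: integrable_aliasing_error.
have zeta1 : c1 <= zeta.
  by apply: pair_mean_ge => // j; have /andP[] := Hc e t J j et t1.
pose rhs w := K0 + (2 * tau)^-1 * V w + K1 * H w + c * T w.
have path w : c1 * \1_E w <= rhs w.
  rewrite indicE; case: (boolP (w \in E)) => [|_]; last first.
    have k1 : 0 <= (2 * tau)^-1 * V w by rewrite mulr_ge0// invr_ge0 mulr_ge0 ?(ltW tau0).
    have k2 : 0 <= K1 * H w by exact: mulr_ge0.
    have k3 : 0 <= c * T w by apply: mulr_ge0 => //; exact: ltW.
    by rewrite mulr0 /rhs; apply: addr_ge0 => //; apply: addr_ge0 => //; exact: addr_ge0.
  rewrite inE => /HEw[h1 h2' h3]; rewrite mulr1.
  have [z1 z2] : Normc.normc (Z w - zeta%:C) <= (tau + V w / tau) / 2 /\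
      zeta <= Normc.normc (Z w - zeta%:C) + Normc.normc (Z w).
    split.
      rewrite /V /sqn; move: (Normc.normc _) => z.
      rewrite ler_pdivlMr//.
      have -> : tau + z ^+ 2 / tau = (tau ^+ 2 + z ^+ 2) / tau by field; rewrite gt_eqF.
      rewrite ler_pdivlMr//; have := sqr_ge0 (z - tau).
      have -> : (z - tau) ^+ 2 = tau ^+ 2 + z ^+ 2 - z * 2 * tau by ring.
      by rewrite subr_ge0.
    have Ez : Normc.normc zeta%:C = zeta.
      by rewrite normc_real ger0_norm// (le_trans (ltW c10)).
    have := le_normcD (- (Z w - zeta%:C)) (Z w).
    by rewrite normcN opprB subrK Ez.
  have Fb : J%:R^-1 * \sum_(0 <= j < J) sqn (cgrid e J w j) <= B ^+ 2.
    rewrite ler_pdivrMl ?ltr0n//.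
    apply: (@le_trans _ _ (\sum_(0 <= j < J) B ^+ 2)); last first.
      by rewrite sumr_const_nat subn0 mulr_natl.
    apply: ler_sum => j _; rewrite /sqn ler_sqr ?nnegrE ?normc_ge0//.
    exact: le_trans (normc_ge0 _) (HB J w j).
  have := @duality_bound R N' L N L0 LN NN (cgrid e J w) (wick_grid t J w)
    (coef e w) (u w) c (B ^+ 2) tau eta' A lam s c0 tau0 eta0 lam0 s01
    (wick_grid_periodic w t01 J0) (sqn_wick_grid t J w) Fb h1 h2' h3.
  rewrite pair_sumE// lam1 -[zsum 0 N (fun n => Normc.normc (dft _ _ n - _))]/(T w) => D.
  have hH := h1_bound_le N' w t01; rewrite -/J -/(H w) in hH.
  set h := h1_bound _ _ _ in D hH.
  apply: (le_trans zeta1); apply: (le_trans z2).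
  apply: (le_trans (lerD z1 D)).
  apply: (@le_trans _ _ (K0 + (2 * tau)^-1 * V w + K1 * h + c * T w)).
    rewrite le_eqVlt; apply/orP; left; apply/eqP; rewrite /K0 /K1.
    by move: (T w) (V w) => x y; field; rewrite !gt_eqF.
  by rewrite lerD2r lerD2l ler_wpM2l.
have i1 := integrable_prob_cst P K0.
have i2 := integrable_realZ measurableT (2 * tau)^-1 iV.
have i3 := integrable_realZ measurableT K1 iH.
have i4 := integrable_realZ measurableT c iT.
have i12 := integrable_realD measurableT i1 i2.
have i123 := integrable_realD measurableT i12 i3.
have irhs := integrable_realD measurableT i123 i4.
have iE : P.-integrable setT (EFin \o (fun w => c1 * \1_E w)).
  apply: integrable_realZ => //; apply: (@bounded_integrableP _ _ _ P _ 1).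
    exact: measurable_indic.
  by move=> w; rewrite indicE; case: (w \in E); rewrite ?normr1 ?normr0.
have : \int[P]_w (c1 * \1_E w) <= \int[P]_w rhs w by apply: le_Rintegral.
have -> : \int[P]_w (c1 * \1_E w) = c1 * fine (P E).
  rewrite RintegralZl//; last first.
    apply: (@bounded_integrableP _ _ _ P _ 1); first exact: measurable_indic.
    by move=> w; rewrite indicE; case: (w \in E); rewrite ?normr1 ?normr0.
  by rewrite /Rintegral integral_indic// setIT.
move=> /le_trans; apply.
rewrite /rhs RintegralD// RintegralD// RintegralD// !RintegralZl// Rintegral_prob_cst.
have hV := HV e t r J et t1 tr J0; rewrite -/(V _) in hV.
have hEH := HE t J t01 J0 ht h2.
have f0 : 0 <= (expR (beta ^+ 2 * (16 * t / r)) - 1) + r `^ ((1 - beta ^+ 2) / 2)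
    + e `^ (- beta ^+ 2) / J%:R.
  have r0 : 0 < r by apply: lt_le_trans tr; rewrite mulr_gt0.
  have f00 : 0 <= expR (beta ^+ 2 * (16 * t / r)) - 1.
    rewrite subr_ge0 -[leLHS]expR0 ler_expR mulr_ge0 ?sqr_ge0// divr_ge0 ?(ltW r0)//.
    by rewrite mulr_ge0// ltW.
  apply: addr_ge0; first by apply: addr_ge0 => //; exact: powR_ge0.
  by rewrite divr_ge0// powR_ge0.
set F := _ + _ + _ in hV f0 *.
have q0 : 0 <= c ^+ 2 / t ^+ 2 by rewrite divr_ge0// sqr_ge0.
set q := c ^+ 2 / t ^+ 2 in lam2 q0 hEH *.
have g1 : (2 * tau)^-1 * \int[P]_w V w <= (2 * tau)^-1 * ((C1 + C2) * F).
  rewrite ler_wpM2l ?invr_ge0 ?mulr_ge0 ?(ltW tau0)//; apply: (le_trans hV).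
  by rewrite ler_wpM2r// lerDl ltW.
have g2 : K1 * \int[P]_w H w <= K1 * ((C1 + C2) * q).
  rewrite ler_wpM2l//; by apply: (le_trans hEH); rewrite ler_wpM2r// lerDr ltW.
have -> : forall x, tau / 2 + x + (B ^+ 2 + (C1 + C2) * q) / (2 * N%:R) + c * \int[P]_w T w +
   eta' / 2 * (1 + (C1 + C2) * q) + tau / 2 * (2 + (C1 + C2)) + c / 2 * (bessel L `^ s * A + 1)
   = K0 + x + K1 * ((C1 + C2) * q) + c * \int[P]_w T w.
  move=> x; rewrite /K0 /K1.
  have -> : tau / 2 * (2 + (C1 + C2)) = tau + tau / 2 * ((lam `^ (s - 1) * q) * (C1 + C2)).
    by rewrite lam2; field.
  by field; rewrite gt_eqF.
by rewrite lerD2r; apply: lerD => //; rewrite lerD2l.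
Qed.

End duality_estimate.

(** * Sums over the integers and the almost sure statement *)

Section integer_series.
Context {R : realType}.
Implicit Types (F : int -> R).

Let window N : seq int := [seq m%:Z - N%:Z | m <- index_iota 0 N.*2].

Let window_uniq N : uniq (window N).
Proof. by rewrite map_inj_uniq ?iota_uniq// => m n /addIr[]. Qed.

Let zsum_window N F : zsum 0 N F = \sum_(i <- window N) F i.
Proof. by rewrite zsum_shift big_map. Qed.

Lemma zsum_le_esum N F : (forall n, 0 <= F n) ->
  ((zsum 0 N F)%:E <= \esum_(n in [set: int]) (F n)%:E)%E.
Proof.
move=> F0; apply: esum_ge; exists [set` window N].
  by split => //; exact: finite_seq.
by rewrite -fsbig_seq// sumEFin lee_fin zsum_window.
Qed.

Lemma esum_le_zsum F (c : R) : (forall n, 0 <= F n) -> (forall N, zsum 0 N F <= c) ->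
  (\esum_(n in [set: int]) (F n)%:E <= c%:E)%E.
Proof.
move=> F0 H; apply: ge_ereal_sup => _ [A [fA _] <-].
rewrite fsbig_finite// sumEFin lee_fin.
set r := finmap.enum_fset _.
pose N := (\max_(i <- r) absz i).+1.
apply: le_trans (H N); rewrite zsum_window; apply: ler_sum_subset => //.
  exact: finmap.fset_uniq.
move=> i ir; have iN : (absz i < N)%N by rewrite ltnS; exact: leq_bigmax_seq.
apply/mapP; exists (absz (i + N%:Z)).
  by rewrite mem_index_iota; move: iN; clear; lia.
by move: iN; clear; lia.
Qed.

(** Past some index the increasing partial sums are within tau of their supremum. L is the maximum
    of that index and an integer above c, so that it also serves as the bound of the sums. *)
Lemma zsum_tail_small F (c tau : R) : (forall n, 0 <= F n) -> 0 < tau ->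
  (forall N, zsum 0 N F <= c) ->
  exists2 L, (0 < L)%N & forall N, zsum 0 N F <= L%:R /\ zsum L N F <= tau.
Proof.
move=> F0 t0 H; pose E := [set zsum 0 N F | N in [set: nat]].
have sE : has_sup E by split; [exists (zsum 0 0 F), 0%N|exists c => _ [N _ <-]].
have [_ [L1 _ <-] HL1] := sup_adherent t0 sE.
pose L2 := (Num.truncn c).+1; exists (maxn L1 L2).
  by rewrite leq_max orbT.
move=> N; split.
  apply: (le_trans (H N)); apply: (@le_trans _ _ L2%:R); first by rewrite ltW// truncnS_gt.
  by rewrite ler_nat leq_maxr.
have [NL|LN] := leqP N (maxn L1 L2); first by rewrite /zsum big_geq// ltW.
have supN : zsum 0 N F <= sup E by apply: ub_le_sup; [case: sE|exists N].
have := @zsum_split R 0 L1 N F; rewrite leq0n/= => /(_ (leq_trans (leq_maxl _ _) (ltnW LN))).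
have := @ler_zsum_nat R (maxn L1 L2) N L1 N F F0 (leq_maxl _ _) (leqnn N).
by lra.
Qed.

Lemma lt_poweR_half (x : \bar R) (eta : R) : 0 < eta -> (0 <= x)%E ->
  (eta%:E < poweR x 2^-1)%E = ((eta ^+ 2)%:E < x)%E.
Proof.
move=> e0 x0; rewrite (poweR12_sqrt x0); case: x x0 => [x| |]//=; last by rewrite !ltry.
rewrite lee_fin !lte_fin => x0.
by rewrite -[in LHS]ltr_sqr ?nnegrE ?sqrtr_ge0 ?(ltW e0)// sqr_sqrtr.
Qed.

End integer_series.

Section almost_sure_irregularity.
Context {R : realType} {d : measure_display} {Omega : measurableType d}.
Variables (P : probability Omega R) (X M : Omega -> (R -> R[i]) -> R[i]).
Variables (phi : R -> R) (beta : R).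
Hypothesis hX : log_correlated_field P X.
Hypothesis hphi : mollifier phi.
Hypothesis hbeta : 0 < beta < 1.
Hypothesis hM : imaginary_chaos P beta phi X M.
Local Notation s := (beta ^+ 2 / 2).
Local Notation coef := (chaos_coef P X phi beta).
Local Notation u w n := (fourier_coef (M w) n).
Implicit Types (w : Omega) (tau : R).

Let cmeasurable_u n : cmeasurable (fun w => u w n).
Proof.
apply: cmeasurableM; first exact: cmeasurable_cst.
by case: hM => -[_ +] _ => /(_ _ (character_test n)).
Qed.

Definition sobolev_sum L N w := zsum L N (fun n => bessel n `^ (- s) * sqn (u w n)).

Let term_ge0 (a : R) w (v : int -> R[i]) n : 0 <= bessel n `^ a * sqn (v n).
Proof. by rewrite mulr_ge0 ?powR_ge0 ?sqn_ge0. Qed.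

Let measurable_sobolev_sum L N : measurable_fun setT (sobolev_sum L N).
Proof.
apply: measurable_zsum => n; apply: measurable_funM => //.
exact: measurable_sqn.
Qed.

Let measurable_le (f : Omega -> R) a : measurable_fun setT f -> measurable [set w | f w <= a].
Proof.
move=> mf; rewrite -[X in measurable X]setTI.
rewrite (_ : [set w | f w <= a] = f @^-1` `]-oo, a]); first exact: mf.
by apply/seteqP; split => w /=; rewrite in_itv.
Qed.

(* Using one bound L for the norm and for the start of the tail makes these
   events increase with L. *)
Definition tight_tail tau L : set Omega :=
  [set w | forall N, sobolev_sum 0 N w <= L%:R /\ sobolev_sum L N w <= tau].

Lemma measurable_tight_tail tau L : measurable (tight_tail tau L).
Proof.
rewrite (_ : tight_tail tau L = \bigcap_N ([set w | sobolev_sum 0 N w <= L%:R] `&`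
    [set w | sobolev_sum L N w <= tau])).
  by apply: bigcapT_measurable => N; apply: measurableI; exact: measurable_le.
by apply/seteqP; split => w H N; [move=> _|]; apply: H.
Qed.

Lemma tight_tail_nondecreasing tau L L' : (L <= L')%N ->
  tight_tail tau L `<=` tight_tail tau L'.
Proof.
move=> LL w H N; have [h1 h2] := H N; split.
  by apply: (le_trans h1); rewrite ler_nat.
by apply: le_trans h2; apply: ler_zsum_nat => // n; exact: term_ge0.
Qed.

Definition chaos_error e w : (R -> R[i]) -> R[i] :=
  fun psi => function_distribution (chaos_approx P beta phi X e w) psi - M w psi.

(** The ball of radius eta in H^-1, an admissible space since -1 < -1/2. Writing it with partial
    sums gives a countable intersection of measurable events. *)
Definition near_chaos e eta : set Omega :=
  [set w | forall N, zsum 0 N (fun n => bessel n `^ (-1) * sqn (coef e w n - u w n)) <= eta ^+ 2].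

Lemma near_chaosE e eta : 0 < eta ->
  [set w | (eta%:E < sobolev_norm (-1)%R (chaos_error e w))%E] =
  ~` near_chaos e eta.
Proof.
move=> e0; apply/seteqP.
have E w : (\esum_(n in [set: int]) (bessel n `^ (-1) * sqn (coef e w n - u w n))%:E)%E =
    sobolev_norm2 (-1) (chaos_error e w).
  by apply: eq_esum => n _; rewrite /fourier_coef mulrBr.
have T w n : 0 <= bessel n `^ (-1) * sqn (coef e w n - u w n).
  by rewrite mulr_ge0 ?powR_ge0 ?sqn_ge0.
have pos w : (0 <= sobolev_norm2 (-1) (chaos_error e w))%E.
  by rewrite -E; apply: esum_ge0 => n _; rewrite lee_fin; exact: T.
split => w /=.
  rewrite /sobolev_norm lt_poweR_half// -E => lt H; move: lt.
  by rewrite ltNge esum_le_zsum.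
move=> nH; rewrite /sobolev_norm lt_poweR_half// -E ltNge; apply/negP => le; apply: nH => N.
by rewrite -lee_fin; apply: le_trans le; exact: zsum_le_esum.
Qed.

Lemma measurable_near_chaos e eta : 0 < e <= 1 -> measurable (near_chaos e eta).
Proof.
move=> e01.
rewrite (_ : near_chaos e eta = \bigcap_N [set w | zsum 0 N (fun n =>
    bessel n `^ (-1) * sqn (coef e w n - u w n)) <= eta ^+ 2]).
  apply: bigcapT_measurable => N; apply: measurable_le.
  apply: measurable_zsum => n; apply: measurable_funM => //; apply: measurable_sqn.
  by apply: cmeasurableB => //; exact: cmeasurable_chaos_coef.
by apply/seteqP; split => w H N; [move=> _|]; apply: H.
Qed.

Let exists_small_scale (a b K : R) : 0 < a -> 0 < b -> 0 < K ->
  exists t : R, [/\ 0 < t <= 1, t <= a, t <= b & t `^ s * K <= 1].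
Proof.
move=> a0 b0 K0; have s0 : 0 < s by case/andP: hbeta => *; rewrite divr_gt0// exprn_gt0.
pose k := K^-1 `^ s^-1; have k0 : 0 < k by rewrite powR_gt0// invr_gt0.
exists (Num.min (Num.min 1 a) (Num.min b k)).
rewrite !lt_min !ge_min ltr01 a0 b0 k0 !lexx ?orbT; split => //.
rewrite -ler_pdivlMr// mul1r.
have -> : K^-1 = k `^ s.
  by rewrite /k -powRrM mulVf ?gt_eqF// powRr1// invr_ge0 ltW.
rewrite ge0_ler_powR ?nnegrE ?(ltW s0) ?(ltW k0) ?ge_min ?lexx ?orbT//.
by rewrite !le_min ler01 !ltW.
Qed.

(** The parameters r, t, eta, e, N, N' are fixed in this order, each in terms of the previous ones,
    so that every error is a multiple of tau. L affects how small t must be, but not K. The summand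
    1 of K pays for the complement of [near_chaos]. *)
Lemma tight_tail_probability : exists2 K, 0 < K & forall tau L, 0 < tau <= 1 -> (0 < L)%N ->
  fine (P (tight_tail (tau ^+ 2) L)) <= K * tau.
Proof.
have [c1 [C [c10 C0 HD]]] := probability_duality_bound hX hphi hbeta.
exists ((6 + 2 * C) / c1 + 1); first by rewrite addr_gt0// divr_gt0// addr_gt0// mulr_gt0.
move=> tau L /andP[tau0 tau1] L0.
have /andP[b0 b1] := hbeta.
have tau20 : 0 < tau ^+ 2 by rewrite exprn_gt0.
have bb0 : 0 < beta ^+ 2 by rewrite exprn_gt0.
have bb1 : beta ^+ 2 < 1 by rewrite expr_lt1// ltW.
pose g := (1 - beta ^+ 2) / 2; have g0 : 0 < g by rewrite divr_gt0// subr_gt0.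
(* The variance will be divided by 2 tau, so each of its three parts has to be at most tau^2; here
   r^g = tau^2. *)
pose r := (tau ^+ 2) `^ g^-1; have r0 : 0 < r by exact: powR_gt0.
have rE : r `^ g = tau ^+ 2 by rewrite /r -powRrM mulVf ?gt_eqF// powRr1// ltW.
have l0 : 0 < ln (1 + tau ^+ 2) by rewrite ln_gt0// ltrDl.
pose A : R := L%:R.
have K0 : 0 < (bessel L `^ s * A + 1) / tau.
  by rewrite divr_gt0// ltr_wpDl// mulr_ge0// powR_ge0.
(* The bound b gives beta^2 (16 t / r) <= ln (1 + tau^2), the far part of the variance; K makes the
   low frequencies, those below L, at most tau. *)
have [||t [t01 tr tl tK]] := exists_small_scale (a := r / 4)
  (b := ln (1 + tau ^+ 2) * r / (16 * beta ^+ 2)) _ _ K0.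
- by rewrite divr_gt0.
- by rewrite divr_gt0 ?mulr_gt0.
have /andP[t0 t1] := t01.
pose c := t `^ s; have c0 : 0 < c by exact: powR_gt0.
pose q := c ^+ 2 / t ^+ 2; have q0 : 0 <= q by rewrite divr_ge0// sqr_ge0.
have Cq0 : 0 < 1 + C * q by rewrite ltr_pwDl// mulr_ge0// ltW.
(* The H^1 scale q blows up as t tends to 0; the distance eta from M_e to M compensates for it,
   which is why e is chosen after t. *)
pose eta := tau / (1 + C * q); have eta0 : 0 < eta by rewrite divr_gt0.
have [e [e0 et Pe]] : exists e, [/\ 0 < e, e <= t & fine (P (~` near_chaos e eta)) <= tau].
  have h1 : - 1 < - 2^-1 :> R by rewrite ltrN2 invf_lt1// ltr1n.
  have [_ /(_ _ h1 _ eta0)/fine_cvg/cvgrPdist_le/(_ _ tau0) cv] := hM.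
  have : \forall e \near (0 : R)^'+, [/\ 0 < e, e <= t & fine (P (~` near_chaos e eta)) <= tau].
    near=> e; split.
    - by near: e; exact: nbhs_right_gt.
    - by near: e; exact: nbhs_right_le.
    - rewrite -near_chaosE//.
      have : `|0 - fine (P [set w | (eta%:E < sobolev_norm (-1)%R (chaos_error e w))%E])| <= tau.
        by near: e; exact: cv.
      by rewrite sub0r normrN; apply: le_trans; exact: ler_norm.
  by move=> /filter_ex.
have e01 : 0 < e <= 1 by rewrite e0 (le_trans et).
have [B B0 HB] := chaos_grid_bounded hX hphi beta e01.
(* N has to beat the bound B of M_e, which depends on e. *)
pose N := (L + (Num.truncn ((B ^+ 2 + C * q) / (2 * tau))).+1)%N.
have [J0 HJ0] := Rintegral_aliasing_error_small hX hphi beta e01 N (divr_gt0 tau0 c0).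
pose k1 := (Num.truncn (pi *+ 2 / t)).+1; pose k2 := (Num.truncn (pi *+ 4 : R)).+1.
pose k3 := (Num.truncn (e `^ (- beta ^+ 2) / tau ^+ 2)).+1.
(* J0 controls the aliasing, k1 and k2 make the mesh at most t and less than 1/2, and k3 handles the
   diagonal of the variance. *)
pose N' := (N + J0 + k1 + k2 + k3)%N.
have big k : (k <= N')%N -> k%:R <= N'.*2%:R :> R.
  by move=> kN; rewrite ler_nat (leq_trans kN)// -addnn leq_addr.
have N'0 : (0 < N'.*2)%N by rewrite double_gt0 /N' /k3 addnS.
have JR : 0 < N'.*2%:R :> R by rewrite ltr0n.
have over (x y : R) k : 0 < y -> (Num.truncn (x / y) < k)%N -> (k <= N')%N -> x / N'.*2%:R <= y.
  move=> y0 xk kN; rewrite ler_pdivrMr// mulrC -ler_pdivrMr//.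
  apply: (le_trans _ (big _ kN)); rewrite ltW//; apply: lt_le_trans (truncnS_gt _) _.
  by rewrite ler_nat.
have ht : pi *+ 2 / N'.*2%:R <= t.
  by apply: (over _ _ k1) => //; rewrite /N'; clear; lia.
have h2 : pi *+ 2 / N'.*2%:R < 2^-1 :> R.
  rewrite ltr_pdivrMr// ltr_pdivlMl//.
  have -> : 2 * (pi *+ 2) = pi *+ 4 :> R by rewrite mulr_natl -mulrnA.
  apply: (lt_le_trans (truncnS_gt _)); apply: (@big k2).
  by rewrite /N'; clear; lia.
have mE : measurable (tight_tail (tau ^+ 2) L `&` near_chaos e eta).
  by apply: measurableI; [exact: measurable_tight_tail|exact: measurable_near_chaos].
have LN : (L <= N)%N by exact: leq_addr.
have NN : (N <= N')%N by rewrite /N'; clear; lia.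
have ete : 0 < e <= t by rewrite e0.
have tr4 : 4 * t <= r by rewrite mulrC -ler_pdivlMr.
have HEw w : (tight_tail (tau ^+ 2) L `&` near_chaos e eta) w ->
    [/\ zsum 0 N (fun n => bessel n `^ (-1) * sqn (coef e w n - u w n)) <= eta ^+ 2,
        zsum 0 L (fun n => bessel n `^ (- s) * sqn (u w n)) <= A &
        zsum L N (fun n => bessel n `^ (- s) * sqn (u w n)) <= tau ^+ 2].
  move=> [H1 H2]; split; first exact: H2.
    by have [] := H1 L.
  by have [] := H1 N.
have := HD e t r tau eta A B L N N' (fun w n => u w n) _
  ete t1 tr4 tau0 eta0 L0 LN NN ht h2 (ler0n _ _) mE HB HEw.
rewrite -/c -/q -/g rE => main.
have m1 : expR (beta ^+ 2 * (16 * t / r)) - 1 <= tau ^+ 2.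
  rewrite lerBlDl -[leRHS]lnK ?posrE ?addr_gt0// ler_expR.
  have -> : beta ^+ 2 * (16 * t / r) = t * (16 * beta ^+ 2) / r by ring.
  by rewrite ler_pdivrMr// -ler_pdivlMr// mulr_gt0.
have m2 : e `^ (- beta ^+ 2) / N'.*2%:R <= tau ^+ 2.
  by apply: (over _ _ k3) => //; rewrite /N'; clear; lia.
have m3 : (B ^+ 2 + C * q) / (2 * N%:R) <= tau.
  have NR : 0 < N%:R :> R by rewrite ltr0n (leq_trans L0).
  have h : (B ^+ 2 + C * q) / (2 * tau) <= N%:R.
    by apply: (le_trans (ltW (truncnS_gt _))); rewrite ler_nat /N leq_addl.
  move: h; rewrite !ler_pdivrMr ?mulr_gt0//.
  by have -> : N%:R * (2 * tau) = tau * (2 * N%:R) by ring.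
have m4 : c * \int[P]_w aliasing_error P X phi beta e N N'.*2 w <= tau.
  rewrite -ler_pdivlMl// mulrC; apply: HJ0.
  by rewrite /N' /k3; clear; lia.
have m5 : eta / 2 * (1 + C * q) <= tau.
  by rewrite mulrAC /eta divfK ?gt_eqF// ler_pdivrMr// ler_peMr ?ler1n ?(ltW tau0).
have m6 : c / 2 * (bessel L `^ s * A + 1) <= tau.
  move: tK; rewrite -/c mulrA ler_pdivrMr// mul1r => h.
  have bA : 0 <= c * (bessel L `^ s * A + 1).
    by apply: mulr_ge0; [exact: ltW|rewrite addr_ge0// mulr_ge0// powR_ge0].
  by apply: le_trans h; rewrite mulrAC ler_pdivrMr// ler_peMr// ler1n.
have m7 : (2 * tau)^-1 * (C * (expR (beta ^+ 2 * (16 * t / r)) - 1 + tau ^+ 2 +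
    e `^ (- beta ^+ 2) / N'.*2%:R)) <= C * tau * (3 / 2).
  have -> : C * tau * (3 / 2) = (2 * tau)^-1 * (C * (tau ^+ 2 + tau ^+ 2 + tau ^+ 2)).
    by field; rewrite gt_eqF.
  rewrite ler_wpM2l ?invr_ge0 ?mulr_ge0 ?(ltW tau0)// ler_wpM2l ?(ltW C0)//.
  by rewrite !lerD.
have PE : fine (P (tight_tail (tau ^+ 2) L `&` near_chaos e eta)) <= (6 + 2 * C) / c1 * tau.
  rewrite mulrAC ler_pdivlMr// mulrC; apply: (le_trans main).
  have -> : (6 + 2 * C) * tau = tau / 2 + C * tau * (3 / 2) + tau + tau + tau
      + tau / 2 * (2 + C) + tau + tau / 2 by field.
  apply: ler_wpDr; first by rewrite divr_ge0// ltW.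
  by repeat (apply: lerD => //).
have mT := measurable_tight_tail (tau ^+ 2) L.
have mNC := measurableC (measurable_near_chaos eta e01).
have PU : (P (tight_tail (tau ^+ 2) L) <=
    P (tight_tail (tau ^+ 2) L `&` near_chaos e eta) + P (~` near_chaos e eta))%E.
  apply: le_trans (measureU2 _ mE mNC); apply: le_measure; rewrite ?inE//.
    exact: measurableU.
  by move=> w Hw; have [?|?] := pselect (near_chaos e eta w); [left|right].
have fin A' : measurable A' -> P A' \is a fin_num by exact: fin_num_measure.
move: PU; rewrite -(fineK (fin _ mT)) -(fineK (fin _ mE)) -(fineK (fin _ mNC)) -EFinD lee_fin.
by move=> /le_trans; apply; rewrite mulrDl mul1r lerD.
Unshelve. all: by end_near. Qed.

(** E is a measurable set containing every sample with finite norm. Its indices are successors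
    because [tight_tail_probability] asks for a positive L. *)
Lemma ae_not_sobolev_space : {ae P, forall w, ~ sobolev_space (- s) (M w)}.
Proof.
have [K K0 HK] := tight_tail_probability.
pose E := \bigcup_L tight_tail 1 L.+1.
have mE : measurable E by apply: bigcupT_measurable => L; exact: measurable_tight_tail.
(* On E all partial sums are bounded, so any smaller tail size is reached by starting the tail
   later; E itself does not depend on tau. *)
have sub tau : 0 < tau -> E `<=` \bigcup_L tight_tail (tau ^+ 2) L.+1.
  move=> tau0 w [L _ HL].
  have [L' L'0 HL'] := @zsum_tail_small R (fun n => bessel n `^ (- s) * sqn (u w n)) L.+1%:R
    (tau ^+ 2) (fun n => term_ge0 _ w _ n) (exprn_gt0 2 tau0) (fun N => (HL N).1).
  by exists L'.-1 => //; rewrite prednK.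
have PE tau : 0 < tau <= 1 -> (P E <= (K * tau)%:E)%E.
  move=> tau01; have /andP[tau0 _] := tau01.
  have mt : measurable (\bigcup_L tight_tail (tau ^+ 2) L.+1).
    by apply: bigcupT_measurable => L; exact: measurable_tight_tail.
  apply: (@le_trans _ _ (P (\bigcup_L tight_tail (tau ^+ 2) L.+1))).
    by apply: le_measure; rewrite ?inE//; exact: sub.
  have cv := @nondecreasing_cvg_mu _ _ _ P (fun L => tight_tail (tau ^+ 2) L.+1)
    (fun L => measurable_tight_tail _ _) mt.
  rewrite -(cvg_lim _ (cv _))//; last first.
    by move=> m n mn; apply/subsetPset; exact: tight_tail_nondecreasing.
  apply: lime_le; first by apply/cvg_ex; eexists; apply: cv; move=> m n mn; apply/subsetPset; exact: tight_tail_nondecreasing.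
  near=> L; rewrite /= -[leLHS]fineK ?lee_fin; last by apply: fin_num_measure; exact: measurable_tight_tail.
  exact: HK.
exists E; split => //.
  apply/eqP; rewrite eq_le measure_ge0 andbT.
  apply/lee_addgt0Pr => x x0; rewrite add0e.
  have tau01 : 0 < Num.min 1 (x / K) <= 1 by rewrite lt_min ltr01 divr_gt0//= ge_min lexx.
  apply: (le_trans (PE _ tau01)); rewrite lee_fin mulrC -ler_pdivlMr// ge_min lexx orbT//.
move=> w /= /contrapT[_ fin].
have T n : 0 <= bessel n `^ (- s) * sqn (u w n) by exact: (term_ge0 _ w).
have fn : sobolev_norm2 (- s) (M w) \is a fin_num.
  by rewrite ge0_fin_numE//; apply: esum_ge0 => n _; rewrite lee_fin; exact: T.
have H N : zsum 0 N (fun n => bessel n `^ (- s) * sqn (u w n)) <=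
    fine (sobolev_norm2 (- s) (M w)).
  by rewrite -lee_fin fineK//; exact: zsum_le_esum.
have [L L0 HL] := zsum_tail_small T ltr01 H.
by exists L.-1 => //; rewrite prednK.
Unshelve. all: by end_near. Qed.

End almost_sure_irregularity.

Theorem corollary1p2 (R : realType) (d : measure_display)
    (Omega : measurableType d) (P : probability Omega R)
    (beta : R) (phi : R -> R) (X M : Omega -> (R -> R[i]) -> R[i])
    (hbeta : 0 < beta < 1)
    (hphi : mollifier phi)
    (hX : log_correlated_field P X)
    (hM : imaginary_chaos P beta phi X M) :
  {ae P, forall w, ~ sobolev_space (- (beta ^+ 2 / 2)) (M w)}.
Proof. exact: (ae_not_sobolev_space hX hphi hbeta hM). Qed.
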